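(* Let $\Bbbk$ be a non-zero commutative ring which is $2$-torsion free. If $\mathfrak g$ is an admissible Lie superalgebra over $\Bbbk$, then there exists a unit-preserving, left $U(\mathfrak g_0)$-module super-coalgebra isomorphism $$U(\mathfrak g_0)\otimes\wedge(\mathfrak g_1)\overset{\simeq}{\longrightarrow}\mathbf{U}(\mathfrak g).$$ Here ''unit-preserving'' means that the isomorphism sends $1\otimes1$ to $1$.
   Context: $2$-torsion free means that $2a=0$ implies $a=0$ for $a\in\Bbbk$. $\otimes$ is over $\Bbbk$. ''Super'' means $\mathbb{Z}_2$-graded; supermodules form a symmetric tensor category with $c_{V,W}(v\otimes w)=(-1)^{|v||w|}w\otimes v$, and super-objects are taken in this category. A Lie superalgebra is a supermodule $\mathfrak g$ with a super-linear map $[\ ,\ ]:\mathfrak g\otimes\mathfrak g\to\mathfrak g$ such that (i) $[u,u]=0$ for $u\in\mathfrak g_0$; (ii) $[[v,v],v]=0$ for $v\in\mathfrak g_1$; (iii) $[\ ,\ ]\circ(\mathrm{id}+c_{\mathfrak g,\mathfrak g})=0$; (iv) $[[\ ,\ ],\ ]\circ(\mathrm{id}+c_{\mathfrak g,\mathfrak g\otimes\mathfrak g}+c_{\mathfrak g\otimes\mathfrak g,\mathfrak g})=0$. It is admissible if (A1) $\mathfrak g_0$ is $\Bbbk$-flat, (A2) $\mathfrak g_1$ is $\Bbbk$-free, (A3) for every $v\in\mathfrak g_1$ there is $u\in\mathfrak g_0$ with $[v,v]=2u$; such $u$ is unique and denoted $\frac12[v,v]$. The universal envelope $\mathbf{U}(\mathfrak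 g)$ is the quotient Hopf superalgebra of the tensor algebra $\mathbf{T}(\mathfrak g)$ (elements of $\mathfrak g$ being primitive) by the Hopf super-ideal generated by $zw-(-1)^{|z||w|}wz-[z,w]$ and $v^2-\frac12[v,v]$, for homogeneous $z,w\in\mathfrak g$ and $v\in\mathfrak g_1$. $U(\mathfrak g_0)$ is the usual universal enveloping algebra of the Lie algebra $\mathfrak g_0$, a cocommutative Hopf algebra; the inclusion $\mathfrak g_0\subset\mathfrak g$ induces a Hopf superalgebra map $U(\mathfrak g_0)\to\mathbf{U}(\mathfrak g)$, by which $\mathbf{U}(\mathfrak g)$ is a left $U(\mathfrak g_0)$-module. The exterior algebra $\wedge(\mathfrak g_1)$ is $\mathbf{T}(\mathfrak g_1)$ modulo all $v^2$, $v\in\mathfrak g_1$, a Hopf superalgebra in which the elements of $\mathfrak g_1$ are odd primitives. *)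

(* Defs.v *)
From HB Require Import structures.
From mathcomp Require Import all_boot all_algebra.
From mathcomp Require Import boolp.

Set Implicit Arguments.
Unset Strict Implicit.
Unset Printing Implicit Defensive.

Import GRing.Theory.

Local Open Scope ring_scope.
Local Open Scope quotient_scope.

Section TensorType.
Context (k : comNzRingType) (V W : lmodType k).

(* A finite sequence of pairs stands for the sum of the corresponding pure
   tensors; [tens_rel] is the least additive congruence on these formal sums
   that makes (v, w) |-> [:: (v, w)] k-bilinear. *)
Inductive tens_rel : seq (V * W) -> seq (V * W) -> Prop :=
| TensRefl s : tens_rel s s
| TensSym s t : tens_rel s t -> tens_rel t s
| TensTrans t s u : tens_rel s t -> tens_rel t u -> tens_rel s u
| TensCat s s' t t' :
    tens_rel s s' -> tens_rel t t' -> tens_rel (s ++ t) (s' ++ t')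
| TensC s t : tens_rel (s ++ t) (t ++ s)
| Tens0 w : tens_rel [:: (0, w)] [::]
| TensDl v v' w : tens_rel [:: (v + v', w)] [:: (v, w); (v', w)]
| TensDr v w w' : tens_rel [:: (v, w + w')] [:: (v, w); (v, w')]
| TensZ a v w : tens_rel [:: (a *: v, w)] [:: (v, a *: w)].

Definition tens_eqv : rel (seq (V * W)) := fun s t => `[< tens_rel s t >].

Lemma tens_eqv_refl : reflexive tens_eqv.
Proof. by move=> s; apply/asboolP; apply: TensRefl. Qed.

Lemma tens_eqv_sym : symmetric tens_eqv.
Proof. by move=> s t; apply/asboolP/asboolP; apply: TensSym. Qed.

Lemma tens_eqv_trans : transitive tens_eqv.
Proof.
by move=> t s u /asboolP st /asboolP tu; apply/asboolP; apply: TensTrans tu.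
Qed.

Canonical tens_equiv :=
  EquivRel tens_eqv tens_eqv_refl tens_eqv_sym tens_eqv_trans.

Definition tensor := {eq_quot tens_equiv}.

HB.instance Definition _ := Choice.on tensor.
HB.instance Definition _ := EqQuotient.on tensor.

Definition tpi (s : seq (V * W)) : tensor := \pi_tensor s.

Lemma tpiP s t : tens_rel s t <-> tpi s = tpi t.
Proof.
split=> [st | /eqmodP /asboolP //].
by apply/eqmodP/asboolP.
Qed.

Lemma tpiK x : tpi (repr x) = x. Proof. exact: reprK. Qed.

Lemma repr_tpi s : tens_rel (repr (tpi s)) s.
Proof. by apply/tpiP; rewrite tpiK. Qed.

Definition tadd (x y : tensor) := tpi (repr x ++ repr y).
Definition tscale (a : k) (x : tensor) :=
  tpi [seq (a *: p.1, p.2) | p <- repr x].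

Lemma tadd_pi s t : tadd (tpi s) (tpi t) = tpi (s ++ t).
Proof. by apply/tpiP/TensCat; apply: repr_tpi. Qed.

Lemma tscale_rel a s t : tens_rel s t ->
  tens_rel [seq (a *: p.1, p.2) | p <- s] [seq (a *: p.1, p.2) | p <- t].
Proof.
elim=> {s t} /=.
- by move=> s; apply: TensRefl.
- by move=> s t _; apply: TensSym.
- by move=> t s u _ st _ tu; apply: TensTrans st tu.
- by move=> s s' t t' _ ss' _ tt'; rewrite !map_cat; apply: TensCat.
- by move=> s t; rewrite !map_cat; apply: TensC.
- by move=> w; rewrite scaler0; apply: Tens0.
- by move=> v v' w; rewrite scalerDr; apply: TensDl.
- by move=> v w w'; apply: TensDr.
- by move=> b v w; rewrite scalerA mulrC -scalerA; apply: TensZ.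
Qed.

Lemma tscale_pi a s : tscale a (tpi s) = tpi [seq (a *: p.1, p.2) | p <- s].
Proof. by apply/tpiP/tscale_rel/repr_tpi. Qed.

Lemma tpi_cons p s : tpi (p :: s) = tadd (tpi [:: p]) (tpi s).
Proof. by rewrite tadd_pi. Qed.

Lemma taddA : associative tadd.
Proof.
by move=> x y z; rewrite -[x]tpiK -[y]tpiK -[z]tpiK !tadd_pi catA.
Qed.

Lemma taddC : commutative tadd.
Proof. by move=> x y; apply/tpiP/TensC. Qed.

Lemma tadd0 : left_id (tpi [::]) tadd.
Proof. by move=> x; rewrite -[x]tpiK tadd_pi. Qed.

Lemma taddN : left_inverse (tpi [::]) (tscale (-1)) tadd.
Proof.
move=> x; rewrite -[x]tpiK tscale_pi.
elim: (repr x) => [|[v w] s IHs]; first by rewrite tadd_pi.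
rewrite map_cons [tpi (_ :: map _ _)]tpi_cons (tpi_cons (v, w)).
set N := tpi (map _ _) in IHs *.
rewrite -taddA [tadd N _]taddC -taddA [tadd _ N]taddC IHs taddA taddC tadd0.
rewrite tadd_pi; apply/tpiP; apply: TensTrans (Tens0 w).
rewrite -[X in tens_rel _ [:: (X, w)]](addNr v) scaleN1r.
exact/TensSym/TensDl.
Qed.

HB.instance Definition _ :=
  GRing.isZmodule.Build tensor taddA taddC tadd0 taddN.

Lemma taddE x y : tadd x y = x + y. Proof. by []. Qed.

Lemma tpi_cat s t : tpi (s ++ t) = tpi s + tpi t.
Proof. by rewrite -tadd_pi. Qed.

Lemma tscaleA a b x : tscale a (tscale b x) = tscale (a * b) x.
Proof.
rewrite -[x]tpiK !tscale_pi -map_comp; congr tpi.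
by apply: eq_map => p /=; rewrite scalerA.
Qed.

Lemma tscale1 : left_id 1 tscale.
Proof.
move=> x; rewrite -[x]tpiK tscale_pi; congr tpi.
by rewrite -[RHS]map_id; apply: eq_map => -[v w]; rewrite /= scale1r.
Qed.

Lemma tscaleDr : right_distributive tscale +%R.
Proof.
by move=> a x y; rewrite -[x]tpiK -[y]tpiK -tpi_cat !tscale_pi map_cat tpi_cat.
Qed.

Lemma tscaleDl x : {morph tscale^~ x : a b / a + b}.
Proof.
move=> a b; rewrite -[x]tpiK !tscale_pi.
elim: (repr x) => [|[v w] s IHs] /=; first by rewrite -tpi_cat.
rewrite [LHS]tpi_cons (tpi_cons (a *: v, w)) (tpi_cons (b *: v, w)).
rewrite IHs !taddE addrACA; congr (_ + _).
by rewrite -tpi_cat scalerDl; apply/tpiP/TensDl.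
Qed.

HB.instance Definition _ :=
  GRing.Zmodule_isLmodule.Build k tensor tscaleA tscale1 tscaleDr tscaleDl.

Definition ptens (v : V) (w : W) : tensor := tpi [:: (v, w)].

End TensorType.

Notation "v *t w" := (ptens v w) (at level 40, left associativity).

Section TensorTheory.
Context (k : comNzRingType) (V W : lmodType k).
Implicit Types (x y : tensor V W).

Lemma ptensDl v v' (w : W) : (v + v' : V) *t w = v *t w + v' *t w.
Proof. by rewrite -tpi_cat; apply/tpiP/TensDl. Qed.

Lemma ptensDr (v : V) (w w' : W) : v *t (w + w') = v *t w + v *t w'.
Proof. by rewrite -tpi_cat; apply/tpiP/TensDr. Qed.

Lemma ptensZl a (v : V) (w : W) : (a *: v) *t w = a *: (v *t w).
Proof. exact: (esym (tscale_pi a [:: (v, w)])). Qed.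

Lemma ptensZr a (v : V) (w : W) : v *t (a *: w) = a *: (v *t w).
Proof. by rewrite -ptensZl; apply/esym/tpiP/TensZ. Qed.

Lemma ptens0l (w : W) : (0 : V) *t w = 0.
Proof. by rewrite -(scale0r 0) ptensZl scale0r. Qed.

Lemma ptens0r (v : V) : v *t (0 : W) = 0.
Proof. by rewrite -(scale0r 0) ptensZr scale0r. Qed.

Lemma ptensNl (v : V) (w : W) : (- v) *t w = - (v *t w).
Proof. by rewrite -scaleN1r ptensZl scaleN1r. Qed.

Lemma ptensNr (v : V) (w : W) : v *t (- w) = - (v *t w).
Proof. by rewrite -scaleN1r ptensZr scaleN1r. Qed.

Lemma tpi_sum s : tpi s = \sum_(p <- s) (p.1 : V) *t (p.2 : W).
Proof.
elim: s => [|[v w] s IHs]; first by rewrite big_nil.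
by rewrite big_cons -cat1s tpi_cat IHs.
Qed.

Lemma tensorE x : x = \sum_(p <- repr x) p.1 *t p.2.
Proof. by rewrite -tpi_sum tpiK. Qed.

Lemma tensor_ind (P : tensor V W -> Prop) :
    P 0 -> (forall x y, P x -> P y -> P (x + y)) ->
    (forall v w, P (v *t w)) -> forall x, P x.
Proof.
by move=> P0 PD Pp x; rewrite (tensorE x); apply: big_ind => // p _; apply: Pp.
Qed.

(* Universal property: for bilinear [f], [tlift f] is the linear map with
   v *t w |-> f v w. *)
Definition tlift (P : lmodType k) (f : V -> W -> P) x : P :=
  \sum_(p <- repr x) f p.1 p.2.

Definition bilin (P : lmodType k) (f : V -> W -> P) :=
  (forall w, linear (f^~ w)) /\ (forall v, linear (f v)).

Section Lift.
Context (P : lmodType k) (f : V -> W -> P).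
Hypothesis fL : bilin f.

Let fDl v v' w : f (v + v') w = f v w + f v' w.
Proof. by have := fL.1 w 1 v v'; rewrite !scale1r. Qed.
Let fDr v w w' : f v (w + w') = f v w + f v w'.
Proof. by have := fL.2 v 1 w w'; rewrite !scale1r. Qed.
Let f0l w : f 0 w = 0.
Proof. by apply: (addrI (f 0 w)); rewrite -fDl !addr0. Qed.
Let f0r v : f v 0 = 0.
Proof. by apply: (addrI (f v 0)); rewrite -fDr !addr0. Qed.
Let fZl a v w : f (a *: v) w = a *: f v w.
Proof. by have := fL.1 w a v 0; rewrite f0l !addr0. Qed.
Let fZr a v w : f v (a *: w) = a *: f v w.
Proof. by have := fL.2 v a w 0; rewrite f0r !addr0. Qed.

Lemma tlift_pi s : tlift f (tpi s) = \sum_(p <- s) f p.1 p.2.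
Proof.
rewrite /tlift; move: (repr (tpi s)) (repr_tpi s) => t; elim=> {s t} //=.
- by move=> t s u _ -> _ ->.
- by move=> s s' t t' _ e _ e'; rewrite !big_cat /= e e'.
- by move=> s t; rewrite !big_cat /= addrC.
- by move=> w; rewrite big_seq1 big_nil f0l.
- by move=> v v' w; rewrite big_seq1 big_cons big_seq1 fDl.
- by move=> v w w'; rewrite big_seq1 big_cons big_seq1 fDr.
- by move=> a v w; rewrite !big_seq1 fZl fZr.
Qed.

Lemma tliftE v w : tlift f (v *t w) = f v w.
Proof. by rewrite tlift_pi big_seq1. Qed.

Lemma tlift_linear : linear (tlift f).
Proof.
move=> a x y; rewrite -[x]tpiK -[y]tpiK [a *: _]tscale_pi -tpi_cat !tlift_pi.
rewrite big_cat big_map scaler_sumr; congr (_ + _).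
by apply: eq_bigr => p _ /=; rewrite fZl.
Qed.

Lemma tliftZ a x : tlift f (a *: x) = a *: tlift f x.
Proof.
rewrite -[x]tpiK [a *: _]tscale_pi !tlift_pi big_map scaler_sumr.
by apply: eq_bigr => p _ /=; rewrite fZl.
Qed.

End Lift.

Lemma tensor_ext (P : lmodType k) (f g : {linear tensor V W -> P}) :
  (forall v w, f (v *t w) = g (v *t w)) -> f =1 g.
Proof.
move=> fg; elim/tensor_ind => [|x y ex ey|//]; first by rewrite !linear0.
by rewrite !linearD ex ey.
Qed.

End TensorTheory.

Section TensorMap.
Context (k : comNzRingType).

Definition tmap (V V' W W' : lmodType k) (f : V -> V') (g : W -> W') :
  tensor V W -> tensor V' W' := tlift (fun v w => f v *t g w).

Section Linear.
Context (V V' W W' : lmodType k) (f : {linear V -> V'}) (g : {linear W -> W'}).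

Let b : bilin (fun v w => f v *t g w).
Proof.
split=> u a x y; rewrite linearP.
  by rewrite ptensDl ptensZl.
by rewrite ptensDr ptensZr.
Qed.

Lemma tmapE v w : tmap f g (v *t w) = f v *t g w.
Proof. exact: tliftE b _ _. Qed.

HB.instance Definition _ :=
  GRing.isLinear.Build k (tensor V W) (tensor V' W') *:%R (tmap f g)
    (tlift_linear b).

End Linear.
End TensorMap.
Lemma tmap_eq (k : comNzRingType) (V V' W W' : lmodType k)
    (f f' : V -> V') (g g' : W -> W') :
  f =1 f' -> g =1 g' -> tmap f g =1 tmap f' g'.
Proof. by move=> e e' x; apply: eq_bigr => p _; rewrite e e'. Qed.

Lemma tmap_comp (k : comNzRingType) (V V' V'' W W' W'' : lmodType k)
    (f : {linear V -> V'}) (f' : {linear V' -> V''})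
    (g : {linear W -> W'}) (g' : {linear W' -> W''}) x :
  tmap f' g' (tmap f g x) = tmap (f' \o f) (g' \o g) x.
Proof.
apply: (tensor_ext (f := tmap f' g' \o tmap f g)) => v w /=.
by rewrite !tmapE.
Qed.

Section Assoc.
Context (k : comNzRingType) (U V W : lmodType k).

Definition tassoc : tensor (tensor U V) W -> tensor U (tensor V W) :=
  tlift (fun x w => tlift (fun u v => u *t (v *t w)) x).

Let b w : bilin (fun (u : U) (v : V) => u *t (v *t (w : W))).
Proof.
by split=> z a x y; rewrite ?ptensDl ?ptensZl // ptensDr ptensZr.
Qed.

Let bb : bilin (fun x (w : W) => tlift (fun (u : U) (v : V) => u *t (v *t w)) x).
Proof.
split=> [w|x a w w']; first exact: tlift_linear (b w).
rewrite /tlift scaler_sumr -big_split /=; apply: eq_bigr => p _.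
by rewrite !ptensDr !ptensZr.
Qed.

HB.instance Definition _ :=
  GRing.isLinear.Build k _ _ *:%R tassoc (tlift_linear bb).

Lemma tassocE u v w : tassoc (u *t v *t w) = u *t (v *t w).
Proof. by rewrite /tassoc (tliftE bb) (tliftE (b w)). Qed.

End Assoc.

(* A Z_2-grading V = V_0 (+) V_1 is given by the two projections
   [spart false] onto V_0 and [spart true] onto V_1. *)
HB.mixin Record isSuperModule (k : comNzRingType) V of GRing.Lmodule k V := {
  spart : bool -> V -> V;
  spart_linear : forall i, linear (spart i);
  spartK : forall i j v, spart i (spart j v) = if i == j then spart i v else 0;
  spartD : forall v, spart false v + spart true v = v
}.

#[short(type="superModType")]
HB.structure Definition SuperModule (k : comNzRingType) :=
  {V of GRing.Lmodule k V & isSuperModule k V}.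

HB.instance Definition _ (k : comNzRingType) (V : superModType k) (i : bool) :=
  GRing.isLinear.Build k V V *:%R (spart i) (@spart_linear k V i).

Definition homog (k : comNzRingType) (V : superModType k) (i : bool) (v : V) :=
  spart i v = v.

Definition is_even (k : comNzRingType) (V W : superModType k) (f : V -> W) :=
  forall i v, f (spart i v) = spart i (f v).

Section SuperTheory.
Context (k : comNzRingType) (V : superModType k).

Lemma spart_homog i (v : V) : homog i (spart i v).
Proof. by rewrite /homog spartK eqxx. Qed.

Lemma homog_spart i j (v : V) :
  homog j v -> spart i v = if i == j then v else 0.
Proof. by rewrite /homog => <-; rewrite spartK; case: eqP => // ->. Qed.

Lemma homogD i (v w : V) : homog i v -> homog i w -> homog i (v + w).
Proof. by rewrite /homog linearD /= => -> ->. Qed.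

Lemma homogZ i a (v : V) : homog i v -> homog i (a *: v).
Proof. by rewrite /homog linearZ => /= ->. Qed.

Lemma super_ind (P : V -> Prop) :
    (forall v w, P v -> P w -> P (v + w)) -> (forall i v, homog i v -> P v) ->
    forall v, P v.
Proof.
move=> PD Ph v; rewrite -(spartD v).
by apply: PD; apply: Ph; apply: spart_homog.
Qed.

End SuperTheory.

Section SuperMaps.
Context (k : comNzRingType) (V W : superModType k).

Lemma even_homog (f : V -> W) i v : is_even f -> homog i v -> homog i (f v).
Proof. by move=> fE; rewrite /homog -fE => ->. Qed.

Lemma evenP (f : {linear V -> W}) :
  (forall i v, homog i v -> homog i (f v)) -> is_even f.
Proof.
move=> fh i v; rewrite -{2}(spartD v) !linearD /=.
rewrite (homog_spart i (fh _ _ (spart_homog false v))).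
rewrite (homog_spart i (fh _ _ (spart_homog true v))).
by case: i; rewrite /= ?addr0 ?add0r.
Qed.

End SuperMaps.

(* The degree-i part of a tensor product is the sum of the V_j (x) W_(i - j). *)
Section SuperTensor.
Context (k : comNzRingType) (V W : superModType k).

Definition tens_spart (i : bool) : tensor V W -> tensor V W :=
  fun x => tmap (spart false) (spart i) x + tmap (spart true) (spart (~~ i)) x.

Lemma tens_spart_linear i : linear (tens_spart i).
Proof.
by move=> a x y; rewrite /tens_spart !linearP scalerDr addrACA.
Qed.

HB.instance Definition _ i :=
  GRing.isLinear.Build k _ _ *:%R (tens_spart i) (tens_spart_linear i).

Lemma tens_spartE i v w : tens_spart i (v *t w) =
  spart false v *t spart i w + spart true v *t spart (~~ i) w.
Proof. by rewrite /tens_spart !tmapE. Qed.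

Lemma tens_spartK i j x :
  tens_spart i (tens_spart j x) = if i == j then tens_spart i x else 0.
Proof.
case: eqP => [->|/eqP ij]; move: x.
  apply: (tensor_ext (f := tens_spart j \o tens_spart j)) => v w /=.
  rewrite !tens_spartE linearD /= !tens_spartE !spartK eqxx.
  by case: j; rewrite /= ?ptens0l ?ptens0r ?addr0 ?add0r.
apply: (tensor_ext (f := tens_spart i \o tens_spart j) (g := \0)) => v w /=.
rewrite !tens_spartE linearD /= !tens_spartE !spartK.
by case: i j ij => [] [] //= _; rewrite !(ptens0l, ptens0r, addr0).
Qed.

Lemma tens_spartD x : tens_spart false x + tens_spart true x = x.
Proof.
move: x; apply: (tensor_ext (f := tens_spart false \+ tens_spart true)
    (g := idfun)) => v w.
by rewrite /= !tens_spartE addrACA -!ptensDr [_ + spart false w]addrC !spartD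
  -ptensDl spartD.
Qed.

HB.instance Definition _ := isSuperModule.Build k (tensor V W)
  tens_spart_linear tens_spartK tens_spartD.

Lemma spart_ptens i (v : V) (w : W) : spart i (v *t w) =
  spart false v *t spart i w + spart true v *t spart (~~ i) w.
Proof. exact: tens_spartE. Qed.

Lemma homog_ptens i j (v : V) (w : W) :
  homog i v -> homog j w -> homog (i (+) j) (v *t w).
Proof.
move=> hv hw; rewrite /homog spart_ptens !(homog_spart _ hv) !(homog_spart _ hw).
by case: i {hv}; case: j {hw}; rewrite /= ?ptens0l ?ptens0r ?addr0 ?add0r.
Qed.

Lemma tensor_hind (P : tensor V W -> Prop) :
    P 0 -> (forall x y, P x -> P y -> P (x + y)) ->
    (forall i j v w, homog i v -> homog j w -> P (v *t w)) -> forall x, P x.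
Proof.
move=> P0 PD Ph; apply: tensor_ind => // v w.
elim/super_ind: v => [v v' e e'|i v hv]; first by rewrite ptensDl; apply: PD.
elim/super_ind: w => [w w' e e'|j w hw]; last exact: Ph hv hw.
by rewrite ptensDr; apply: PD.
Qed.

Lemma tensor_hext (P : lmodType k) (f g : {linear tensor V W -> P}) :
    (forall i j v w, homog i v -> homog j w -> f (v *t w) = g (v *t w)) ->
  f =1 g.
Proof.
move=> fg; elim/tensor_hind => [|x y ex ey|]; rewrite ?linear0 //.
by rewrite !linearD ex ey.
Qed.

Lemma tensor_even (P : superModType k) (f : {linear tensor V W -> P}) :
    (forall i j v w, homog i v -> homog j w -> homog (i (+) j) (f (v *t w))) ->
  is_even f.
Proof.
move=> fh l; apply: (tensor_hext (f := f \o spart l) (g := spart l \o f)).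
move=> i j v w hv hw /=; rewrite (homog_spart _ (homog_ptens hv hw)).
by rewrite (homog_spart _ (fh _ _ _ _ hv hw)); case: eqP => // _; rewrite linear0.
Qed.

(* c_{V,W}, extended from homogeneous elements to all of V (x) W *)
Definition braid : tensor V W -> tensor W V :=
  tlift (fun v w => \sum_(i : bool) \sum_(j : bool)
    (-1) ^+ (i && j) *: (spart j w *t spart i v)).

Let b : bilin (fun (v : V) (w : W) => \sum_(i : bool) \sum_(j : bool)
    ((-1) ^+ (i && j) : k) *: (spart j w *t spart i v)).
Proof.
split=> z a x y; rewrite scaler_sumr -big_split; apply: eq_bigr => i _;
  rewrite scaler_sumr -big_split; apply: eq_bigr => j _; rewrite /= linearP;
  by rewrite ?ptensDl ?ptensDr ?ptensZl ?ptensZr scalerDr !scalerA mulrC.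
Qed.

HB.instance Definition _ :=
  GRing.isLinear.Build k _ _ *:%R braid (tlift_linear b).

Lemma braid_homog i j (v : V) (w : W) : homog i v -> homog j w ->
  braid (v *t w) = (-1) ^+ (i && j) *: (w *t v).
Proof.
move=> hv hw; rewrite /braid (tliftE b) !big_bool.
rewrite !(homog_spart _ hv) !(homog_spart _ hw).
by case: i {hv}; case: j {hw};
  rewrite /= !(ptens0l, ptens0r, scaler0, addr0, add0r).
Qed.

End SuperTensor.

Section SuperTensorMap.
Context (k : comNzRingType).

Lemma tmap_even (V V' W W' : superModType k)
    (f : {linear V -> V'}) (g : {linear W -> W'}) :
  is_even f -> is_even g -> is_even (tmap f g).
Proof.
move=> fE gE i; apply: (tensor_ext (f := tmap f g \o spart i)
  (g := spart i \o tmap f g)) => v w /=.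
by rewrite spart_ptens linearD /= !tmapE spart_ptens !fE !gE.
Qed.

(* id (x) c_{B,C} (x) id *)
Section Interchange.
Context (A B C D : superModType k).

Definition tmid :
    tensor (tensor A B) (tensor C D) -> tensor (tensor A C) (tensor B D) :=
  tlift (fun x y => tlift (fun a b => tlift (fun c d =>
    tlift (fun c' b' => (a *t c') *t (b' *t d)) (braid (b *t c))) y) x).

Let m4 (a : A) (d : D) : bilin (fun (c : C) (b : B) => (a *t c) *t (b *t d)).
Proof.
by split=> z e x y; rewrite ?(ptensDl, ptensDr) ?(ptensZl, ptensZr) //
  ?(ptensDl, ptensDr).
Qed.

Let m3 (a : A) (b : B) : bilin (fun (c : C) (d : D) =>
  tlift (fun c' b' => (a *t c') *t (b' *t d)) (braid (b *t c))).
Proof.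
split=> [d|c] e x y; last first.
  rewrite /tlift scaler_sumr -big_split; apply: eq_bigr => p _ /=.
  by rewrite !ptensDr !ptensZr.
by rewrite ptensDr ptensZr linearP /= (tlift_linear (m4 a d)).
Qed.

Let m2 y : bilin (fun (a : A) (b : B) => tlift (fun (c : C) (d : D) =>
  tlift (fun c' b' => (a *t c') *t (b' *t d)) (braid (b *t c))) y).
Proof.
split=> [b|a] e x z; rewrite /tlift scaler_sumr -big_split; apply: eq_bigr => p _.
  rewrite /= scaler_sumr -big_split; apply: eq_bigr => q _ /=.
  by rewrite !ptensDl !ptensZl.
rewrite /= ptensDl ptensZl linearP /=.
exact: (tlift_linear (m4 a p.2)).
Qed.

Let m1 : bilin (fun x y => tlift (fun (a : A) (b : B) =>
  tlift (fun (c : C) (d : D) =>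
    tlift (fun c' b' => (a *t c') *t (b' *t d)) (braid (b *t c))) y) x).
Proof.
split=> [y|x e y z]; first exact: tlift_linear (m2 y).
rewrite [LHS]/tlift scaler_sumr -big_split; apply: eq_bigr => p _.
exact: (tlift_linear (m3 p.1 p.2)).
Qed.

HB.instance Definition _ :=
  GRing.isLinear.Build k _ _ *:%R tmid (tlift_linear m1).

Lemma tmid_homog i j (a : A) (b : B) (c : C) (d : D) :
    homog i b -> homog j c ->
  tmid ((a *t b) *t (c *t d)) = (-1) ^+ (i && j) *: ((a *t c) *t (b *t d)).
Proof.
move=> hb hc; rewrite /tmid (tliftE m1) (tliftE (m2 _)) (tliftE (m3 _ _)).
rewrite (braid_homog hb hc).
by rewrite (tliftZ (m4 a d)) (tliftE (m4 a d)).
Qed.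

End Interchange.
End SuperTensorMap.

Section NestedTensor3.
Context (k : comNzRingType) (A B C : superModType k).

Lemma tens3l_hext (P : lmodType k) (f g : {linear tensor (tensor A B) C -> P}) :
    (forall i j l a b c, homog i a -> homog j b -> homog l c ->
      f (a *t b *t c) = g (a *t b *t c)) ->
  f =1 g.
Proof.
move=> fg; apply: tensor_hext => m l x c _ hc.
elim/tensor_hind: x => [|x y ex ey|i j a b ha hb].
- by rewrite ptens0l !linear0.
- by rewrite ptensDl !linearD ex ey.
exact: fg ha hb hc.
Qed.

End NestedTensor3.

Section NestedTensor.
Context (k : comNzRingType) (A B C D : superModType k).

Lemma tens4_hext (P : lmodType k)
    (f g : {linear tensor (tensor A B) (tensor C D) -> P}) :
    (forall i j l m a b c d,
      homog i a -> homog j b -> homog l c -> homog m d ->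
      f ((a *t b) *t (c *t d)) = g ((a *t b) *t (c *t d))) ->
  f =1 g.
Proof.
move=> fg; apply: tens3l_hext => i j n a b y ha hb _.
elim/tensor_hind: y => [|x y ex ey|l m c d hc hd].
- by rewrite ptens0r !linear0.
- by rewrite ptensDr !linearD ex ey.
exact: fg ha hb hc hd.
Qed.

Lemma tassoc_even : is_even (@tassoc k A B C).
Proof.
move=> n; apply: (tens3l_hext (f := @tassoc k A B C \o spart n)
  (g := spart n \o @tassoc k A B C)).
move=> i j l a b c ha hb hc /=.
rewrite (homog_spart _ (homog_ptens (homog_ptens ha hb) hc)) tassocE.
rewrite (homog_spart _ (homog_ptens ha (homog_ptens hb hc))) addbA.
by case: eqP => _; rewrite ?tassocE ?linear0.
Qed.

Lemma tmid_even : is_even (@tmid k A B C D).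
Proof.
move=> n; apply: (tens4_hext (f := @tmid k A B C D \o spart n)
  (g := spart n \o @tmid k A B C D)).
move=> i j l m a b c d ha hb hc hd /=; rewrite (tmid_homog _ _ hb hc) linearZ /=.
rewrite (homog_spart _ (homog_ptens (homog_ptens ha hb) (homog_ptens hc hd))).
rewrite (homog_spart _ (homog_ptens (homog_ptens ha hc) (homog_ptens hb hd))).
rewrite addbACA; case: eqP => _; rewrite ?(tmid_homog _ _ hb hc) //.
by rewrite linear0 scaler0.
Qed.

End NestedTensor.

(* As k is purely even, a super-linear map C -> k vanishes on C_1. *)
HB.mixin Record hasCounit (k : comNzRingType) C of SuperModule k C := {
  counit : C -> k;
  counit_linear : scalar counit;
  counit_odd : forall x : C, homog true x -> counit x = 0
}.

#[short(type="counitedModType")]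
HB.structure Definition CounitedModule (k : comNzRingType) :=
  {C of SuperModule k C & hasCounit k C}.

HB.instance Definition _ (k : comNzRingType) (C : counitedModType k) :=
  GRing.isLinear.Build k C k *%R (@counit k C) (@counit_linear k C).

Arguments counit_odd {k s x} _.

Section CounitMaps.
Context (k : comNzRingType) (C : counitedModType k).

(* The maps k (x) C = C and C (x) k = C are understood. *)
Definition counitl : tensor C C -> C := tlift (fun c d => counit c *: d).
Definition counitr : tensor C C -> C := tlift (fun c d => counit d *: c).

Let bl : bilin (fun c d : C => counit c *: d).
Proof.
split=> z a x y; rewrite linearP /=; first by rewrite scalerDl scalerA.
by rewrite !scalerA mulrC.
Qed.

Let br : bilin (fun c d : C => counit d *: c).
Proof.
split=> z a x y; rewrite linearP /=; last by rewrite scalerDl scalerA.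
by rewrite !scalerA mulrC.
Qed.

HB.instance Definition _ :=
  GRing.isLinear.Build k _ _ *:%R counitl (tlift_linear bl).
HB.instance Definition _ :=
  GRing.isLinear.Build k _ _ *:%R counitr (tlift_linear br).

Lemma counitlE c d : counitl (c *t d) = counit c *: d.
Proof. exact: (tliftE bl). Qed.

Lemma counitrE c d : counitr (c *t d) = counit d *: c.
Proof. exact: (tliftE br). Qed.

End CounitMaps.

HB.mixin Record isSuperCoalgebra (k : comNzRingType) C
    of SuperModule k C & hasCounit k C := {
  comul : C -> tensor C C;
  comul_linear : linear comul;
  comul_even : is_even comul;
  comulA : forall x : C,
    tassoc (tmap comul idfun (comul x)) = tmap idfun comul (comul x);
  comul_counitl : forall x : C, counitl (comul x) = x;
  comul_counitr : forall x : C, counitr (comul x) = x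
}.

#[short(type="superCoalgType")]
HB.structure Definition SuperCoalgebra (k : comNzRingType) :=
  {C of SuperModule k C & hasCounit k C & isSuperCoalgebra k C}.

HB.instance Definition _ (k : comNzRingType) (C : superCoalgType k) :=
  GRing.isLinear.Build k C (tensor C C) *:%R (@comul k C) (@comul_linear k C).

HB.mixin Record isSuperAlgebra (k : comNzRingType) A
    of SuperModule k A & GRing.Algebra k A := {
  homog1 : homog false (1 : A);
  homogM : forall i j (x y : A),
    homog i x -> homog j y -> homog (i (+) j) (x * y)
}.

#[short(type="superAlgType")]
HB.structure Definition SuperAlgebra (k : comNzRingType) :=
  {A of SuperModule k A & GRing.Algebra k A & isSuperAlgebra k A}.

Arguments homogM {k s i j x y} _ _.

(* MathComp algebras are non-zero rings.  The augmentation ensures that the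
   tensor product of two such superalgebras is again non-zero. *)
HB.mixin Record isAugSuperAlgebra (k : comNzRingType) A
    of SuperAlgebra k A & hasCounit k A := {
  counit_monoid : monoid_morphism (@counit k A)
}.

#[short(type="augSuperAlgType")]
HB.structure Definition AugSuperAlgebra (k : comNzRingType) :=
  {A of SuperAlgebra k A & hasCounit k A & isAugSuperAlgebra k A}.

HB.instance Definition _ (k : comNzRingType) (A : augSuperAlgType k) :=
  GRing.isMonoidMorphism.Build A k (@counit k A) (@counit_monoid k A).

Section TensorCounit.
Context (k : comNzRingType) (C D : counitedModType k).

Definition tens_counit (x : tensor C D) : k :=
  @tlift k C D k^o (fun c d => counit c * counit d) x.

Let b : @bilin k C D k^o (fun c d => counit c * counit d).
Proof.
split=> z a x y; rewrite linearP /=; first by rewrite mulrDl -mulrA.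
by rewrite mulrDr; congr (_ + _); rewrite mulrCA.
Qed.

Lemma tens_counit_linear : scalar tens_counit.
Proof. exact: (tlift_linear b). Qed.

Lemma tens_counitE c d : tens_counit (c *t d) = counit c * counit d.
Proof. exact: (tliftE b). Qed.

Lemma tens_counit_odd x : homog true x -> tens_counit x = 0.
Proof.
move=> <-; move: x; pose f : {linear tensor C D -> k^o} :=
  HB.pack tens_counit (GRing.isLinear.Build _ _ _ _ tens_counit tens_counit_linear).
apply: (tensor_hext (f := f \o spart true) (g := \0)) => i j v w hv hw.
rewrite /= (homog_spart _ (homog_ptens hv hw)).
case: eqP => [e|_]; last exact: (linear0 f).
rewrite /f /= tens_counitE; case: i j e hv hw => [] [] //= _ hv hw.
  by rewrite (counit_odd hv) mul0r.
by rewrite (counit_odd hw) mulr0.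
Qed.

HB.instance Definition _ := hasCounit.Build k (tensor C D)
  tens_counit_linear tens_counit_odd.

Lemma counit_ptens (c : C) (d : D) : counit (c *t d) = counit c * counit d.
Proof. exact: tens_counitE. Qed.

End TensorCounit.

Section MulMap.
Context (k : comNzRingType) (A : superAlgType k).

Definition mulmap : tensor A A -> A := tlift (fun x y => x * y).

Let b : bilin (fun x y : A => x * y).
Proof.
split=> z a x y; first by rewrite mulrDl scalerAl.
by rewrite mulrDr scalerAr.
Qed.

HB.instance Definition _ :=
  GRing.isLinear.Build k _ _ *:%R mulmap (tlift_linear b).

Lemma mulmapE x y : mulmap (x *t y) = x * y. Proof. exact: (tliftE b). Qed.

Lemma mulmap_even : is_even mulmap.
Proof.
by apply: tensor_even => i j v w hv hw; rewrite /= mulmapE; apply: homogM.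
Qed.

End MulMap.

(* The product (m (x) m) o (id (x) c (x) id), that is
   (a *t b) * (a' *t b') = (-1) ^ (|b| |a'|) (a * a') *t (b * b'). *)
Section TensorAlgebraProduct.
Context (k : comNzRingType) (A B : augSuperAlgType k).
Implicit Types x y z : tensor A B.

Definition tens_mul x y : tensor A B :=
  tmap (@mulmap k A) (@mulmap k B) (tmid (x *t y)).

Lemma tens_mulE i j (a : A) (b : B) (c : A) (d : B) : homog i b -> homog j c ->
  tens_mul (a *t b) (c *t d) = (-1) ^+ (i && j) *: ((a * c) *t (b * d)).
Proof.
by move=> hb hc; rewrite /tens_mul (tmid_homog _ _ hb hc) linearZ /= tmapE /= !mulmapE.
Qed.

Lemma tens_mulDl : left_distributive tens_mul +%R.
Proof. by move=> x y z; rewrite /tens_mul ptensDl !linearD. Qed.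

Lemma tens_mulDr : right_distributive tens_mul +%R.
Proof. by move=> x y z; rewrite /tens_mul ptensDr !linearD. Qed.

Lemma tens_mulZl a x y : a *: tens_mul x y = tens_mul (a *: x) y.
Proof. by rewrite /tens_mul ptensZl !linearZ. Qed.

Lemma tens_mulZr a x y : a *: tens_mul x y = tens_mul x (a *: y).
Proof. by rewrite /tens_mul ptensZr !linearZ. Qed.

Lemma tens_mul0 x : tens_mul 0 x = 0.
Proof. by rewrite /tens_mul ptens0l !linear0. Qed.

Lemma tens_mulr0 x : tens_mul x 0 = 0.
Proof. by rewrite /tens_mul ptens0r !linear0. Qed.

Lemma tens_mulA : associative tens_mul.
Proof.
move=> x y z.
elim/tensor_hind: x => [|x x' e e'|i1 j1 a1 b1 ha1 hb1].
- by rewrite !tens_mul0.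
- by rewrite !tens_mulDl e e'.
elim/tensor_hind: y => [|x x' e e'|i2 j2 a2 b2 ha2 hb2].
- by rewrite tens_mul0 !tens_mulr0 tens_mul0.
- by rewrite !(tens_mulDl, tens_mulDr) e e'.
elim/tensor_hind: z => [|x x' e e'|i3 j3 a3 b3 ha3 hb3].
- by rewrite !tens_mulr0.
- by rewrite !tens_mulDr e e'.
rewrite (tens_mulE _ _ hb2 ha3) (tens_mulE _ _ hb1 ha2) -tens_mulZr -tens_mulZl.
rewrite (tens_mulE _ _ hb1 (homogM ha2 ha3)) (tens_mulE _ _ (homogM hb1 hb2) ha3).
rewrite !mulrA !scalerA -!signr_addb; congr (_ *: _); congr (_ ^+ _).
by case: j1 {hb1}; case: j2 {hb2}; case: i2 {ha2}; case: i3 {ha3}.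
Qed.

Lemma tens_mul1 : left_id (1 *t 1) tens_mul.
Proof.
move=> x; elim/tensor_hind: x => [|x x' e e'|i j a b ha hb].
- exact: tens_mulr0.
- by rewrite tens_mulDr e e'.
by rewrite (tens_mulE _ _ (@homog1 k B) ha) !mul1r scale1r.
Qed.

Lemma tens_mulr1 : right_id (1 *t 1) tens_mul.
Proof.
move=> x; elim/tensor_hind: x => [|x x' e e'|i j a b ha hb].
- exact: tens_mul0.
- by rewrite tens_mulDl e e'.
by rewrite (tens_mulE _ _ hb (@homog1 k A)) andbF !mulr1 scale1r.
Qed.

Lemma tens_1_neq0 : (1 : A) *t (1 : B) != 0.
Proof.
apply/negP => /eqP /(congr1 (@counit k (tensor A B))) /eqP.
by rewrite counit_ptens !rmorph1 mulr1 linear0 oner_eq0.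
Qed.

HB.instance Definition _ := GRing.Zmodule_isNzRing.Build (tensor A B)
  tens_mulA tens_mul1 tens_mulr1 tens_mulDl tens_mulDr tens_1_neq0.

HB.instance Definition _ :=
  GRing.Lmodule_isLalgebra.Build k (tensor A B) tens_mulZl.

HB.instance Definition _ :=
  GRing.Lalgebra_isAlgebra.Build k (tensor A B) tens_mulZr.

Lemma ptensM i j (a : A) (b : B) (c : A) (d : B) : homog i b -> homog j c ->
  (a *t b) * (c *t d) = (-1) ^+ (i && j) *: ((a * c) *t (b * d)).
Proof. exact: tens_mulE. Qed.

Lemma tens_homog1 : homog false (1 : tensor A B).
Proof. exact: (homog_ptens (@homog1 k A) (@homog1 k B)). Qed.

Lemma tens_homogM i j x y : homog i x -> homog j y -> homog (i (+) j) (x * y).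
Proof.
move=> hx hy.
apply: (even_homog (tmap_even (@mulmap_even k A) (@mulmap_even k B))).
exact: (even_homog (@tmid_even k A B A B) (homog_ptens hx hy)).
Qed.

HB.instance Definition _ :=
  isSuperAlgebra.Build k (tensor A B) tens_homog1 tens_homogM.

Lemma tens_counit_monoid : monoid_morphism (@counit k (tensor A B)).
Proof.
split=> [|x y]; first by rewrite counit_ptens !rmorph1 mulr1.
elim/tensor_hind: x => [|x x' e e'|i1 j1 a1 b1 ha1 hb1].
- by rewrite !(linear0, mul0r).
- by rewrite mulrDl !linearD /= e e' mulrDl.
elim/tensor_hind: y => [|x x' e e'|i2 j2 a2 b2 ha2 hb2].
- by rewrite !(linear0, mulr0).
- by rewrite mulrDr !linearD /= e e' mulrDr.
rewrite (ptensM _ _ hb1 ha2) linearZ /= !counit_ptens !rmorphM /=.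
case: i2 ha2 => ha2; first by rewrite (counit_odd ha2) !(mulr0, mul0r).
by rewrite andbF mul1r mulrACA.
Qed.

HB.instance Definition _ :=
  isAugSuperAlgebra.Build k (tensor A B) tens_counit_monoid.

End TensorAlgebraProduct.

Section TensorCoalgebra.
Context (k : comNzRingType).

Lemma tmid_natural (A B C D A' B' C' D' : superModType k)
    (f : {linear A -> A'}) (g : {linear B -> B'})
    (h : {linear C -> C'}) (l : {linear D -> D'}) x y :
    is_even g -> is_even h ->
  tmid (tmap f g x *t tmap h l y) =
  tmap (tmap f h) (tmap g l) (tmid (x *t y)).
Proof.
move=> gE hE; elim/tensor_hind: x => [|x x' e e'|i1 i2 a b ha hb].
- by rewrite !(linear0, ptens0l).
- by rewrite linearD /= !ptensDl !linearD /= e e'.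
elim/tensor_hind: y => [|x x' e e'|i3 i4 c d hc hd].
- by rewrite !(linear0, ptens0r).
- by rewrite linearD /= !ptensDr !linearD /= e e'.
rewrite !tmapE (tmid_homog _ _ (even_homog gE hb) (even_homog hE hc)).
by rewrite (tmid_homog _ _ hb hc) linearZ /= !tmapE /= !tmapE.
Qed.

Lemma tmid_assoc (A B C D E F : superModType k)
    (x : tensor (tensor A B) C) (y : tensor (tensor D E) F) :
  tassoc (tmap (@tmid k A B D E) idfun (tmid (x *t y))) =
  tmap idfun (@tmid k B C E F) (tmid (tassoc x *t tassoc y)).
Proof.
move: x; pose r := tassoc y.
elim/tensor_hind => [|x x' e e'|i12 i3 x c _ hc].
- by rewrite !(linear0, ptens0l).
- by rewrite linearD /= !ptensDl !linearD /= e e'.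
elim/tensor_hind: x => [|x x' e e'|i1 i2 a b ha hb].
- by rewrite !(ptens0l, linear0).
- by rewrite !ptensDl !linearD /= !ptensDl !linearD /= e e'.
rewrite {}/r; elim/tensor_hind: y => [|x x' e e'|j12 j3 y f _ hf].
- by rewrite !(linear0, ptens0r).
- by rewrite linearD /= !ptensDr !linearD /= e e'.
elim/tensor_hind: y => [|x x' e e'|j1 j2 d e hd he].
- by rewrite !(ptens0l, linear0, ptens0r).
- by rewrite !ptensDl !linearD /= !ptensDr !linearD /= e e'.
rewrite !tassocE (tmid_homog _ _ hc (homog_ptens hd he)).
rewrite (tmid_homog _ _ (homog_ptens hb hc) hd) !linearZ /= !tmapE /=.
rewrite (tmid_homog _ _ hb hd) (tmid_homog _ _ hc he).
rewrite ptensZl linearZ /= tassocE ptensZr !scalerA -!signr_addb.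
congr (_ *: _); congr (_ ^+ _).
by case: i2 {hb}; case: i3 {hc}; case: j1 {hd}; case: j2 {he}.
Qed.

Section Def.
Context (C D : superCoalgType k).

(* (id (x) c_{C,D} (x) id) o (Delta_C (x) Delta_D) *)
Definition tens_comul : tensor C D -> tensor (tensor C D) (tensor C D) :=
  fun x => tmid (tmap (@comul k C) (@comul k D) x).

Lemma tens_comulE c d : tens_comul (c *t d) = tmid (comul c *t comul d).
Proof. by rewrite /tens_comul tmapE. Qed.

Lemma tens_comul_linear : linear tens_comul.
Proof. by move=> a x y; rewrite /tens_comul !linearP. Qed.

HB.instance Definition _ := GRing.isLinear.Build k _ _ *:%R
  tens_comul tens_comul_linear.

Lemma tens_comul_even : is_even tens_comul.
Proof.
move=> i x; rewrite /tens_comul (tmap_even (@comul_even k C) (@comul_even k D)).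
exact: tmid_even.
Qed.

Lemma idfun_even (V : superModType k) : is_even (@idfun V).
Proof. by []. Qed.

Lemma tens_comulA x :
  tassoc (tmap tens_comul idfun (tens_comul x)) =
  tmap idfun tens_comul (tens_comul x).
Proof.
move: x; apply: (tensor_ext
  (f := @tassoc k _ _ _ \o (tmap tens_comul idfun \o tens_comul))
  (g := tmap idfun tens_comul \o tens_comul)) => c d /=.
rewrite tens_comulE.
have L : tmap tens_comul idfun (tmid (comul c *t comul d)) =
  tmap (@tmid k C C D D) idfun
    (tmid (tmap comul idfun (comul c) *t tmap comul idfun (comul d))).
  rewrite tmid_natural //; last exact: comul_even.
  rewrite tmap_comp; apply: tmap_eq => // z /=.
  by rewrite (_ : tmap _ _ z = z) //;
    exact: (tensor_ext (f := tmap idfun idfun) (g := idfun)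
      (fun v w => tmapE _ _ v w)).
have R : tmap idfun tens_comul (tmid (comul c *t comul d)) =
  tmap idfun (@tmid k C C D D)
    (tmid (tmap idfun comul (comul c) *t tmap idfun comul (comul d))).
  rewrite tmid_natural //; last exact: comul_even.
  rewrite tmap_comp; apply: tmap_eq => // z /=.
  by rewrite (_ : tmap _ _ z = z) //;
    exact: (tensor_ext (f := tmap idfun idfun) (g := idfun)
      (fun v w => tmapE _ _ v w)).
by rewrite L R tmid_assoc !comulA.
Qed.

Lemma tmid_counitl (u : tensor C C) (v : tensor D D) :
  counitl (tmid (u *t v)) = counitl u *t counitl v.
Proof.
elim/tensor_hind: u => [|x x' e e'|i1 i2 a b ha hb].
- by rewrite !(linear0, ptens0l).
- by rewrite linearD /= !ptensDl !linearD /= e e'.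
elim/tensor_hind: v => [|x x' e e'|i3 i4 c d hc hd].
- by rewrite !(linear0, ptens0r).
- by rewrite linearD /= !ptensDr !linearD /= e e'.
rewrite (tmid_homog _ _ hb hc) linearZ /= !counitlE counit_ptens.
case: i3 hc => hc.
  by rewrite (counit_odd hc) mulr0 !scale0r ptens0r scaler0.
by rewrite andbF scale1r ptensZl ptensZr scalerA.
Qed.

Lemma tmid_counitr (u : tensor C C) (v : tensor D D) :
  counitr (tmid (u *t v)) = counitr u *t counitr v.
Proof.
elim/tensor_hind: u => [|x x' e e'|i1 i2 a b ha hb].
- by rewrite !(linear0, ptens0l).
- by rewrite linearD /= !ptensDl !linearD /= e e'.
elim/tensor_hind: v => [|x x' e e'|i3 i4 c d hc hd].
- by rewrite !(linear0, ptens0r).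
- by rewrite linearD /= !ptensDr !linearD /= e e'.
rewrite (tmid_homog _ _ hb hc) linearZ /= !counitrE counit_ptens.
case: i2 hb => hb.
  by rewrite (counit_odd hb) mul0r !scale0r ptens0l scaler0.
by rewrite scale1r ptensZl ptensZr scalerA.
Qed.

Lemma tens_comul_counitl x : counitl (tens_comul x) = x.
Proof.
move: x; apply: (tensor_ext (f := @counitl k _ \o tens_comul) (g := idfun)).
by move=> c d /=; rewrite tens_comulE tmid_counitl !comul_counitl.
Qed.

Lemma tens_comul_counitr x : counitr (tens_comul x) = x.
Proof.
move: x; apply: (tensor_ext (f := @counitr k _ \o tens_comul) (g := idfun)).
by move=> c d /=; rewrite tens_comulE tmid_counitr !comul_counitr.
Qed.

HB.instance Definition _ := isSuperCoalgebra.Build k (tensor C D)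
  tens_comul_linear tens_comul_even tens_comulA
  tens_comul_counitl tens_comul_counitr.

End Def.
End TensorCoalgebra.

Definition algmap (k : comNzRingType) (A B : algType k) (f : A -> B) :=
  linear f /\ monoid_morphism f.

Section AlgMap.
Context (k : comNzRingType).

Lemma algmap_comp (A B C : algType k) (f : B -> C) (g : A -> B) :
  algmap f -> algmap g -> algmap (f \o g).
Proof.
move=> [fL [f1 fM]] [gL [g1 gM]]; split=> [a x y|] /=; first by rewrite gL fL.
by split=> [|x y] /=; rewrite ?g1 // gM fM.
Qed.

Lemma algmap_id (A : algType k) : algmap (@idfun A).
Proof. by []. Qed.

Lemma tmap_algmap (A B A' B' : augSuperAlgType k)
    (f : {linear A -> A'}) (g : {linear B -> B'}) :
  algmap f -> algmap g -> is_even f -> is_even g -> algmap (tmap f g).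
Proof.
move=> [_ [f1 fM]] [_ [g1 gM]] fE gE; split; first exact: linearP.
split=> [|x y]; first by rewrite tmapE f1 g1.
elim/tensor_hind: x => [|x x' e e'|i1 i2 a b ha hb].
- by rewrite linear0 !mul0r linear0.
- by rewrite mulrDl !linearD /= e e' mulrDl.
elim/tensor_hind: y => [|x x' e e'|i3 i4 c d hc hd].
- by rewrite linear0 !mulr0 linear0.
- by rewrite mulrDr !linearD /= e e' mulrDr.
rewrite (ptensM _ _ hb hc) linearZ /= !tmapE fM gM.
by rewrite (ptensM _ _ (even_homog gE hb) (even_homog fE hc)).
Qed.

Lemma tassoc_algmap (A B C : augSuperAlgType k) : algmap (@tassoc k A B C).
Proof.
split; first exact: linearP.
split=> [|x y]; first exact: tassocE.
elim/tensor_hind: x => [|x x' e e'|i12 i3 x c _ hc].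
- by rewrite linear0 !mul0r linear0.
- by rewrite mulrDl !linearD /= e e' mulrDl.
elim/tensor_hind: x => [|x x' e e'|i1 i2 a b ha hb].
- by rewrite ptens0l linear0 !mul0r linear0.
- by rewrite ptensDl mulrDl !linearD /= e e' mulrDl.
elim/tensor_hind: y => [|x x' e e'|j12 j3 y c' hy hc'].
- by rewrite linear0 !mulr0 linear0.
- by rewrite mulrDr !linearD /= e e' mulrDr.
have {hy} : homog j12 y by [].
rewrite /homog => <-; move: y.
pose f1 := @tassoc k A B C \o (fun y => (a *t b *t c) * (y *t c')).
pose f2 := (fun y => tassoc (a *t b *t c) * tassoc (y *t c')).
have f1L : linear f1.
  by move=> z u v; rewrite /f1 /= ptensDl ptensZl mulrDr -scalerAr linearP.
have f2L : linear f2.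
  move=> z u v; rewrite /f2 /= ptensDl ptensZl linearP /= mulrDr.
  by rewrite -scalerAr.
pose F1 : {linear tensor A B -> _} :=
  HB.pack f1 (GRing.isLinear.Build _ _ _ _ f1 f1L).
pose F2 : {linear tensor A B -> _} :=
  HB.pack f2 (GRing.isLinear.Build _ _ _ _ f2 f2L).
have e : F1 =1 F2.
  apply: tensor_hext => j1 j2 a' b' ha' hb'; rewrite /F1 /F2 /= /f1 /f2 /=.
  rewrite (ptensM _ _ hc (homog_ptens ha' hb')) (ptensM _ _ hb ha') !tassocE.
  rewrite (ptensM _ _ (homog_ptens hb hc) ha') (ptensM _ _ hc hb').
  rewrite ptensZl linearZ /= linearZ /= tassocE ptensZr !scalerA -!signr_addb.
  congr (_ *: _); congr (_ ^+ _).
  by case: i2 {hb}; case: i3 {hc}; case: j1 {ha'}; case: j2 {hb'}.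
by move=> y; exact: (e (spart j12 y)).
Qed.

Lemma counitl_algmap (A : augSuperAlgType k) : algmap (@counitl k A).
Proof.
split; first exact: linearP.
split=> [|x y]; first by rewrite counitlE rmorph1 scale1r.
elim/tensor_hind: x => [|x x' e e'|i1 i2 a b ha hb].
- by rewrite linear0 !mul0r linear0.
- by rewrite mulrDl !linearD /= e e' mulrDl.
elim/tensor_hind: y => [|x x' e e'|i3 i4 c d hc hd].
- by rewrite linear0 !mulr0 linear0.
- by rewrite mulrDr !linearD /= e e' mulrDr.
rewrite (ptensM _ _ hb hc) linearZ /= !counitlE rmorphM /=.
rewrite -scalerAl -scalerAr !scalerA; case: i3 hc => hc.
  by rewrite (counit_odd hc) !(mulr0, mul0r) scale0r.
by rewrite andbF mul1r.
Qed.

Lemma counitr_algmap (A : augSuperAlgType k) : algmap (@counitr k A).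
Proof.
split; first exact: linearP.
split=> [|x y]; first by rewrite counitrE rmorph1 scale1r.
elim/tensor_hind: x => [|x x' e e'|i1 i2 a b ha hb].
- by rewrite linear0 !mul0r linear0.
- by rewrite mulrDl !linearD /= e e' mulrDl.
elim/tensor_hind: y => [|x x' e e'|i3 i4 c d hc hd].
- by rewrite linear0 !mulr0 linear0.
- by rewrite mulrDr !linearD /= e e' mulrDr.
rewrite (ptensM _ _ hb hc) linearZ /= !counitrE rmorphM /=.
rewrite -scalerAl -scalerAr !scalerA; case: i2 hb => hb.
  by rewrite (counit_odd hb) !(mulr0, mul0r) scale0r.
by rewrite mul1r.
Qed.

End AlgMap.

Section TensorAlgebra.
Context (k : comNzRingType) (V : superModType k).

(* T(V) is presented as the unital associative k-algebra freely generated by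
   the module V: expressions in elements of k and V, modulo the least
   congruence that imposes the algebra laws and the linearity of V -> T(V).
   Its universal property is [talg_liftP] and [talg_ext] below. *)
Inductive tterm :=
| TCst of k
| TGen of V
| TAdd of tterm & tterm
| TMul of tterm & tterm.

Inductive tterm_rel : tterm -> tterm -> Prop :=
| TRefl s : tterm_rel s s
| TSym s t : tterm_rel s t -> tterm_rel t s
| TTrans t s u : tterm_rel s t -> tterm_rel t u -> tterm_rel s u
| TAddCong s s' t t' :
    tterm_rel s s' -> tterm_rel t t' -> tterm_rel (TAdd s t) (TAdd s' t')
| TMulCong s s' t t' :
    tterm_rel s s' -> tterm_rel t t' -> tterm_rel (TMul s t) (TMul s' t')
| TAddA s t u : tterm_rel (TAdd s (TAdd t u)) (TAdd (TAdd s t) u)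
| TAddC s t : tterm_rel (TAdd s t) (TAdd t s)
| TAdd0 s : tterm_rel (TAdd (TCst 0) s) s
| TMulA s t u : tterm_rel (TMul s (TMul t u)) (TMul (TMul s t) u)
| TMul1l s : tterm_rel (TMul (TCst 1) s) s
| TMul0l s : tterm_rel (TMul (TCst 0) s) (TCst 0)
| TMulDl s t u : tterm_rel (TMul (TAdd s t) u) (TAdd (TMul s u) (TMul t u))
| TMulDr s t u : tterm_rel (TMul s (TAdd t u)) (TAdd (TMul s t) (TMul s u))
| TCstC a s : tterm_rel (TMul (TCst a) s) (TMul s (TCst a))
| TCstD a b : tterm_rel (TCst (a + b)) (TAdd (TCst a) (TCst b))
| TCstM a b : tterm_rel (TCst (a * b)) (TMul (TCst a) (TCst b))
| TGenD v w : tterm_rel (TGen (v + w)) (TAdd (TGen v) (TGen w))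
| TGenZ a v : tterm_rel (TGen (a *: v)) (TMul (TCst a) (TGen v)).

HB.instance Definition _ := gen_eqMixin tterm.
HB.instance Definition _ := gen_choiceMixin tterm.

Definition tterm_eqv : rel tterm := fun s t => `[< tterm_rel s t >].

Lemma tterm_eqv_refl : reflexive tterm_eqv.
Proof. by move=> s; apply/asboolP; apply: TRefl. Qed.

Lemma tterm_eqv_sym : symmetric tterm_eqv.
Proof. by move=> s t; apply/asboolP/asboolP; apply: TSym. Qed.

Lemma tterm_eqv_trans : transitive tterm_eqv.
Proof.
by move=> t s u /asboolP st /asboolP tu; apply/asboolP; apply: TTrans tu.
Qed.

Canonical tterm_equiv :=
  EquivRel tterm_eqv tterm_eqv_refl tterm_eqv_sym tterm_eqv_trans.

Definition talg := {eq_quot tterm_equiv}.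

HB.instance Definition _ := Choice.on talg.
HB.instance Definition _ := EqQuotient.on talg.

Definition tcls (s : tterm) : talg := \pi_talg s.

Lemma tclsP s t : tterm_rel s t <-> tcls s = tcls t.
Proof.
split=> [st | /eqmodP /asboolP //].
by apply/eqmodP/asboolP.
Qed.

Lemma tclsK x : tcls (repr x) = x. Proof. exact: reprK. Qed.

Lemma repr_tcls s : tterm_rel (repr (tcls s)) s.
Proof. by apply/tclsP; rewrite tclsK. Qed.

Definition talg_add (x y : talg) := tcls (TAdd (repr x) (repr y)).
Definition talg_mul (x y : talg) := tcls (TMul (repr x) (repr y)).

Lemma talg_addE s t : talg_add (tcls s) (tcls t) = tcls (TAdd s t).
Proof. by apply/tclsP/TAddCong; apply: repr_tcls. Qed.

Lemma talg_mulE s t : talg_mul (tcls s) (tcls t) = tcls (TMul s t).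
Proof. by apply/tclsP/TMulCong; apply: repr_tcls. Qed.

Lemma talg_addA : associative talg_add.
Proof.
move=> x y z; rewrite -[x]tclsK -[y]tclsK -[z]tclsK !talg_addE.
exact/tclsP/TAddA.
Qed.

Lemma talg_addC : commutative talg_add.
Proof. by move=> x y; apply/tclsP/TAddC. Qed.

Lemma talg_add0 : left_id (tcls (TCst 0)) talg_add.
Proof. by move=> x; rewrite -[x]tclsK talg_addE; apply/tclsP/TAdd0. Qed.

Lemma talg_mulDl : left_distributive talg_mul talg_add.
Proof.
move=> x y z; rewrite -[x]tclsK -[y]tclsK -[z]tclsK !(talg_addE, talg_mulE).
exact/tclsP/TMulDl.
Qed.

Lemma talg_mulDr : right_distributive talg_mul talg_add.
Proof.
move=> x y z; rewrite -[x]tclsK -[y]tclsK -[z]tclsK !(talg_addE, talg_mulE).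
exact/tclsP/TMulDr.
Qed.

Lemma talg_mulA : associative talg_mul.
Proof.
move=> x y z; rewrite -[x]tclsK -[y]tclsK -[z]tclsK !talg_mulE.
exact/tclsP/TMulA.
Qed.

Lemma talg_mul1 : left_id (tcls (TCst 1)) talg_mul.
Proof. by move=> x; rewrite -[x]tclsK talg_mulE; apply/tclsP/TMul1l. Qed.

Lemma talg_cstC a x : talg_mul (tcls (TCst a)) x = talg_mul x (tcls (TCst a)).
Proof. by rewrite -[x]tclsK !talg_mulE; apply/tclsP/TCstC. Qed.

Lemma talg_mulr1 : right_id (tcls (TCst 1)) talg_mul.
Proof. by move=> x; rewrite -talg_cstC talg_mul1. Qed.

Lemma talg_addN : left_inverse (tcls (TCst 0)) (talg_mul (tcls (TCst (-1))))
  talg_add.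
Proof.
move=> x; rewrite -{2}[x]talg_mul1 -talg_mulDl talg_addE.
have <- : tcls (TCst (-1 + 1)) = tcls (TAdd (TCst (-1)) (TCst 1)).
  exact/tclsP/TCstD.
by rewrite addNr -[x]tclsK talg_mulE; apply/tclsP/TMul0l.
Qed.

HB.instance Definition _ :=
  GRing.isZmodule.Build talg talg_addA talg_addC talg_add0 talg_addN.

Fixpoint teval (A : algType k) (f : V -> A) (s : tterm) : A :=
  match s with
  | TCst a => a%:A
  | TGen v => f v
  | TAdd s t => teval f s + teval f t
  | TMul s t => teval f s * teval f t
  end.

Lemma teval_rel (A : algType k) (f : V -> A) s t :
  linear f -> tterm_rel s t -> teval f s = teval f t.
Proof.
move=> fL; elim=> {s t} //=.
- by move=> t s u _ -> _ ->.
- by move=> s s' t t' _ -> _ ->.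
- by move=> s s' t t' _ -> _ ->.
- by move=> s t u; rewrite addrA.
- by move=> s t; rewrite addrC.
- by move=> s; rewrite scale0r add0r.
- by move=> s t u; rewrite mulrA.
- by move=> s; rewrite scale1r mul1r.
- by move=> s; rewrite scale0r mul0r.
- by move=> s t u; rewrite mulrDl.
- by move=> s t u; rewrite mulrDr.
- by move=> a s; rewrite -scalerAl -scalerAr mul1r mulr1.
- by move=> a b; rewrite scalerDl.
- by move=> a b; rewrite -scalerAl mul1r scalerA.
- by move=> v w; rewrite -[v]scale1r fL !scale1r.
have f0 : f 0 = 0.
  by apply: (addrI (f 0)); rewrite -{1}[f 0]scale1r -fL scale1r !addr0.
by move=> a v; rewrite -[a *: v]addr0 fL f0 addr0 -scalerAl mul1r.
Qed.

Lemma talg_1_neq0 : tcls (TCst 1) != 0.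
Proof.
apply/negP => /eqP /tclsP.
have fL : linear (fun _ : V => 0 : k^o) by move=> a x y; rewrite scaler0 addr0.
by move/(teval_rel fL)/eqP; rewrite /= scale1r scale0r oner_eq0.
Qed.

HB.instance Definition _ := GRing.Zmodule_isNzRing.Build talg
  talg_mulA talg_mul1 talg_mulr1 talg_mulDl talg_mulDr talg_1_neq0.

Definition tcst (a : k) : talg := tcls (TCst a).
Definition talg_scale (a : k) (x : talg) := tcst a * x.

Lemma tcstD a b : tcst (a + b) = tcst a + tcst b.
Proof. by rewrite [RHS]talg_addE; apply/tclsP/TCstD. Qed.

Lemma tcstM a b : tcst (a * b) = tcst a * tcst b.
Proof. by rewrite [RHS]talg_mulE; apply/tclsP/TCstM. Qed.

Lemma talg_scaleA a b x : talg_scale a (talg_scale b x) = talg_scale (a * b) x.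
Proof. by rewrite /talg_scale tcstM mulrA. Qed.

Lemma talg_scale1 : left_id 1 talg_scale.
Proof. exact: mul1r. Qed.

Lemma talg_scaleDr : right_distributive talg_scale +%R.
Proof. by move=> a x y; apply: mulrDr. Qed.

Lemma talg_scaleDl x : {morph talg_scale^~ x : a b / a + b}.
Proof. by move=> a b; rewrite /talg_scale tcstD mulrDl. Qed.

HB.instance Definition _ := GRing.Zmodule_isLmodule.Build k talg
  talg_scaleA talg_scale1 talg_scaleDr talg_scaleDl.

Lemma talg_scaleAl (a : k) (x y : talg) : a *: (x * y) = (a *: x) * y.
Proof. exact: mulrA. Qed.

HB.instance Definition _ := GRing.Lmodule_isLalgebra.Build k talg talg_scaleAl.

Lemma talg_scaleAr (a : k) (x y : talg) : a *: (x * y) = x * (a *: y).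
Proof.
rewrite -![a *: _]/(tcst a * _) !mulrA; congr (_ * _).
exact: talg_cstC.
Qed.

HB.instance Definition _ := GRing.Lalgebra_isAlgebra.Build k talg talg_scaleAr.

Definition tgen (v : V) : talg := tcls (TGen v).

Lemma tcls_add s t : tcls (TAdd s t) = tcls s + tcls t.
Proof. by rewrite -talg_addE. Qed.

Lemma tcls_mul s t : tcls (TMul s t) = tcls s * tcls t.
Proof. by rewrite -talg_mulE. Qed.

Lemma tcls_cst a : tcls (TCst a) = a%:A.
Proof. exact: esym (mulr1 (tcst a)). Qed.

Lemma tgen_linear : linear tgen.
Proof.
move=> a v w.
have -> : tgen (a *: v + w) = tgen (a *: v) + tgen w.
  by rewrite -tcls_add; apply/tclsP/TGenD.
congr (_ + _).
have -> : tgen (a *: v) = tcst a * tgen v.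
  by rewrite -tcls_mul; apply/tclsP/TGenZ.
by [].
Qed.

HB.instance Definition _ := GRing.isLinear.Build k V talg *:%R tgen tgen_linear.

Lemma talg_ind (P : talg -> Prop) :
    (forall a, P a%:A) -> (forall v, P (tgen v)) ->
    (forall x y, P x -> P y -> P (x + y)) ->
    (forall x y, P x -> P y -> P (x * y)) -> forall x, P x.
Proof.
move=> Pc Pg PD PM x; rewrite -[x]tclsK; elim: (repr x) => [a|v|s Ps t Pt|s Ps t Pt].
- by rewrite tcls_cst.
- exact: Pg.
- by rewrite tcls_add; apply: PD.
- by rewrite tcls_mul; apply: PM.
Qed.

(* The algebra map T(V) -> A that extends a linear map [f]. *)
Definition talg_lift (A : algType k) (f : V -> A) (x : talg) : A :=
  teval f (repr x).

Section Lift.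
Context (A : algType k) (f : V -> A).
Hypothesis fL : linear f.

Lemma talg_lift_cls s : talg_lift f (tcls s) = teval f s.
Proof. exact/(teval_rel fL)/repr_tcls. Qed.

Lemma talg_liftE v : talg_lift f (tgen v) = f v.
Proof. by rewrite talg_lift_cls. Qed.

Lemma talg_liftP : algmap (talg_lift f).
Proof.
have M x y : talg_lift f (x * y) = talg_lift f x * talg_lift f y.
  by rewrite -[x]tclsK -[y]tclsK -tcls_mul !talg_lift_cls.
split=> [a x y|]; last by split=> //; rewrite talg_lift_cls /= scale1r.
rewrite -[a *: x]/(tcst a * x).
have D u v : talg_lift f (u + v) = talg_lift f u + talg_lift f v.
  by rewrite -[u]tclsK -[v]tclsK -tcls_add !talg_lift_cls.
by rewrite D M talg_lift_cls /= -scalerAl mul1r.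
Qed.

End Lift.

Lemma talg_ext (A : algType k) (f g : talg -> A) : algmap f -> algmap g ->
  (forall v, f (tgen v) = g (tgen v)) -> f =1 g.
Proof.
have D (h : talg -> A) : algmap h -> forall x y, h (x + y) = h x + h y.
  by move=> [hL _] x y; rewrite -[x]scale1r hL !scale1r.
have C (h : talg -> A) : algmap h -> forall a, h a%:A = a%:A.
  move=> hA a; case: (hA) => hL [h1 _].
  have h0 : h 0 = 0 by apply: (addrI (h 0)); rewrite -D // !addr0.
  by rewrite -[a%:A]addr0 hL h0 h1 addr0.
move=> fA gA fg; apply: talg_ind => [a||x y ex ey|x y ex ey] //.
- by rewrite !C.
- by rewrite !D // ex ey.
- by rewrite fA.2.2 gA.2.2 ex ey.
Qed.

(* The grading of T(V) induced by that of V. *)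
Fixpoint tterm_part (i : bool) (s : tterm) : tterm :=
  match s with
  | TCst a => TCst (if i then 0 else a)
  | TGen v => TGen (spart i v)
  | TAdd s t => TAdd (tterm_part i s) (tterm_part i t)
  | TMul s t => TAdd (TMul (tterm_part false s) (tterm_part i t))
                     (TMul (tterm_part true s) (tterm_part (~~ i) t))
  end.

Definition talg_part (i : bool) (x : talg) : talg :=
  tcls (tterm_part i (repr x)).

Lemma tterm_part_rel i s t :
  tterm_rel s t -> tcls (tterm_part i s) = tcls (tterm_part i t).
Proof.
have c0 : tcls (TCst 0) = 0 by [].
have c1 : tcls (TCst 1) = 1 by [].
move=> st; elim: st i => {s t} //=.
- by move=> t s u _ e _ e' i; rewrite e.
- by move=> s s' t t' _ e _ e' i; rewrite !tcls_add e e'.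
- by move=> s s' t t' _ e _ e' i; rewrite !(tcls_add, tcls_mul) !e !e'.
- by move=> s t u i; rewrite !tcls_add addrA.
- by move=> s t i; rewrite !tcls_add addrC.
- by move=> s i; rewrite tcls_add if_same c0 add0r.
- move=> s t u i; rewrite !(tcls_add, tcls_mul) !mulrDr !mulrDl !mulrA negbK.
  by case: i => /=; rewrite -!addrA; congr (_ + _); rewrite [RHS]addrC -addrA;
    congr (_ + _); rewrite addrC.
- by move=> s i; rewrite !(tcls_add, tcls_mul) c0 c1 mul1r mul0r addr0.
- by move=> s i; rewrite !(tcls_add, tcls_mul) !c0 !mul0r addr0 if_same.
- by move=> s t u i; rewrite !(tcls_add, tcls_mul) !mulrDl addrACA.
- by move=> s t u i; rewrite !(tcls_add, tcls_mul) !mulrDr addrACA.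
- move=> a s i; rewrite !(tcls_add, tcls_mul) !c0 mul0r addr0.
  by case: i => /=; rewrite ?c0 mulr0 ?add0r ?addr0 tcls_cst -scalerAl -scalerAr
    mul1r mulr1.
- move=> a b i; rewrite !tcls_add; case: i; rewrite ?c0 ?addr0 //.
  exact: tcstD.
- move=> a b i; rewrite !(tcls_add, tcls_mul) !c0 mul0r addr0.
  by case: i; rewrite ?c0 ?mulr0 //; exact: tcstM.
- by move=> v w i; rewrite tcls_add linearD; exact: (linearD tgen).
move=> a v i; rewrite !(tcls_add, tcls_mul) !c0 mul0r addr0 linearZ.
by rewrite -[LHS]/(tgen _) linearZ.
Qed.

Lemma talg_part_cls i s : talg_part i (tcls s) = tcls (tterm_part i s).
Proof. exact/tterm_part_rel/repr_tcls. Qed.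

Lemma talg_part_add i x y : talg_part i (x + y) = talg_part i x + talg_part i y.
Proof.
by rewrite -[x]tclsK -[y]tclsK -tcls_add !talg_part_cls tcls_add.
Qed.

Lemma talg_part_mul i x y : talg_part i (x * y) =
  talg_part false x * talg_part i y + talg_part true x * talg_part (~~ i) y.
Proof.
by rewrite -[x]tclsK -[y]tclsK -tcls_mul !talg_part_cls tcls_add !tcls_mul.
Qed.

Lemma talg_part_cst i a : talg_part i a%:A = if i then 0 else a%:A.
Proof. by rewrite -!tcls_cst talg_part_cls; case: i. Qed.

Lemma talg_part0 i : talg_part i 0 = 0.
Proof. by rewrite -(scale0r 1) talg_part_cst scale0r if_same. Qed.

Lemma talg_part_gen i v : talg_part i (tgen v) = tgen (spart i v).
Proof. by rewrite talg_part_cls. Qed.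

Lemma talg_part_linear i : linear (talg_part i).
Proof.
move=> a x y; rewrite talg_part_add -[a *: x]mulr_algl talg_part_mul.
by rewrite !talg_part_cst mul0r addr0 mulr_algl.
Qed.

Lemma talg_partK i j x :
  talg_part i (talg_part j x) = if i == j then talg_part i x else 0.
Proof.
elim/talg_ind: x i j => [a|v|x y ex ey|x y ex ey] i j.
- by rewrite !talg_part_cst; case: j; rewrite ?talg_part0 ?talg_part_cst; case: i.
- by rewrite !talg_part_gen spartK; case: eqP => // _; rewrite linear0.
- rewrite !talg_part_add ex ey; case: eqP => // _.
  by rewrite addr0.
rewrite talg_part_mul talg_part_add !talg_part_mul !ex !ey.
by case: i; case: j; rewrite /= ?(mul0r, mulr0, addr0, add0r).
Qed.

Lemma talg_partD x : talg_part false x + talg_part true x = x.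
Proof.
elim/talg_ind: x => [a|v|x y ex ey|x y ex ey].
- by rewrite !talg_part_cst addr0.
- by rewrite !talg_part_gen -linearD spartD.
- by rewrite !talg_part_add addrACA ex ey.
rewrite !talg_part_mul /= addrACA -!mulrDr.
by rewrite [talg_part true y + _]addrC ey -mulrDl ex.
Qed.

HB.instance Definition _ := isSuperModule.Build k talg
  talg_part_linear talg_partK talg_partD.

Lemma talg_homog1 : homog false (1 : talg).
Proof. by rewrite /homog -{2}[1]scale1r -(talg_part_cst false 1) scale1r. Qed.

Lemma talg_homogM i j (x y : talg) :
  homog i x -> homog j y -> homog (i (+) j) (x * y).
Proof.
move=> hx hy; rewrite /homog [LHS]talg_part_mul.
rewrite -!/(@spart k talg _ _) !(homog_spart _ hx) !(homog_spart _ hy).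
by case: i {hx}; case: j {hy}; rewrite /= ?(mul0r, mulr0, addr0, add0r).
Qed.

HB.instance Definition _ :=
  isSuperAlgebra.Build k talg talg_homog1 talg_homogM.

Lemma spart_tgen i v : spart i (tgen v) = tgen (spart i v).
Proof. exact: talg_part_gen. Qed.

Lemma homog_tgen i v : homog i v -> homog i (tgen v).
Proof. by rewrite /homog spart_tgen => ->. Qed.

Lemma talg_lift_even (A : superAlgType k) (f : V -> A) :
  linear f -> is_even f -> is_even (talg_lift f).
Proof.
move=> fL fE i x; have [lL [l1 lM]] := talg_liftP fL.
have lD u v : talg_lift f (u + v) = talg_lift f u + talg_lift f v.
  by rewrite -[u]scale1r lL !scale1r.
have pM j (u v : A) : spart j (u * v) =
    spart false u * spart j v + spart true u * spart (~~ j) v.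
  rewrite -{1}(spartD u) -{1}(spartD v) mulrDl !mulrDr !linearD /=.
  do !rewrite (homog_spart j (homogM (spart_homog _ _) (spart_homog _ _))).
  by case: j; rewrite /= ?addr0 ?add0r // addrC.
elim/talg_ind: x i => [a|v|x y ex ey|x y ex ey] i.
- have l0 : talg_lift f 0 = 0 by apply: (addrI (talg_lift f 0)); rewrite -lD !addr0.
  have lc b : talg_lift f b%:A = b%:A by rewrite -[b%:A]addr0 lL l0 l1 addr0.
  rewrite [spart i a%:A]talg_part_cst lc linearZ /= (homog_spart i (@homog1 k A)).
  by case: i; rewrite ?l0 ?scaler0 ?lc.
- by rewrite spart_tgen !talg_liftE.
- by rewrite !(linearD, lD) /= ex ey.
by rewrite [spart i (x * y)]talg_part_mul lD !lM pM !ex !ey.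
Qed.

Definition talg_counit (x : talg) : k := @talg_lift k^o (fun _ => 0) x.

Let zL : @GRing.linear_for k V k^o *:%R (fun _ => 0).
Proof. by move=> a x y; rewrite scaler0 addr0. Qed.

Lemma talg_counit_linear : scalar talg_counit.
Proof. by have [] := talg_liftP zL. Qed.

Lemma talg_counit_monoid : monoid_morphism talg_counit.
Proof. by have [] := talg_liftP zL. Qed.

Lemma talg_counit_gen v : talg_counit (tgen v) = 0.
Proof. exact: (talg_liftE zL). Qed.

Lemma talg_counit_odd x : homog true x -> talg_counit x = 0.
Proof.
have [_ M] := talg_counit_monoid.
have D u v : talg_counit (u + v) = talg_counit u + talg_counit v.
  by rewrite -[u]scale1r talg_counit_linear mul1r scale1r.
have c0 : talg_counit 0 = 0 by apply: (addrI (talg_counit 0)); rewrite -D !addr0.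
rewrite /homog => <-; elim/talg_ind: x => [a|v|x y ex ey|x y ex ey].
- by rewrite [spart _ _]talg_part_cst.
- by rewrite spart_tgen talg_counit_gen.
- by rewrite linearD D /= ex ey addr0.
by rewrite [spart _ _]talg_part_mul D !M ex ey mulr0 mul0r addr0.
Qed.

HB.instance Definition _ :=
  hasCounit.Build k talg talg_counit_linear talg_counit_odd.
HB.instance Definition _ := isAugSuperAlgebra.Build k talg talg_counit_monoid.

(* The algebra map that makes the elements of V primitive *)
Definition talg_comul : talg -> tensor talg talg :=
  talg_lift (fun v => tgen v *t 1 + 1 *t tgen v).

Definition primitive (x : talg) := talg_comul x = x *t 1 + 1 *t x.

End TensorAlgebra.

Inductive superideal (k : comNzRingType) (A : superAlgType k) (S : A -> Prop) :
    A -> Prop :=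
| SuperidealGen x : S x -> superideal S x
| Superideal0 : superideal S 0
| SuperidealD x y : superideal S x -> superideal S y -> superideal S (x + y)
| SuperidealMl a x : superideal S x -> superideal S (a * x)
| SuperidealMr a x : superideal S x -> superideal S (x * a)
| SuperidealPart i x : superideal S x -> superideal S (spart i x).

Record prim_rel (k : comNzRingType) (V : superModType k) := PrimRel {
  prel :> talg V -> Prop;
  prel_primitive : forall s, prel s -> primitive s
}.

Section HopfQuotient.
Context (k : comNzRingType) (V : superModType k) (S : prim_rel V).

Let I := superideal (prel S).

Lemma superidealZ a x : I x -> I (a *: x).
Proof. by move=> Ix; rewrite -mulr_algl; apply: SuperidealMl. Qed.

Lemma superidealN x : I x -> I (- x).
Proof. by rewrite -scaleN1r; apply: superidealZ. Qed.

Lemma counit_primitive (x : talg V) : primitive x -> counit x = 0.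
Proof.
move=> px.
have cL : linear (fun v : V => tgen v *t 1 + 1 *t tgen v).
  by move=> a v w; rewrite linearP ptensDl ptensDr ptensZl ptensZr scalerDr addrACA.
have cA := talg_liftP cL.
have [tL [t1 tM]] : algmap (talg_comul (V := V)) := cA.
have /talg_ext E : @algmap k (talg V) (talg V)
    (@counitl k (talg V) \o talg_comul (V := V)).
  exact: algmap_comp (counitl_algmap _) cA.
have /E {}E := algmap_id (talg V).
have {E} /= : counitl (talg_comul x) = x.
  apply: E => v /=; rewrite /talg_comul (talg_liftE cL) linearD /= !counitlE.
  by rewrite [counit (tgen v)]talg_counit_gen scale0r add0r rmorph1 scale1r.
rewrite px linearD /= !counitlE rmorph1 scale1r.
move/(canRL (addrK _)); rewrite subrr => /(congr1 (@counit k (talg V))).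
by rewrite linearZ /= rmorph1 mulr1 linear0.
Qed.

Lemma counit_superideal x : I x -> counit x = 0.
Proof.
elim=> {x} [x /prel_primitive /counit_primitive //||x y _ ex _ ey|a x _ ex|a x _ ex|i x _ ex].
- exact: linear0.
- by rewrite linearD /= ex ey addr0.
- by rewrite rmorphM /= ex mulr0.
- by rewrite rmorphM /= ex mul0r.
case: i; first by rewrite (counit_odd (spart_homog _ _)).
by rewrite -ex -{2}(spartD x) linearD /= (counit_odd (spart_homog true x)) addr0.
Qed.

Definition hquot_eqv : rel (talg V) := fun x y => `[< I (x - y) >].

Lemma hquot_eqv_refl : reflexive hquot_eqv.
Proof. by move=> x; apply/asboolP; rewrite subrr; apply: Superideal0. Qed.

Lemma hquot_eqv_sym : symmetric hquot_eqv.
Proof.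
by move=> x y; apply/asboolP/asboolP => /superidealN; rewrite opprB.
Qed.

Lemma hquot_eqv_trans : transitive hquot_eqv.
Proof.
move=> y x z /asboolP xy /asboolP yz; apply/asboolP.
by rewrite -(subrKA y); apply: SuperidealD.
Qed.

Canonical hquot_equiv :=
  EquivRel hquot_eqv hquot_eqv_refl hquot_eqv_sym hquot_eqv_trans.

(* T(V) / (S).  Since the elements of S are primitive, the super-ideal (S) is
   automatically a Hopf super-ideal. *)
Definition hquot := {eq_quot hquot_equiv}.

HB.instance Definition _ := Choice.on hquot.
HB.instance Definition _ := EqQuotient.on hquot.

Definition hpi (x : talg V) : hquot := \pi_hquot x.

Lemma hpiP x y : I (x - y) <-> hpi x = hpi y.
Proof.
split=> [xy | /eqmodP /asboolP //].
by apply/eqmodP/asboolP.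
Qed.

Lemma hpiK x : hpi (repr x) = x. Proof. exact: reprK. Qed.

Lemma repr_hpi x : I (repr (hpi x) - x).
Proof. by apply/hpiP; rewrite hpiK. Qed.

Definition hadd (x y : hquot) := hpi (repr x + repr y).
Definition hopp (x : hquot) := hpi (- repr x).
Definition hmul (x y : hquot) := hpi (repr x * repr y).
Definition hscale a (x : hquot) := hpi (a *: repr x).
Definition hquot_part i (x : hquot) := hpi (spart i (repr x)).

Lemma haddE x y : hadd (hpi x) (hpi y) = hpi (x + y).
Proof.
by apply/hpiP; rewrite opprD addrACA; apply: SuperidealD; apply: repr_hpi.
Qed.

Lemma hoppE x : hopp (hpi x) = hpi (- x).
Proof. by apply/hpiP; rewrite -opprD; apply/superidealN/repr_hpi. Qed.

Lemma hmulE x y : hmul (hpi x) (hpi y) = hpi (x * y).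
Proof.
apply/hpiP; rewrite -(subrKA (x * repr (hpi y))) -mulrBl -mulrBr.
apply: SuperidealD; first exact/SuperidealMr/repr_hpi.
exact/SuperidealMl/repr_hpi.
Qed.

Lemma hscaleE a x : hscale a (hpi x) = hpi (a *: x).
Proof. by apply/hpiP; rewrite -scalerBr; apply/superidealZ/repr_hpi. Qed.

Lemma hquot_partE i x : hquot_part i (hpi x) = hpi (spart i x).
Proof. by apply/hpiP; rewrite -linearB; apply/SuperidealPart/repr_hpi. Qed.

Lemma haddA : associative hadd.
Proof.
by move=> x y z; rewrite -[x]hpiK -[y]hpiK -[z]hpiK !haddE addrA.
Qed.

Lemma haddC : commutative hadd.
Proof. by move=> x y; rewrite /hadd addrC. Qed.

Lemma hadd0 : left_id (hpi 0) hadd.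
Proof. by move=> x; rewrite -[x]hpiK haddE add0r. Qed.

Lemma haddN : left_inverse (hpi 0) hopp hadd.
Proof. by move=> x; rewrite -[x]hpiK hoppE haddE addNr. Qed.

HB.instance Definition _ :=
  GRing.isZmodule.Build hquot haddA haddC hadd0 haddN.

Lemma hmulA : associative hmul.
Proof.
by move=> x y z; rewrite -[x]hpiK -[y]hpiK -[z]hpiK !hmulE mulrA.
Qed.

Lemma hmul1 : left_id (hpi 1) hmul.
Proof. by move=> x; rewrite -[x]hpiK hmulE mul1r. Qed.

Lemma hmulr1 : right_id (hpi 1) hmul.
Proof. by move=> x; rewrite -[x]hpiK hmulE mulr1. Qed.

Lemma hmulDl : left_distributive hmul +%R.
Proof.
move=> x y z; rewrite -[x]hpiK -[y]hpiK -[z]hpiK.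
by rewrite -[_ + _]/(hadd _ _) haddE !hmulE mulrDl -haddE.
Qed.

Lemma hmulDr : right_distributive hmul +%R.
Proof.
move=> x y z; rewrite -[x]hpiK -[y]hpiK -[z]hpiK.
by rewrite -[_ + _]/(hadd _ _) haddE !hmulE mulrDr -haddE.
Qed.

Lemma h1_neq0 : hpi 1 != 0.
Proof.
apply/negP => /eqP /hpiP; rewrite subr0 => /counit_superideal /eqP.
by rewrite rmorph1 oner_eq0.
Qed.

HB.instance Definition _ := GRing.Zmodule_isNzRing.Build hquot
  hmulA hmul1 hmulr1 hmulDl hmulDr h1_neq0.

Lemma hscaleA a b x : hscale a (hscale b x) = hscale (a * b) x.
Proof. by rewrite -[x]hpiK !hscaleE scalerA. Qed.

Lemma hscale1 : left_id 1 hscale.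
Proof. by move=> x; rewrite -[x]hpiK hscaleE scale1r. Qed.

Lemma hscaleDr : right_distributive hscale +%R.
Proof.
move=> a x y; rewrite -[x]hpiK -[y]hpiK.
by rewrite -[_ + _]/(hadd _ _) haddE !hscaleE scalerDr -haddE.
Qed.

Lemma hscaleDl x : {morph hscale^~ x : a b / a + b}.
Proof. by move=> a b; rewrite -[x]hpiK !hscaleE scalerDl -haddE. Qed.

HB.instance Definition _ := GRing.Zmodule_isLmodule.Build k hquot
  hscaleA hscale1 hscaleDr hscaleDl.

Lemma hscaleAl (a : k) (x y : hquot) : a *: (x * y) = (a *: x) * y.
Proof.
rewrite -[x]hpiK -[y]hpiK -[LHS]/(hscale _ (hmul _ _)).
by rewrite -[RHS]/(hmul (hscale _ _) _) !(hmulE, hscaleE) scalerAl.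
Qed.

HB.instance Definition _ := GRing.Lmodule_isLalgebra.Build k hquot hscaleAl.

Lemma hscaleAr (a : k) (x y : hquot) : a *: (x * y) = x * (a *: y).
Proof.
rewrite -[x]hpiK -[y]hpiK -[LHS]/(hscale _ (hmul _ _)).
by rewrite -[RHS]/(hmul _ (hscale _ _)) !(hmulE, hscaleE) scalerAr.
Qed.

HB.instance Definition _ := GRing.Lalgebra_isAlgebra.Build k hquot hscaleAr.

Lemma hpi_algmap : algmap hpi.
Proof.
split=> [a x y|]; first by rewrite -haddE -hscaleE.
by split=> // x y; rewrite -hmulE.
Qed.

HB.instance Definition _ :=
  GRing.isLinear.Build k (talg V) hquot *:%R hpi hpi_algmap.1.
HB.instance Definition _ :=
  GRing.isMonoidMorphism.Build (talg V) hquot hpi hpi_algmap.2.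

Lemma hquot_part_linear i : linear (hquot_part i).
Proof.
by move=> a x y; rewrite -[x]hpiK -[y]hpiK -linearP !hquot_partE !linearP.
Qed.

Lemma hquot_partK i j x : hquot_part i (hquot_part j x) = if i == j then hquot_part i x else 0.
Proof. by rewrite -[x]hpiK !hquot_partE spartK; case: eqP => // _; rewrite linear0. Qed.

Lemma hquot_partD x : hquot_part false x + hquot_part true x = x.
Proof. by rewrite -[x]hpiK !hquot_partE -linearD spartD. Qed.

HB.instance Definition _ :=
  isSuperModule.Build k hquot hquot_part_linear hquot_partK hquot_partD.

Lemma hpi_even : is_even hpi.
Proof. by move=> i x; rewrite [RHS]hquot_partE. Qed.

Lemma hhomog1 : homog false (1 : hquot).
Proof. exact: (even_homog hpi_even (@homog1 k (talg V))). Qed.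

Lemma hhomogM i j (x y : hquot) :
  homog i x -> homog j y -> homog (i (+) j) (x * y).
Proof.
have R l (z : hquot) : homog l z -> z = hpi (spart l (repr z)).
  by rewrite hpi_even hpiK.
move=> /R -> /R ->; rewrite -rmorphM; apply: (even_homog hpi_even).
by apply: homogM; apply: spart_homog.
Qed.

HB.instance Definition _ := isSuperAlgebra.Build k hquot hhomog1 hhomogM.

Definition hgen (v : V) : hquot := hpi (tgen v).

HB.instance Definition _ := GRing.Linear.copy hgen (hpi \o @tgen k V).

Lemma hgen_even : is_even hgen.
Proof. by move=> i v; rewrite /hgen -hpi_even spart_tgen. Qed.

(* The algebra map T(V)/(S) -> A induced by an even linear map [f] such that
   T(V) -> A vanishes on S. *)
Definition hlift (A : algType k) (f : V -> A) (x : hquot) : A :=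
  talg_lift f (repr x).

Lemma hlift_pi (A : superAlgType k) (f : V -> A) :
    linear f -> is_even f -> (forall s, S s -> talg_lift f s = 0) ->
  forall x, hlift f (hpi x) = talg_lift f x.
Proof.
move=> fL fE fS x; have [lL [l1 lM]] := talg_liftP fL.
pose l : {linear talg V -> A} :=
  HB.pack (talg_lift f) (GRing.isLinear.Build _ _ _ _ (talg_lift f) lL).
have l0 : talg_lift f 0 = 0 := linear0 l.
have lB u v : talg_lift f (u - v) = talg_lift f u - talg_lift f v.
  exact: (linearB l).
have lI y : I y -> talg_lift f y = 0.
  elim=> {y} [y||y z _ ey _ ez|a y _ ey|a y _ ey|i y _ ey] //.
  - exact: fS.
  - by rewrite -[y]scale1r lL ey ez scaler0 addr0.
  - by rewrite lM ey mulr0.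
  - by rewrite lM ey mul0r.
  - by rewrite (talg_lift_even fL fE) ey linear0.
by apply/eqP; rewrite -subr_eq0 -lB lI //; apply: repr_hpi.
Qed.

Section Lift.
Context (A : superAlgType k) (f : V -> A).
Hypotheses (fL : linear f) (fE : is_even f).
Hypothesis fS : forall s, S s -> talg_lift f s = 0.

Lemma hliftE v : hlift f (hgen v) = f v.
Proof. by rewrite hlift_pi // talg_liftE. Qed.

Lemma hlift_algmap : algmap (hlift f).
Proof.
have [lL [l1 lM]] := talg_liftP fL; have E := hlift_pi fL fE fS.
split=> [a x y|].
  by rewrite -[x]hpiK -[y]hpiK -linearP !E lL.
split=> [|x y]; first by rewrite -[1]/(hpi 1) E l1.
by rewrite -[x]hpiK -[y]hpiK -rmorphM !E lM.
Qed.

Lemma hlift_even : is_even (hlift f).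
Proof.
move=> i x; have E := hlift_pi fL fE fS.
by rewrite -[x]hpiK -hpi_even !E (talg_lift_even fL fE).
Qed.

End Lift.

Lemma hquot_ext (A : algType k) (f g : hquot -> A) : algmap f -> algmap g ->
  (forall v, f (hgen v) = g (hgen v)) -> f =1 g.
Proof.
move=> fA gA fg x; rewrite -[x]hpiK.
exact: (talg_ext (algmap_comp fA hpi_algmap) (algmap_comp gA hpi_algmap)).
Qed.

Definition hcounit (x : hquot) : k := counit (repr x).

Lemma hcounitE x : hcounit (hpi x) = counit x.
Proof.
by apply/eqP; rewrite -subr_eq0 -linearB /= counit_superideal //; apply: repr_hpi.
Qed.

Lemma hcounit_linear : scalar hcounit.
Proof. by move=> a x y; rewrite -[x]hpiK -[y]hpiK -linearP !hcounitE; apply: counit_linear. Qed.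

Lemma hcounit_odd x : homog true x -> hcounit x = 0.
Proof.
move=> <-; rewrite -[x]hpiK -hpi_even hcounitE.
by rewrite (counit_odd (spart_homog _ _)).
Qed.

HB.instance Definition _ := hasCounit.Build k hquot hcounit_linear hcounit_odd.

Lemma counit_hpi x : counit (hpi x) = counit x.
Proof. exact: hcounitE. Qed.

Lemma hcounit_monoid : monoid_morphism (@counit k hquot).
Proof.
split=> [|x y]; first by rewrite -[1]/(hpi 1) counit_hpi rmorph1.
by rewrite -[x]hpiK -[y]hpiK -rmorphM /= !counit_hpi rmorphM.
Qed.

HB.instance Definition _ := isAugSuperAlgebra.Build k hquot hcounit_monoid.

Lemma counit_hgen v : counit (hgen v) = 0.
Proof. by rewrite [LHS]hcounitE; apply: talg_counit_gen. Qed.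

(* The superalgebra map with v |-> v (x) 1 + 1 (x) v for v in V *)
Definition hcomul : hquot -> tensor hquot hquot :=
  hlift (fun v => hgen v *t 1 + 1 *t hgen v).

Let cL : linear (fun v => hgen v *t 1 + 1 *t hgen v : tensor hquot hquot).
Proof.
by move=> a v w; rewrite linearP ptensDl ptensDr ptensZl ptensZr scalerDr addrACA.
Qed.

Let cE : is_even (fun v => hgen v *t 1 + 1 *t hgen v : tensor hquot hquot).
Proof.
move=> i v; rewrite linearD /= !spart_ptens !(homog_spart _ (@homog1 k hquot)).
rewrite !hgen_even; case: i;
  by rewrite /= !(ptens0l, ptens0r, addr0, add0r).
Qed.

Let cS s : S s ->
  talg_lift (fun v => hgen v *t 1 + 1 *t hgen v : tensor hquot hquot) s = 0.
Proof.
move=> Ss; have ps := prel_primitive Ss.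
have tL : linear (fun v : V => tgen v *t 1 + 1 *t tgen v).
  by move=> a v w; rewrite linearP ptensDl ptensDr ptensZl ptensZr scalerDr addrACA.
have e : talg_lift (fun v => hgen v *t 1 + 1 *t hgen v : tensor hquot hquot) =1
    tmap hpi hpi \o talg_comul (V := V).
  apply: talg_ext => [||v]; first exact: talg_liftP.
    apply: algmap_comp (talg_liftP tL).
    exact: (tmap_algmap hpi_algmap hpi_algmap hpi_even hpi_even).
  by rewrite (talg_liftE cL) /= /talg_comul (talg_liftE tL) linearD /= !tmapE.
rewrite e /= ps linearD /= !tmapE /=.
have -> : hpi s = 0.
  by apply/hpiP; rewrite subr0; apply: SuperidealGen.
by rewrite ptens0l ptens0r addr0.
Qed.

Lemma hcomul_gen v : hcomul (hgen v) = hgen v *t 1 + 1 *t hgen v.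
Proof. exact: (hliftE cL cE cS). Qed.

Lemma hcomul_algmap : algmap hcomul.
Proof. exact: (hlift_algmap cL cE cS). Qed.

Lemma hcomul_linear : linear hcomul.
Proof. exact: hcomul_algmap.1. Qed.

HB.instance Definition _ := GRing.isLinear.Build k _ _ *:%R hcomul hcomul_linear.

Lemma hcomul_even : is_even hcomul.
Proof. exact: (hlift_even cL cE cS). Qed.

Let h1 : hcomul 1 = 1 *t 1.
Proof. exact: hcomul_algmap.2.1. Qed.

Lemma hcomulA x :
  tassoc (tmap hcomul idfun (hcomul x)) = tmap idfun hcomul (hcomul x).
Proof.
have iE : is_even (@idfun hquot) by [].
have cA := hcomul_algmap.
apply: (hquot_ext (f := @tassoc k _ _ _ \o (tmap hcomul idfun \o hcomul))
  (g := tmap idfun hcomul \o hcomul)) => [||v].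
- apply: algmap_comp; first exact: tassoc_algmap.
  apply: (algmap_comp _ cA).
  exact: (tmap_algmap cA (algmap_id _) hcomul_even iE).
- apply: (algmap_comp _ cA).
  exact: (tmap_algmap (algmap_id _) cA iE hcomul_even).
rewrite /= hcomul_gen !linearD /= !tmapE /= hcomul_gen h1.
by rewrite ptensDl ptensDr !linearD /= !tassocE addrA.
Qed.

Lemma hcomul_counitl x : counitl (hcomul x) = x.
Proof.
apply: (hquot_ext (f := @counitl k hquot \o hcomul) (g := idfun)) => [||v].
- exact: algmap_comp (counitl_algmap _) hcomul_algmap.
- exact: algmap_id.
rewrite /= hcomul_gen linearD /= !counitlE counit_hgen rmorph1.
by rewrite scale0r add0r scale1r.
Qed.

Lemma hcomul_counitr x : counitr (hcomul x) = x.
Proof.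
apply: (hquot_ext (f := @counitr k hquot \o hcomul) (g := idfun)) => [||v].
- exact: algmap_comp (counitr_algmap _) hcomul_algmap.
- exact: algmap_id.
rewrite /= hcomul_gen linearD /= !counitrE counit_hgen rmorph1.
by rewrite scale0r addr0 scale1r.
Qed.

HB.instance Definition _ := isSuperCoalgebra.Build k hquot
  hcomul_linear hcomul_even hcomulA hcomul_counitl hcomul_counitr.

End HopfQuotient.

Section Primitives.
Context (k : comNzRingType) (V : superModType k).

Let cL : linear (fun v : V => tgen v *t 1 + 1 *t tgen v).
Proof.
by move=> a v w; rewrite linearP ptensDl ptensDr ptensZl ptensZr scalerDr addrACA.
Qed.

Lemma talg_comul_linear : linear (@talg_comul k V).
Proof. by have [] := talg_liftP cL. Qed.

HB.instance Definition _ :=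
  GRing.isLinear.Build k _ _ *:%R (@talg_comul k V) talg_comul_linear.

Lemma talg_comul_gen (v : V) :
  talg_comul (tgen v) = tgen v *t 1 + 1 *t tgen v.
Proof. exact: (talg_liftE cL). Qed.

Lemma talg_comulM (x y : talg V) :
  talg_comul (x * y) = talg_comul x * talg_comul y.
Proof. by have [_ [_ M]] := talg_liftP cL; apply: M. Qed.

Lemma primitive_gen (v : V) : primitive (tgen v).
Proof. exact: talg_comul_gen. Qed.

Lemma primitiveB (x y : talg V) : primitive x -> primitive y -> primitive (x - y).
Proof.
rewrite /primitive linearB /= => -> ->.
by rewrite ptensDl ptensDr ptensNl ptensNr opprD addrACA.
Qed.

Lemma talg_comul_genM i j (v w : V) : homog i v -> homog j w ->
  talg_comul (tgen v * tgen w) =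
  (tgen v * tgen w) *t 1 + 1 *t (tgen v * tgen w) +
  (tgen v *t tgen w + (-1) ^+ (i && j) *: (tgen w *t tgen v)).
Proof.
move=> /homog_tgen hv /homog_tgen hw; have h1 := @homog1 k (talg V).
rewrite talg_comulM !talg_comul_gen mulrDl !mulrDr.
rewrite (ptensM _ _ h1 hw) (ptensM _ _ h1 h1) (ptensM _ _ hv hw) (ptensM _ _ hv h1).
rewrite !scale1r !mulr1 !mul1r -!addrA; congr (_ + _).
by rewrite andbF scale1r [RHS]addrC -addrA.
Qed.

Lemma primitive_bracket i j (v w : V) : homog i v -> homog j w ->
  primitive (tgen v * tgen w - (-1) ^+ (i && j) *: (tgen w * tgen v)).
Proof.
move=> hv hw; rewrite /primitive linearB linearZ /=.
rewrite (talg_comul_genM hv hw) (talg_comul_genM hw hv) [j && i]andbC.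
rewrite !scalerDr scalerA -signr_addb addbb scale1r.
rewrite [X in _ - (_ + X)]addrC opprD addrACA subrr addr0.
by rewrite ptensDl ptensDr ptensNl ptensNr ptensZl ptensZr opprD addrACA.
Qed.

Lemma primitive_square (v : V) : homog true v -> primitive (tgen v * tgen v).
Proof.
move=> hv; rewrite /primitive (talg_comul_genM hv hv) /= expr1 scaleN1r.
by rewrite subrr addr0.
Qed.

End Primitives.

Definition in_degree (k : comNzRingType) (i : bool) (M : lmodType k) : Type := M.

Section InDegree.
Context (k : comNzRingType) (i : bool) (M : lmodType k).

HB.instance Definition _ := GRing.Lmodule.on (in_degree i M).

Definition in_degree_part (j : bool) (x : in_degree i M) : in_degree i M :=
  if j == i then x else 0.

Lemma in_degree_part_linear j : linear (in_degree_part j).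
Proof.
by move=> a x y; rewrite /in_degree_part; case: eqP => // _; rewrite scaler0 addr0.
Qed.

Lemma in_degree_partK j l x : in_degree_part j (in_degree_part l x) =
  if j == l then in_degree_part j x else 0.
Proof.
rewrite /in_degree_part; case: (l =P i) => [->|li]; first by case: ifP.
by rewrite if_same; case: eqP => // ->; case: eqP.
Qed.

Lemma in_degree_partD x : in_degree_part false x + in_degree_part true x = x.
Proof. by rewrite /in_degree_part; case: i; rewrite ?add0r ?addr0. Qed.

HB.instance Definition _ := isSuperModule.Build k (in_degree i M)
  in_degree_part_linear in_degree_partK in_degree_partD.

Lemma in_degree_homog (x : in_degree i M) : homog i x.
Proof. by rewrite /homog /spart /= /in_degree_part eqxx. Qed.

End InDegree.

Section HomogeneousPart.
Context (k : comNzRingType) (V : superModType k) (i : bool).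

Definition homog_pred : {pred V} := fun v => spart i v == v.

Lemma homog_predP (v : V) : reflect (homog i v) (v \in homog_pred).
Proof. exact: eqP. Qed.

Lemma homog_pred_closed : submod_closed homog_pred.
Proof.
split=> [|a x y /homog_predP hx /homog_predP hy]; apply/homog_predP.
  exact: linear0.
exact: homogD (homogZ a hx) hy.
Qed.

HB.instance Definition _ :=
  GRing.isSubmodClosed.Build k V homog_pred homog_pred_closed.

(* The k-module V_i *)
Record hpart := HPart { hpart_val :> V; _ : hpart_val \in homog_pred }.

HB.instance Definition _ := [isSub for hpart_val].
HB.instance Definition _ := [Choice of hpart by <:].
HB.instance Definition _ := [SubChoice_isSubLmodule of hpart by <:].

Lemma hpart_val_linear : linear hpart_val.
Proof. by move=> a x y; apply: (linearP (\val : hpart -> V)). Qed.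

HB.instance Definition _ :=
  GRing.isLinear.Build k hpart V *:%R hpart_val hpart_val_linear.

Lemma hpart_val_inj : injective hpart_val.
Proof. exact: val_inj. Qed.

Lemma hpart_homog (x : hpart) : homog i (x : V).
Proof. by apply/homog_predP; apply: valP. Qed.

Definition to_hpart (v : V) (hv : homog i v) : hpart :=
  HPart (introT (homog_predP v) hv).

End HomogeneousPart.

Definition flat_module (k : comNzRingType) (P : lmodType k) :=
  forall (M N : lmodType k) (f : {linear M -> N}),
    injective f -> injective (tmap f (@idfun P)).

Definition free_module (k : comNzRingType) (P : lmodType k) :=
  exists (I : choiceType) (e : I -> P),
    (forall x, exists (s : seq I) (c : I -> k), x = \sum_(i <- s) c i *: e i) /\
    (forall (s : seq I) (c : I -> k), uniq s ->
       \sum_(i <- s) c i *: e i = 0 -> forall i, i \in s -> c i = 0).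

HB.mixin Record isLieAlgebra (k : comNzRingType) L of GRing.Lmodule k L := {
  lie : L -> L -> L;
  lie_bilin : bilin lie;
  liexx : forall x, lie x x = 0;
  lie_jacobi : forall x y z,
    lie (lie x y) z + lie (lie y z) x + lie (lie z x) y = 0
}.

#[short(type="lieAlgType")]
HB.structure Definition LieAlgebra (k : comNzRingType) :=
  {L of GRing.Lmodule k L & isLieAlgebra k L}.

(* Antisymmetry and the Jacobi identity, stated in the paper with the symmetry
   c, are written out on homogeneous elements. *)
HB.mixin Record isLieSuperAlgebra (k : comNzRingType) g of SuperModule k g := {
  slie : g -> g -> g;
  slie_bilin : bilin slie;
  slie_homog : forall i j (u v : g),
    homog i u -> homog j v -> homog (i (+) j) (slie u v);
  slie_even : forall u : g, homog false u -> slie u u = 0;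
  slie_odd : forall v : g, homog true v -> slie (slie v v) v = 0;
  slie_antisym : forall i j (u v : g), homog i u -> homog j v ->
    slie u v + (-1) ^+ (i && j) *: slie v u = 0;
  slie_jacobi : forall i j l (u v w : g),
    homog i u -> homog j v -> homog l w ->
    slie (slie u v) w
    + (-1) ^+ (i && (j (+) l)) *: slie (slie v w) u
    + (-1) ^+ ((i (+) j) && l) *: slie (slie w u) v = 0
}.

#[short(type="lieSuperAlgType")]
HB.structure Definition LieSuperAlgebra (k : comNzRingType) :=
  {g of SuperModule k g & isLieSuperAlgebra k g}.

Arguments slie_homog {k s i j u v} _ _.
Arguments slie_jacobi {k s i j l u v w} _ _ _.

Section EvenPart.
Context (k : comNzRingType) (g : lieSuperAlgType k).

Definition lie0 (x y : hpart g false) : hpart g false :=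
  to_hpart (slie_homog (hpart_homog x) (hpart_homog y)).

Lemma lie0_bilin : bilin lie0.
Proof.
have E x y : hpart_val (lie0 x y) = slie (hpart_val x) (hpart_val y) by [].
split=> z a x y; apply: hpart_val_inj.
  by rewrite [RHS]hpart_val_linear !E hpart_val_linear;
    apply: slie_bilin.1.
by rewrite [RHS]hpart_val_linear !E hpart_val_linear;
  apply: slie_bilin.2.
Qed.

Lemma lie0xx x : lie0 x x = 0.
Proof.
by apply: hpart_val_inj; rewrite linear0 /= slie_even //; apply: hpart_homog.
Qed.

Lemma lie0_jacobi x y z :
  lie0 (lie0 x y) z + lie0 (lie0 y z) x + lie0 (lie0 z x) y = 0.
Proof.
apply: hpart_val_inj; rewrite linear0 !linearD /=.
have := slie_jacobi (hpart_homog x) (hpart_homog y) (hpart_homog z).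
by rewrite !scale1r.
Qed.

HB.instance Definition _ := isLieAlgebra.Build k (hpart g false)
  lie0_bilin lie0xx lie0_jacobi.

End EvenPart.

Definition admissible (k : comNzRingType) (g : lieSuperAlgType k) :=
  [/\ flat_module (hpart g false),
      free_module (hpart g true) &
      forall v : g, homog true v ->
        exists u : g, homog false u /\ slie v v = u *+ 2].

Lemma flat_torsion_free (k : comNzRingType) (P : lmodType k) :
    (forall a : k, a *+ 2 = 0 -> a = 0) -> flat_module P ->
  forall u : P, u *+ 2 = 0 -> u = 0.
Proof.
move=> k2 flP u u2.
have dL : linear (fun a : k^o => a *+ 2 : k^o).
  by move=> a x y; rewrite mulrnDl scalerMnr.
pose d : {linear k^o -> k^o} := HB.pack (fun a : k^o => a *+ 2 : k^o)
  (GRing.isLinear.Build _ _ _ _ (fun a : k^o => a *+ 2 : k^o) dL).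
have d_inj : injective d.
  move=> a b /eqP; rewrite -subr_eq0 -linearB => /eqP /k2 /eqP.
  by rewrite subr_eq0 => /eqP.
have b : bilin (fun (a : k^o) (x : P) => (a : k) *: x).
  split=> z a x y; first by rewrite scalerDl scalerA.
  by rewrite scalerDr !scalerA mulrC.
have /(congr1 (tlift (fun (a : k^o) (x : P) => (a : k) *: x))) :
    (1 : k^o) *t u = 0 *t u.
  apply: (flP _ _ _ d_inj); rewrite !tmapE /= mul0rn ptens0l.
  by rewrite mulr2n ptensDl -ptensDr -mulr2n u2 ptens0r.
by rewrite !(tliftE b) scale1r scale0r.
Qed.

Lemma half_unique (k : comNzRingType) (g : lieSuperAlgType k) :
    (forall a : k, a *+ 2 = 0 -> a = 0) -> admissible g ->
  forall u u' : g, homog false u -> homog false u' -> u *+ 2 = u' *+ 2 -> u = u'.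
Proof.
move=> k2 [fl _ _] u u' hu hu' e; apply/eqP; rewrite -subr_eq0; apply/eqP.
have h : homog false (u - u').
  by rewrite -scaleN1r; apply: homogD hu (homogZ _ hu').
apply: (congr1 (@hpart_val k g false) (x := to_hpart h) (y := 0)).
apply: (flat_torsion_free k2 fl); apply: hpart_val_inj.
by rewrite !mulr2n linearD linear0 /= -mulr2n mulrnBl e subrr.
Qed.

Section Envelopes.
Context (k : comNzRingType).

Section LieEnvelope.
Context (L : lieAlgType k).

Inductive lie_env_rel : talg (in_degree false L) -> Prop :=
| LieEnvRel (x y : in_degree false L) :
    lie_env_rel (tgen x * tgen y - tgen y * tgen x
                 - tgen (lie x y : in_degree false L)).

Lemma lie_env_rel_primitive s : lie_env_rel s -> primitive s.
Proof.
case=> x y; apply: primitiveB; last exact: primitive_gen.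
have := primitive_bracket (in_degree_homog x) (in_degree_homog y).
by rewrite scale1r.
Qed.

Definition lie_env := hquot (PrimRel lie_env_rel_primitive).

HB.instance Definition _ := AugSuperAlgebra.on lie_env.
HB.instance Definition _ := SuperCoalgebra.on lie_env.

End LieEnvelope.

Section ExteriorAlgebra.
Context (M : lmodType k).

Inductive ext_rel : talg (in_degree true M) -> Prop :=
| ExtRel (v : in_degree true M) : ext_rel (tgen v * tgen v).

Lemma ext_rel_primitive s : ext_rel s -> primitive s.
Proof. by case=> v; apply/primitive_square/in_degree_homog. Qed.

(* T(M) / (v ^ 2 : v in M), with M placed in odd degree *)
Definition exterior := hquot (PrimRel ext_rel_primitive).

HB.instance Definition _ := AugSuperAlgebra.on exterior.
HB.instance Definition _ := SuperCoalgebra.on exterior.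

End ExteriorAlgebra.

Section SuperEnvelope.
Context (g : lieSuperAlgType k).

(* In the second relation u is an even element with 2 u = [v, v]; when g is
   admissible and k is 2-torsion free, u is unique and is (1/2)[v, v]. *)
Inductive super_env_rel : talg g -> Prop :=
| SuperEnvBracket i j (z w : g) : homog i z -> homog j w ->
    super_env_rel (tgen z * tgen w - (-1) ^+ (i && j) *: (tgen w * tgen z)
                   - tgen (slie z w))
| SuperEnvSquare (v u : g) : homog true v -> homog false u ->
    slie v v = u *+ 2 -> super_env_rel (tgen v * tgen v - tgen u).

Lemma super_env_rel_primitive s : super_env_rel s -> primitive s.
Proof.
case=> [i j z w hz hw|v u hv _ _]; apply: primitiveB; try exact: primitive_gen.
  exact: primitive_bracket.
exact: primitive_square.
Qed.

Definition super_env := hquot (PrimRel super_env_rel_primitive).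

HB.instance Definition _ := AugSuperAlgebra.on super_env.
HB.instance Definition _ := SuperCoalgebra.on super_env.

(* The map U(g_0) -> U(g) induced by the inclusion of g_0 *)
Definition env_incl : lie_env (hpart g false) -> super_env :=
  hlift (fun x : in_degree false (hpart g false) =>
           hgen (PrimRel super_env_rel_primitive) (hpart_val x)).

Let f (x : in_degree false (hpart g false)) : super_env :=
  hgen (PrimRel super_env_rel_primitive) (hpart_val x).

Let fL : linear f.
Proof. by move=> a x y; rewrite /f (hpart_val_linear a x y) linearP. Qed.

Let fE : is_even f.
Proof.
move=> i x; rewrite /f -hgen_even /spart /= /in_degree_part.
rewrite -[_ i (hpart_val x)]/(spart i (hpart_val x)).
by rewrite (homog_spart i (hpart_homog x)); case: eqP.
Qed.

Let fS s : lie_env_rel s -> talg_lift f s = 0.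
Proof.
case=> x y; have [lL [l1 lM]] := talg_liftP fL.
have lB u v : talg_lift f (u - v) = talg_lift f u - talg_lift f v.
  by rewrite addrC -scaleN1r lL scaleN1r addrC.
pose R := PrimRel super_env_rel_primitive.
have h (z : in_degree false (hpart g false)) : homog false (hpart_val z).
  exact: hpart_homog.
have : hpi R (tgen (hpart_val x) * tgen (hpart_val y)
    - tgen (hpart_val y) * tgen (hpart_val x)
    - tgen (slie (hpart_val x) (hpart_val y))) = hpi R 0.
  apply/hpiP; rewrite subr0; apply: SuperidealGen.
  by have := SuperEnvBracket (h x) (h y); rewrite scale1r.
rewrite !linearB !rmorphM linear0 /= => <-.
by rewrite !lB !lM !(talg_liftE fL).
Qed.

Let R0 := PrimRel (@lie_env_rel_primitive (hpart g false)).

Lemma env_inclE x :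
  env_incl (hgen (PrimRel (@lie_env_rel_primitive (hpart g false))) x) =
  hgen (PrimRel super_env_rel_primitive) (hpart_val x).
Proof. exact: (hliftE (S := R0) fL fE fS). Qed.

Lemma env_incl_algmap : algmap env_incl.
Proof. exact: (hlift_algmap (S := R0) fL fE fS). Qed.

Lemma env_incl_even : is_even env_incl.
Proof. exact: (hlift_even (S := R0) fL fE fS). Qed.

End SuperEnvelope.
End Envelopes.

Definition super_coalgebra_iso (k : comNzRingType) (C D : superCoalgType k)
    (f : {linear C -> D}) :=
  [/\ bijective f, is_even f,
      forall x, comul (f x) = tmap f f (comul x) &
      forall x, counit (f x) = counit x].

(* Main.v *)
(* Let A = U(g_0) and choose a totally ordered basis (x_i) of g_1. The proof is a
   diamond lemma in the form of a module construction: on the free left A-module M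
   with basis the ordered words in the x_i, the elements of g act from the right
   by the rewriting rules that bring w * x_i and w * y (y in g_0) to ordered form.
   Induction on the length of words shows that these operators satisfy the
   relations of the envelope, so U(g) acts on M and u |-> [].u is inverse to the
   evaluation of words, a w |-> a x_w. Thus U(g) is A-free on the ordered products
   x_w; the case of zero brackets and A = k gives the basis of the exterior
   algebra. The isomorphism sends a (x) x_w to a x_w: the coproducts of x_w in both
   algebras are the same signed sum over complementary subwords of w, and the
   product of the two coalgebra maps from U(g_0) and from the exterior algebra is
   a coalgebra map. *)

Require Import Defs.
From HB Require Import structures.
From mathcomp Require Import all_boot all_algebra.
From mathcomp Require Import finmap boolp wochoice.
From mathcomp.multinomials Require Import monalg.

Set Implicit Arguments.
Unset Strict Implicit.
Unset Printing Implicit Defensive.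

Import GRing.Theory.

Local Open Scope ring_scope.

(** The operators act from the right so that they are linear over A, which multiplies from the left.
    The obstacle is that the rules need not shorten words: rewriting [n :: w] times x_i with i < n
    makes x_n act on w * x_i, which may contain words as long as [n :: w] itself. Those long words
    have all letters below n, so x_n merely puts n in front of them. This makes both the definition
    of the action by recursion on length and the check of the relations well founded. The other
    ingredient is the half-bracket. Its identities are those of [v, v] = 2 (1/2)[v, v] after
    cancelling 2, which is possible in g_0 because a flat module inherits the absence of 2-torsion
    from k, and in g_1 because it is free. Of U(g_0) the construction of the action uses the algebra
    and the linear map [j] from g_0; the relations then ask [j] to respect brackets. Hence the same
    construction serves the exterior algebra. *)

Section AlgebraMaps.
Context (k : comNzRingType) (A B : algType k) (f : A -> B) (f_alg : algmap f).

Lemma algmapD : {morph f : a b / a + b}.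
Proof. by move=> a b; have := f_alg.1 1 a b; rewrite !scale1r. Qed.

Lemma algmap0 : f 0 = 0.
Proof. by apply: (addrI (f 0)); rewrite -algmapD !addr0. Qed.

Lemma algmap_scalar c : f c%:A = c%:A.
Proof.
by have := f_alg.1 c 1 0; rewrite algmap0 f_alg.2.1 !addr0.
Qed.

End AlgebraMaps.

(** * Free modules over a noncommutative ring *)

Section FreeModule.
Context (A : nzRingType) (K : choiceType).
Implicit Types (m : {malg A[K]}) (P : K -> Prop).

Lemma malgZE (a : A) (w : K) : << a *g w >> = a *: << w >>.
Proof. by apply/malgP => u; rewrite mcoeffZ !mcoeffU mulr_natr. Qed.

Lemma malg_ind (Q : {malg A[K]} -> Prop) :
    Q 0 -> (forall x y, Q x -> Q y -> Q (x + y)) ->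
    (forall a w, Q (a *: << w >>)) -> forall m, Q m.
Proof.
move=> Q0 QD Qb m; rewrite (monalgE m); apply: big_ind => // w _.
by rewrite malgZE.
Qed.

Section AdditiveExtension.
Context (N : zmodType) (F : K -> A -> N).
Context (FD : forall w, {morph F w : a b / a + b}).

(** Only additivity of [F w] is asked for, since targets such as U(g) and the tensor product are
    given as k-modules and not as A-modules. *)
Definition msum m : N := \sum_(w <- msupp m) F w m@_w.

Let F0 w : F w 0 = 0.
Proof. by apply: (addrI (F w 0)); rewrite -FD !addr0. Qed.

Lemma msum_incl (D : {fset K}) m :
  (msupp m `<=` D)%fset -> msum m = \sum_(w <- D) F w m@_w.
Proof.
by move=> sD; apply: big_fset_incl => // w _ /mcoeff_outdom ->.
Qed.

Lemma msumD : {morph msum : x y / x + y}.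
Proof.
move=> x y; pose D := (msupp (x + y) `|` (msupp x `|` msupp y))%fset.
have [s1 s2 s3] : [/\ msupp (x + y) `<=` D, msupp x `<=` D
                    & msupp y `<=` D]%fset.
  rewrite /D fsubsetUl; split=> //; apply: fsubset_trans (fsubsetUr _ _).
    exact: fsubsetUl.
  exact: fsubsetUr.
rewrite (msum_incl s1) (msum_incl s2) (msum_incl s3) -big_split.
by apply: eq_bigr => w _; rewrite /= mcoeffD FD.
Qed.

Lemma msum0 : msum 0 = 0.
Proof. by apply: (addrI (msum 0)); rewrite -msumD !addr0. Qed.

Lemma msumB : {morph msum : x y / x - y}.
Proof.
by move=> x y; apply: (addIr (msum y)); rewrite -msumD !subrK.
Qed.

Lemma msumE a w : msum (a *: << w >>) = F w a.
Proof.
rewrite -malgZE (msum_incl (D := [fset w])%fset) ?msuppU_le //.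
by rewrite big_seq_fset1 mcoeffUU.
Qed.

End AdditiveExtension.

Section Extension.
Context (M : lmodType A) (h : K -> M).

Definition mext m : M := msum (fun w a => a *: h w) m.

Let hD w : {morph (fun a => a *: h w) : a b / a + b}.
Proof. by move=> a b; apply: scalerDl. Qed.

Lemma mext_linear : linear mext.
Proof.
move=> a x y; rewrite /mext (msumD hD); congr (_ + _).
elim/malg_ind: x => [|u v eu ev|b w].
- by rewrite scaler0 (msum0 hD) scaler0.
- by rewrite scalerDr !(msumD hD) eu ev scalerDr.
by rewrite scalerA !(msumE hD) scalerA.
Qed.

HB.instance Definition _ :=
  GRing.isLinear.Build A {malg A[K]} M *:%R mext mext_linear.

Lemma mextE w : mext << w >> = h w.
Proof. by rewrite -[<< w >>]scale1r /mext (msumE hD) scale1r. Qed.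

End Extension.

Lemma malg_ext (M : lmodType A) (f g : {linear {malg A[K]} -> M}) :
  (forall w, f << w >> = g << w >>) -> f =1 g.
Proof.
move=> fg; apply: malg_ind => [|x y ex ey|a w]; first by rewrite !linear0.
  by rewrite !linearD ex ey.
by rewrite !linearZ fg.
Qed.

(** Bounds on the words occurring in a vector are stated as membership in such a span; two linear
    maps then agree on the vector as soon as they agree on the words satisfying [P]. *)
Inductive mspan P : {malg A[K]} -> Prop :=
| MSpan0 : mspan P 0
| MSpanD a w m : P w -> mspan P m -> mspan P (a *: << w >> + m).

Lemma mspanD P x y : mspan P x -> mspan P y -> mspan P (x + y).
Proof.
by elim=> [|a w m Pw _ IH] sy; rewrite ?add0r // -addrA; apply: MSpanD (IH sy).
Qed.

Lemma mspanZ P b x : mspan P x -> mspan P (b *: x).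
Proof.
elim=> [|a w m Pw _ IH]; first by rewrite scaler0; apply: MSpan0.
by rewrite scalerDr scalerA; apply: MSpanD.
Qed.

Lemma mspanN P x : mspan P x -> mspan P (- x).
Proof. by rewrite -scaleN1r; apply: mspanZ. Qed.

Lemma mspan_gen P w : P w -> mspan P << w >>.
Proof.
by rewrite -[<< w >>]addr0 -[<< w >>]scale1r => Pw; apply/MSpanD/MSpan0.
Qed.

End FreeModule.

Lemma mspan_sub (A : nzRingType) (K : choiceType) (P Q : K -> Prop) 
    (x : {malg A[K]}) : (forall w, P w -> Q w) -> mspan P x -> mspan Q x.
Proof.
move=> PQ; elim=> [|a w m Pw _ IH]; first exact: MSpan0.
by apply: MSpanD => //; apply: PQ.
Qed.

Lemma mspan_map (A : nzRingType) (K L : choiceType) (P : K -> Prop)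
    (Q : L -> Prop) (f : {linear {malg A[K]} -> {malg A[L]}}) x :
  (forall w, P w -> mspan Q (f << w >>)) -> mspan P x -> mspan Q (f x).
Proof.
move=> fP; elim=> [|a w m Pw _ IH]; first by rewrite linear0; apply: MSpan0.
by rewrite linearD linearZ; apply: mspanD => //; apply/mspanZ/fP.
Qed.

Lemma mspan_eq (A : nzRingType) (K : choiceType) (P : K -> Prop)
    (M : lmodType A) (f g : {linear {malg A[K]} -> M}) x :
  (forall w, P w -> f << w >> = g << w >>) -> mspan P x -> f x = g x.
Proof.
move=> fg; elim=> [|a w m Pw _ IH]; first by rewrite !linear0.
by rewrite !linearD !linearZ IH fg.
Qed.

(** * The k-algebra of A-linear operators on words *)

Section Endomorphisms.
Context (k : comNzRingType) (A : algType k) (I : choiceType).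
Local Notation M := {malg A[seq I]}.

(* Composed from left to right, because the envelope acts on the right. *)
Record endo := Endo { endo_fun :> M -> M; endo_linear : linear endo_fun }.

HB.instance Definition _ := gen_eqMixin endo.
HB.instance Definition _ := gen_choiceMixin endo.

HB.instance Definition _ (f : endo) :=
  GRing.isLinear.Build A M M *:%R (endo_fun f) (endo_linear f).

Lemma endoP (f g : endo) : (f : M -> M) =1 g -> f = g.
Proof.
case: f g => f fL [g gL] /= /funext fg; case: g / fg gL => gL.
by congr Endo; apply: Prop_irrelevance.
Qed.

Implicit Types f g h : endo.

Fact endo_add_subproof f g : linear (fun m => f m + g m).
Proof. by move=> a x y; rewrite !linearP scalerDr addrACA. Qed.
Definition endo_add f g := Endo (endo_add_subproof f g).

Fact endo_zero_subproof : linear (fun _ : M => 0 : M).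
Proof. by move=> a x y; rewrite scaler0 addr0. Qed.
Definition endo_zero := Endo endo_zero_subproof.

Fact endo_opp_subproof f : linear (fun m => - f m).
Proof. by move=> a x y; rewrite linearP opprD scalerN. Qed.
Definition endo_opp f := Endo (endo_opp_subproof f).

Fact endo_mul_subproof f g : linear (fun m => g (f m)).
Proof. by move=> a x y; rewrite !linearP. Qed.
Definition endo_mul f g := Endo (endo_mul_subproof f g).

Fact endo_one_subproof : linear (fun m : M => m).
Proof. by []. Qed.
Definition endo_one := Endo endo_one_subproof.

(** Scaling by an element of k stays A-linear because [c%:A] is central in A. *)
Fact endo_scale_subproof (c : k) f : linear (fun m => c%:A *: f m).
Proof.
by move=> a x y; rewrite linearP scalerDr !scalerA mulr_algl mulr_algr.
Qed.
Definition endo_scale c f := Endo (endo_scale_subproof c f).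

Fact endo_addA : associative endo_add.
Proof. by move=> f g h; apply: endoP => m /=; rewrite addrA. Qed.
Fact endo_addC : commutative endo_add.
Proof. by move=> f g; apply: endoP => m /=; rewrite addrC. Qed.
Fact endo_add0 : left_id endo_zero endo_add.
Proof. by move=> f; apply: endoP => m /=; rewrite add0r. Qed.
Fact endo_addN : left_inverse endo_zero endo_opp endo_add.
Proof. by move=> f; apply: endoP => m /=; rewrite addNr. Qed.

HB.instance Definition _ :=
  GRing.isZmodule.Build endo endo_addA endo_addC endo_add0 endo_addN.

Lemma endoD f g m : (f + g) m = f m + g m. Proof. by []. Qed.
Lemma endoN f m : (- f) m = - f m. Proof. by []. Qed.
Lemma endo0 m : (0 : endo) m = 0. Proof. by []. Qed.

Fact endo_mulA : associative endo_mul.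
Proof. by move=> f g h; apply: endoP. Qed.
Fact endo_mul1 : left_id endo_one endo_mul.
Proof. by move=> f; apply: endoP. Qed.
Fact endo_mulr1 : right_id endo_one endo_mul.
Proof. by move=> f; apply: endoP. Qed.
Fact endo_mulDl : left_distributive endo_mul +%R.
Proof. by move=> f g h; apply: endoP => m /=; rewrite linearD. Qed.
Fact endo_mulDr : right_distributive endo_mul +%R.
Proof. by move=> f g h; apply: endoP. Qed.

Fact endo_one_neq0 : endo_one != 0.
Proof.
apply/eqP => /(congr1 (fun f : endo => (f << [::] >>)@_[::])) /eqP.
by rewrite /= mcoeffUU mcoeff0 oner_eq0.
Qed.

HB.instance Definition _ := GRing.Zmodule_isNzRing.Build endo
  endo_mulA endo_mul1 endo_mulr1 endo_mulDl endo_mulDr endo_one_neq0.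

Lemma endoM f g m : (f * g) m = g (f m). Proof. by []. Qed.

Fact endo_scaleA a b f : endo_scale a (endo_scale b f) = endo_scale (a * b) f.
Proof.
by apply: endoP => m /=; rewrite scalerA mulr_algl scalerA.
Qed.
Fact endo_scale1 : left_id 1 endo_scale.
Proof. by move=> f; apply: endoP => m /=; rewrite !scale1r. Qed.
Fact endo_scaleDr : right_distributive endo_scale +%R.
Proof. by move=> a f g; apply: endoP => m /=; rewrite scalerDr. Qed.
Fact endo_scaleDl f : {morph endo_scale^~ f : a b / a + b}.
Proof. by move=> a b; apply: endoP => m /=; rewrite !scalerDl. Qed.

HB.instance Definition _ := GRing.Zmodule_isLmodule.Build k endo
  endo_scaleA endo_scale1 endo_scaleDr endo_scaleDl.

Lemma endoZ (c : k) f m : (c *: f) m = c%:A *: f m. Proof. by []. Qed.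

Fact endo_scaleAl (c : k) f g : c *: (f * g) = c *: f * g.
Proof. by apply: endoP => m; rewrite !(endoZ, endoM) linearZ. Qed.

HB.instance Definition _ :=
  GRing.Lmodule_isLalgebra.Build k endo endo_scaleAl.

Fact endo_scaleAr (c : k) f g : c *: (f * g) = f * (c *: g).
Proof. by apply: endoP. Qed.

HB.instance Definition _ :=
  GRing.Lalgebra_isAlgebra.Build k endo endo_scaleAr.

(* Locked, since unification would otherwise unfold the operators built with it. *)
Definition bend (h : seq I -> M) : endo := locked (Endo (mext_linear h)).

Lemma bendE (h : seq I -> M) w : bend h << w >> = h w.
Proof. by rewrite /bend -lock /= mextE. Qed.

Lemma endor0 f : f 0 = 0. Proof. exact: linear0. Qed.
Lemma endorD f m n : f (m + n) = f m + f n. Proof. exact: linearD. Qed.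
Lemma endorN f m : f (- m) = - f m. Proof. exact: linearN. Qed.
Lemma endorB f m n : f (m - n) = f m - f n. Proof. exact: linearB. Qed.
Lemma endorZ f a m : f (a *: m) = a *: f m. Proof. exact: linearZ. Qed.

Lemma endo_ext f g : (forall w, f << w >> = g << w >>) -> f = g.
Proof. by move=> fg; apply: endoP; apply: malg_ext. Qed.

Lemma endo_mspan_eq (P : seq I -> Prop) f g m :
  (forall w, P w -> f << w >> = g << w >>) -> mspan P m -> f m = g m.
Proof. exact: mspan_eq. Qed.

Lemma endo_mspan (P Q : seq I -> Prop) f m :
  (forall w, P w -> mspan Q (f << w >>)) -> mspan P m -> mspan Q (f m).
Proof. exact: mspan_map. Qed.

End Endomorphisms.
Arguments endo {k} A I.

(** The order comes from a well-order, that is, from the axiom of choice. Totality, antisymmetry and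
    transitivity are read off from the least elements of sets of two or three elements. *)
Lemma strict_total_order (I : choiceType) : exists lt : rel I,
  [/\ irreflexive lt, transitive lt & forall a b, [|| lt a b, a == b | lt b a]].
Proof.
have [R Rwo] := well_ordering_principle I.
have min3 a b c : exists z,
    z \in [:: a; b; c] /\ [/\ R z a, R z b & R z c].
  have [|z [[zi zm] _]] := Rwo [in [:: a; b; c]].
    by exists a; apply: mem_head.
  by exists z; split=> //; split; apply: zm; rewrite !inE eqxx ?orbT.
have Rab a b : R a b || R b a.
  have [z [zi [za zb _]]] := min3 a b b.
  by move: zi za zb; rewrite !inE => /or3P[] /eqP -> za zb; rewrite ?za ?zb ?orbT.
have Rxx a : R a a by have := Rab a a; rewrite orbb.
have Ra a b : R a b -> R b a -> a = b.
  move=> ab ba; have [|z [_ zu]] := Rwo [in [:: a; b]].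
    by exists a; apply: mem_head.
  rewrite -(zu a); first apply: zu; split; rewrite ?inE ?eqxx ?orbT //;
    by move=> x; rewrite !inE => /orP[] /eqP ->.
have Rt : transitive R.
  move=> b a c ab bc; have [z [zi [za zb zc]]] := min3 a b c.
  move: zi za zb zc; rewrite !inE => /or3P[] /eqP -> // ba.
    by rewrite (Ra a b).
  by move=> cb _; rewrite -(Ra b c).
exists (fun a b => (a != b) && R a b); split=> [a|b a c|a b] /=.
- by rewrite eqxx.
- move=> /andP[ab Rab'] /andP[bc Rbc]; rewrite (Rt _ _ _ Rab' Rbc) andbT.
  by apply: contraNneq bc => e; rewrite -e in Rbc *; rewrite (Ra _ _ Rab' Rbc).
- by rewrite [b == a]eq_sym; case: eqP => //= _; apply: Rab.
Qed.

(* Y stands for g_0, V for g_1 with ordered basis x, and hx i for (1/2)[x i, x i].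
   The word n :: w stands for w * x n, hence the basis words are the strictly
   decreasing ones; both actions kill all other words. The fields below orient
   x n * y = y * x n + [x n, y] and x n * x i = [x n, x i] - x i * x n (i < n). *)
Section RightAction.
Context (k : comNzRingType) (A : algType k) (Y V : lmodType k).
Context (I : choiceType) (lt : rel I) (j : Y -> A) (x : I -> V).
Context (bVY : V -> Y -> V) (bVV : V -> V -> Y) (hx : I -> Y).
Local Notation desc := (sorted (fun a b => lt b a)).

(** The words on which x_n is under control before the action on length [N] is: the shorter ones by
    induction, those of length [N] because n may be put in front. *)
Definition topped n N (u : seq I) :=
  (size u < N)%N || (size u == N) && desc (n :: u).

Record right_action (actY : Y -> endo A I) (actV : V -> endo A I) : Prop := {
  act_nil y : actY y << [::] >> = j y *: << [::] >>;
  act_unsorted w : ~~ desc w ->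
    (forall y, actY y << w >> = 0) /\ (forall v, actV v << w >> = 0);
  act_append i w : desc (i :: w) -> actV (x i) << w >> = << i :: w >>;
  act_square n w : desc (n :: w) ->
    actV (x n) << n :: w >> = actY (hx n) << w >>;
  actY_cons n w : desc (n :: w) -> forall y, actY y << n :: w >> =
    actV (x n) (actY y << w >>) + actV (bVY (x n) y) << w >>;
  actV_cons n w i : desc (n :: w) -> lt i n -> actV (x i) << n :: w >> =
    actY (bVV (x n) (x i)) << w >> - actV (x n) (actV (x i) << w >>);
  actY_span y w : mspan (fun u => size u <= size w)%N (actY y << w >>);
  actV_span n i w : desc (n :: w) -> lt i n ->
    mspan (topped n (size w).+1) (actV (x i) << w >>)
}.

End RightAction.

(** * Existence of the right action *)

Section Construction.
Context (k : comNzRingType) (A : algType k) (Y V : lmodType k).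
Context (I : choiceType) (lt : rel I).
Context (lt_irr : irreflexive lt) (lt_tr : transitive lt).
Context (lt_total : forall a b, [|| lt a b, a == b | lt b a]).
Context (j : {linear Y -> A}).
Context (x : I -> V) (co : {linear V -> {malg k[I]}}).
Context (cox : forall i, co (x i) = << i >>).
Context (bVY : V -> Y -> V) (bVV : V -> V -> Y) (hx : I -> Y).
Context (bVYl : bilin bVY).

HB.instance Definition _ v :=
  GRing.isLinear.Build k Y V *:%R (bVY v) (bVYl.2 v).

Local Notation M := {malg A[seq I]}.
Local Notation E := (endo A I).
Local Notation gt := (fun a b => lt b a).

Definition vext (X : I -> E) (v : V) : E := mext X (co v).

Lemma vext_linear X : linear (vext X).
Proof. by move=> a u v; rewrite /vext !linearP. Qed.

HB.instance Definition _ X :=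
  GRing.isLinear.Build k V E *:%R (vext X) (vext_linear X).

Lemma vextE X i : vext X (x i) = X i.
Proof. by rewrite /vext cox mextE. Qed.

(* On words of length N, which only occur with all letters below n, multiplication
   by n appends n. *)
Definition append N (X : I -> E) n : E :=
  bend (fun u => if (size u < N)%N then X n << u >> else << n :: u >>).

Definition stepY N (Yp : Y -> E) (Xp : I -> E) y (w : seq I) : M :=
  if (size w < N)%N then Yp y << w >> else
  if (size w == N) && sorted gt w then
    if w is n :: u then Xp n (Yp y << u >>) + vext Xp (bVY (x n) y) << u >>
    else j y *: << [::] >>
  else 0.

Definition stepX N (Yp : Y -> E) (Xp : I -> E) i (w : seq I) : M :=
  if (size w < N)%N then Xp i << w >> else
  if (size w == N) && sorted gt w then
    if w is n :: u then
      if lt n i then << i :: w >> else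
      if i == n then Yp (hx n) << u >>
      else Yp (bVV (x n) (x i)) << u >> - append N Xp n (Xp i << u >>)
    else << [:: i] >>
  else 0.

(* [level_op N] is the action on words of length < N. Level N determines level
   N + 1 since the products on the right-hand sides of the rewriting rules only
   meet words of length < N, or of length N that [append] handles. *)
Fixpoint level_op N : (Y -> E) * (I -> E) :=
  if N is N'.+1 then
    (fun y => bend (stepY N' (level_op N').1 (level_op N').2 y),
     fun i => bend (stepX N' (level_op N').1 (level_op N').2 i))
  else (fun _ => 0, fun _ => 0).

Definition actY y : E := bend (fun w => (level_op (size w).+1).1 y << w >>).
Definition actX i : E := bend (fun w => (level_op (size w).+1).2 i << w >>).
Definition actV v : E := vext actX v.

Lemma actY_raw y w : actY y << w >> =
  stepY (size w) (level_op (size w)).1 (level_op (size w)).2 y w.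
Proof. by rewrite /actY bendE /= bendE. Qed.

Lemma actX_raw i w : actX i << w >> =
  stepX (size w) (level_op (size w)).1 (level_op (size w)).2 i w.
Proof. by rewrite /actX bendE /= bendE. Qed.

(** A step keeps the values on shorter words, so all levels above the length of a word agree on
    it. *)
Lemma level_op_actY N y w : (size w < N)%N ->
  (level_op N).1 y << w >> = actY y << w >>.
Proof.
elim: N => // N IH wN; rewrite /= bendE /stepY.
case: ifP => [/IH //|wN']; have {wN wN'} <- : size w = N.
  by apply/eqP; rewrite eqn_leq -ltnS wN leqNgt wN'.
by rewrite actY_raw /stepY ltnn.
Qed.

Lemma level_op_actX N i w : (size w < N)%N ->
  (level_op N).2 i << w >> = actX i << w >>.
Proof.
elim: N => // N IH wN; rewrite /= bendE /stepX.
case: ifP => [/IH //|wN']; have {wN wN'} <- : size w = N.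
  by apply/eqP; rewrite eqn_leq -ltnS wN leqNgt wN'.
by rewrite actX_raw /stepX ltnn.
Qed.

Lemma level_op_linear N : linear (level_op N).1.
Proof.
elim: N => [|N IH] a y y'; apply: endo_ext => w; first by rewrite /= scaler0 addr0.
rewrite endoD endoZ /= !bendE /stepY; case: ifP => _; first by rewrite IH.
case: ifP => _; last by rewrite scaler0 addr0.
case: w => [|n u]; first by rewrite linearP scalerDl scalerA mulr_algl.
rewrite IH endoD endoZ linearP [bVY _ _]linearP [vext _ _]linearP endoD endoZ.
by rewrite scalerDr addrACA.
Qed.

Lemma actY_linear : linear actY.
Proof.
move=> a y y'; apply: endo_ext => w.
have e z : actY z << w >> = (level_op (size w).+1).1 z << w >> by exact: bendE.
by rewrite endoD endoZ !e level_op_linear endoD endoZ.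
Qed.

HB.instance Definition _ :=
  GRing.isLinear.Build k Y E *:%R actY actY_linear.
HB.instance Definition _ :=
  GRing.isLinear.Build k V E *:%R actV (vext_linear actX).

Lemma actVE i : actV (x i) = actX i.
Proof. exact: vextE. Qed.

Lemma vext_eq (X X' : I -> E) v (m : M) :
  (forall i, X i m = X' i m) -> vext X v m = vext X' v m.
Proof.
move=> e; rewrite /vext; elim/malg_ind: (co v) => [|c d ec ed|a i].
- by rewrite !linear0.
- by rewrite !linearD !endoD ec ed.
by rewrite !linearZ !endoZ /= !mextE e.
Qed.

Lemma mspan_vext P (X : I -> E) v (m : M) :
  (forall i, mspan P (X i m)) -> mspan P (vext X v m).
Proof.
move=> e; rewrite /vext; elim/malg_ind: (co v) => [|c d ec ed|a i].
- by rewrite linear0; apply: MSpan0.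
- by rewrite linearD endoD; apply: mspanD.
by rewrite linearZ endoZ /= mextE; apply: mspanZ.
Qed.

(** These bounds turn the levelwise definition into the rewriting rules: the words on which the
    right-hand sides evaluate an operator are then short enough for the current level, or are
    handled by [append]. The rules at [n :: w] need the bounds at [w], so the two are established
    alternately. *)
Definition bounded_growth w := [/\
  forall y, mspan (fun u => size u <= size w)%N (actY y << w >>),
  forall i, mspan (fun u => size u <= (size w).+1)%N (actX i << w >>) &
  forall i n, sorted gt (n :: w) -> lt i n ->
    mspan (topped lt n (size w).+1) (actX i << w >>)].

Lemma actY_nil y : actY y << [::] >> = j y *: << [::] >>.
Proof. by rewrite actY_raw /stepY. Qed.

Lemma act_unsorted0 w : ~~ sorted gt w ->
  (forall y, actY y << w >> = 0) /\ (forall i, actX i << w >> = 0).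
Proof.
move=> sw; split=> z; rewrite (actY_raw, actX_raw) /stepY /stepX ltnn.
  by rewrite (negPf sw) andbF.
by rewrite (negPf sw) andbF.
Qed.

Lemma actX_append i w : sorted gt (i :: w) -> actX i << w >> = << i :: w >>.
Proof.
rewrite actX_raw /stepX ltnn eqxx; case: w => //= n w /andP[ni ->].
by rewrite ni.
Qed.

Lemma actX_square n w : sorted gt (n :: w) ->
  actX n << n :: w >> = actY (hx n) << w >>.
Proof.
move=> sw; rewrite actX_raw /stepX ltnn eqxx sw lt_irr eqxx.
by apply: level_op_actY.
Qed.

Lemma actY_cons0 n w y : sorted gt (n :: w) -> bounded_growth w ->
  actY y << n :: w >> =
  actX n (actY y << w >>) + actV (bVY (x n) y) << w >>.
Proof.
move=> sw [gY gX _]; rewrite actY_raw /stepY ltnn eqxx sw.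
move eN : (size (n :: w)) => N.
have uN u : (size u <= size w)%N -> (size u < N)%N by rewrite -eN.
congr (_ + _); last by apply: vext_eq => i; rewrite level_op_actX ?uN.
rewrite level_op_actY ?uN //; apply: endo_mspan_eq (gY y) => u uw.
by rewrite level_op_actX ?uN.
Qed.

Lemma actX_cons0 n w i : sorted gt (n :: w) -> lt i n -> bounded_growth w ->
  actX i << n :: w >> =
  actY (bVV (x n) (x i)) << w >> - actX n (actX i << w >>).
Proof.
move=> sw lin [gY gX gT]; rewrite actX_raw /stepX ltnn eqxx sw.
case: ifP => [lni|_]; first by have := lt_tr lin lni; rewrite lt_irr.
case: eqP lin => [->|_ lin]; first by rewrite lt_irr.
move eN : (size (n :: w)) => N.
have uN u : (size u <= size w)%N -> (size u < N)%N by rewrite -eN.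
congr (_ - _); first by rewrite level_op_actY ?uN.
(* On the long words [append] and [actX n] agree, since n may be put in front of them. *)
rewrite level_op_actX ?uN //; apply: endo_mspan_eq (gT i n sw lin) => u.
rewrite /append bendE -eN => /orP[uw|/andP[/eqP uw su]].
  by rewrite uw level_op_actX ?uN // -eN.
by rewrite uw ltnn actX_append.
Qed.

(** Induction on the length. For the last bound at [n :: w], preceded by m: the long words that
    arise begin with n or with i, both below m, so m may again be put in front. *)
Lemma bounded_growthP w : bounded_growth w.
Proof.
have [N] := ubnP (size w); elim: N w => // N IH [_|n w wN].
  split=> [y|i|i n].
  - by rewrite actY_nil; apply/mspanZ/mspan_gen.
  - by rewrite actX_append //; apply: mspan_gen.
  move=> _ lin; rewrite actX_append //; apply: mspan_gen.
  by rewrite /topped /= lin.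
have [sw|nsw] := boolP (sorted gt (n :: w)); last first.
  have [e e'] := act_unsorted0 nsw.
  by split=> *; rewrite ?e ?e'; apply: MSpan0.
have [gY gX gT] := IH w wN.
have g u : (size u <= size w)%N -> bounded_growth u.
  by move=> uw; apply: IH; apply: (leq_ltn_trans uw); apply: wN.
have gXY i y : mspan (fun u => size u <= (size w).+1)%N (actX i (actY y << w >>)).
  apply: endo_mspan (gY y) => u uw; have [_ + _] := g u uw; move/(_ i).
  by apply: mspan_sub => v vu; apply: leq_trans vu _.
split=> [y|i|i m].
- rewrite actY_cons0 //; apply: mspanD; first exact: gXY.
  by apply: mspan_vext => i; apply: gX.
- have [lin|] := boolP (lt i n).
    rewrite actX_cons0 //; apply: mspanD.
      by apply: mspan_sub (gY _) => u uw /=; rewrite ltnW // ltnW.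
    apply: mspanN; apply: endo_mspan (gT i n sw lin) => u.
    case/orP=> [uw|/andP[/eqP uw su]]; last first.
      by rewrite actX_append //; apply: mspan_gen; rewrite /= uw.
    have [_ + _] := g u uw; move/(_ n).
    by apply: mspan_sub => v vu; apply: leq_trans vu _; rewrite ltnW.
  have := lt_total i n; case: (lt i n) => //= /orP[/eqP -> _|lni _].
    rewrite actX_square //; apply: mspan_sub (gY _) => u uw /=.
    by rewrite ltnW // ltnW.
  by rewrite actX_append /= ?lni //; apply: mspan_gen.
move=> /[dup] smw /= /andP[lnm _] lim.
have [lin|] := boolP (lt i n).
  rewrite actX_cons0 //; apply: mspanD.
    by apply: mspan_sub (gY _) => u uw; rewrite /topped ltnS ltnW.
  apply: mspanN; apply: endo_mspan (gT i n sw lin) => u.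
  case/orP=> [uw|/andP[/eqP uw su]]; last first.
    rewrite actX_append //; apply: mspan_gen.
    by move: su => /= su; rewrite /topped /= uw lnm eqxx su orbT.
  have [_ + _] := g u uw; move/(_ n).
  by apply: mspan_sub => v vu; rewrite /topped ltnS (leq_trans vu).
have := lt_total i n; case: (lt i n) => //= /orP[/eqP -> _|lni _].
  rewrite actX_square //; apply: mspan_sub (gY _) => u uw.
  by rewrite /topped ltnS ltnW.
rewrite actX_append /= ?lni //; apply: mspan_gen.
by rewrite /topped /= lim lni eqxx; move: sw => /= ->; rewrite orbT.
Qed.

Lemma right_action_exists : exists (aY : {linear Y -> E}) (aV : {linear V -> E}),
  right_action lt j x bVY bVV hx aY aV.
Proof.
exists actY, actV.
split=> [|w nw|i w sw|n w sw|n w sw y|n w i sw lin|y w|n i w sw lin];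
  rewrite /= ?actVE.
- exact: actY_nil.
- have [eY eX] := act_unsorted0 nw; split=> // v.
  rewrite /actV /vext; elim/malg_ind: (co v) => [|c d ec ed|a i].
  + by rewrite linear0.
  + by rewrite linearD endoD ec ed addr0.
  by rewrite linearZ endoZ /= mextE eX scaler0.
- exact: actX_append.
- exact: actX_square.
- exact: actY_cons0 sw (bounded_growthP w).
- exact: actX_cons0 sw lin (bounded_growthP w).
- by have [gY _ _] := bounded_growthP w.
by have [_ _ gT] := bounded_growthP w; apply: gT.
Qed.

End Construction.

Lemma subr0_eq_add0 (M : zmodType) (a b : M) : a - b + 0 = 0 -> a = b.
Proof. by rewrite addr0 => /subr0_eq. Qed.

(* The terms are generalized first: the rewrites would otherwise compare them up to
   conversion, which is very slow. *)
Ltac cancel_in_zmod :=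
  apply: subr0_eq_add0;
  repeat match goal with |- context [endo_fun ?f ?m] =>
    generalize (endo_fun f m); intros ? end;
  rewrite ?opprD ?opprK -?addrA;
  do 12 try match goal with
  | |- - ?a + _ = 0 => repeat first [rewrite (addKr a) | rewrite (addrCA (- a))]
  | |- ?a + _ = 0 => repeat first [rewrite (addNKr a) | rewrite (addrCA a)]
  end; try reflexivity.

(** * The action satisfies the relations of the envelope *)

Section Relations.
Context (k : comNzRingType) (A : algType k) (Y V : lmodType k).
Context (I : choiceType) (lt : rel I) (lt_tr : transitive lt).
Context (lt_total : forall a b, [|| lt a b, a == b | lt b a]).
Context (j : Y -> A).
Context (x : I -> V) (co : V -> {malg k[I]}) (coK : forall v, mext x (co v) = v).
Context (bYY : Y -> Y -> Y) (bVY : V -> Y -> V) (bVV : V -> V -> Y) (hx : I -> Y).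
Context (bVYl : bilin bVY) (bVVl : bilin bVV).
Context (bVVC : forall v v', bVV v v' = bVV v' v).
Context (hx2 : forall i, bVV (x i) (x i) = hx i *+ 2).
Context (jYY : forall y y', j (bYY y y') = j y * j y' - j y' * j y).
Context (JVYY : forall v y y',
  bVY v (bYY y y') = bVY (bVY v y) y' - bVY (bVY v y') y).
Context (JVVY : forall v v' y,
  bYY (bVV v v') y = bVV (bVY v y) v' + bVV v (bVY v' y)).
Context (JhY : forall i y, bYY (hx i) y = bVV (bVY (x i) y) (x i)).
Context (JVVV : forall v v' v'',
  bVY v (bVV v' v'') = - bVY v'' (bVV v v') - bVY v' (bVV v v'')).
Context (JVh : forall v i, bVY v (hx i) = - bVY (x i) (bVV v (x i))).
Context (Jhh : forall i, bVY (x i) (hx i) = 0).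
Context (actY : {linear Y -> endo A I}) (actV : {linear V -> endo A I}).
Context (act : right_action lt j x bVY bVV hx actY actV).

HB.instance Definition _ v :=
  GRing.isLinear.Build k V Y *:%R (bVV v) (bVVl.2 v).

Local Notation M := {malg A[seq I]}.
Local Notation gt := (fun a b => lt b a).

Lemma V_ind (Q : V -> Prop) :
    Q 0 -> (forall u v, Q u -> Q v -> Q (u + v)) ->
    (forall a i, Q (a *: x i)) -> forall v, Q v.
Proof.
move=> Q0 QD Qx v; rewrite -(coK v).
elim/malg_ind: (co v) => [|c d Qc Qd|a i]; first by rewrite linear0.
  by rewrite linearD; apply: QD.
by rewrite linearZ /= mextE.
Qed.

Lemma bVYDl u v y : bVY (u + v) y = bVY u y + bVY v y.
Proof. by have := bVYl.1 y 1 u v; rewrite !scale1r. Qed.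
Lemma bVY0l y : bVY 0 y = 0.
Proof. by apply: (addrI (bVY 0 y)); rewrite -bVYDl !addr0. Qed.
Lemma bVYZl a v y : bVY (a *: v) y = a *: bVY v y.
Proof. by have := bVYl.1 y a v 0; rewrite bVY0l !addr0. Qed.

Lemma actV0 : actV 0 = 0. Proof. exact: linear0. Qed.
Lemma actVD u v : actV (u + v) = actV u + actV v. Proof. exact: linearD. Qed.
Lemma actVN v : actV (- v) = - actV v. Proof. exact: linearN. Qed.
Lemma actVZ a v : actV (a *: v) = a *: actV v. Proof. exact: linearZ. Qed.
Lemma actY0 : actY 0 = 0. Proof. exact: linear0. Qed.
Lemma actYD u v : actY (u + v) = actY u + actY v. Proof. exact: linearD. Qed.
Lemma actYZ a v : actY (a *: v) = a *: actY v. Proof. exact: linearZ. Qed.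
Lemma bVV0 v : bVV v 0 = 0. Proof. exact: linear0. Qed.
Lemma bVVD v u u' : bVV v (u + u') = bVV v u + bVV v u'.
Proof. exact: linearD. Qed.
Lemma bVVZ a v u : bVV v (a *: u) = a *: bVV v u. Proof. exact: linearZ. Qed.

Definition relYY m := forall y y',
  actY (bYY y y') m = actY y' (actY y m) - actY y (actY y' m).
Definition relVY m := forall v y,
  actV (bVY v y) m = actY y (actV v m) - actV v (actY y m).
Definition relVV m := forall v v',
  actY (bVV v v') m = actV v' (actV v m) + actV v (actV v' m).
(** Only basis vectors are squared here; [square_of_basis] reaches all odd elements by
    polarization. *)
Definition relsq m := forall i, actY (hx i) m = actV (x i) (actV (x i) m).
Definition relations_at m := [/\ relYY m, relVY m, relVV m & relsq m].

Lemma relVY_basis m :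
    (forall i y, actV (bVY (x i) y) m =
       actY y (actV (x i) m) - actV (x i) (actY y m)) ->
  relVY m.
Proof.
move=> e v y; elim/V_ind: v => [|u v eu ev|a i].
- by rewrite bVY0l actV0 !endo0 endor0 subrr.
- by rewrite bVYDl !actVD !endoD eu ev endorD opprD addrACA.
by rewrite bVYZl !actVZ !endoZ endorZ e -scalerBr.
Qed.

(** Both sides are symmetric in the two odd arguments, so one order of each pair of basis vectors
    suffices. *)
Lemma relVV_basis m :
    (forall i i', (i == i') || lt i' i -> actY (bVV (x i) (x i')) m =
       actV (x i') (actV (x i) m) + actV (x i) (actV (x i') m)) ->
  relVV m.
Proof.
move=> e0.
have e i i' : actY (bVV (x i) (x i')) m =
       actV (x i') (actV (x i) m) + actV (x i) (actV (x i') m).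
  have := lt_total i i'; case/or3P=> ii'.
  - by rewrite bVVC addrC e0 // ii' orbT.
  - by rewrite e0 // ii'.
  by rewrite e0 // ii' orbT.
have e1 v i : actY (bVV v (x i)) m =
    actV (x i) (actV v m) + actV v (actV (x i) m).
  elim/V_ind: v => [|u v eu ev|a l].
  - by rewrite bVVC bVV0 actY0 actV0 !endo0 endor0 addr0.
  - rewrite bVVC bVVD !(bVVC (x i)) actYD !actVD.
    by rewrite !endoD eu ev endorD addrACA.
  rewrite bVVC bVVZ bVVC actYZ !actVZ.
  by rewrite !endoZ endorZ e scalerDr.
move=> v v'; elim/V_ind: v' => [|u w eu ev|a l].
- by rewrite bVV0 actY0 actV0 !endo0 endor0 addr0.
- rewrite bVVD actYD !actVD.
  by rewrite !endoD eu ev endorD addrACA.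
rewrite bVVZ actYZ !actVZ.
by rewrite !endoZ endorZ e1 scalerDr.
Qed.

Lemma relations_at_span P m :
  (forall w, P w -> relations_at << w >>) -> mspan P m -> relations_at m.
Proof.
move=> gP sm; split=> [y y'|v y|v v'|i].
- apply: (endo_mspan_eq (g := actY y * actY y' - actY y' * actY y)) sm.
  by move=> w /gP[e _ _ _]; apply: e.
- apply: (endo_mspan_eq (g := actV v * actY y - actY y * actV v)) sm.
  by move=> w /gP[_ e _ _]; apply: e.
- apply: (endo_mspan_eq (g := actV v * actV v' + actV v' * actV v)) sm.
  by move=> w /gP[_ _ e _]; apply: e.
apply: (endo_mspan_eq (g := actV (x i) * actV (x i))) sm.
by move=> w /gP[_ _ _ e]; apply: e.
Qed.

(* On words with letters below n, multiplication by n is followed by the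
   rewriting rules themselves, so there the relations hold by definition. *)
Lemma topped_rel n N (p : M) :
    (forall u, (size u < N)%N -> relations_at << u >>) -> mspan (topped lt n N) p ->
  [/\ forall y,
        actY y (actV (x n) p) = actV (x n) (actY y p) + actV (bVY (x n) y) p,
      forall i, lt i n ->
        actV (x i) (actV (x n) p) =
        actY (bVV (x n) (x i)) p - actV (x n) (actV (x i) p) &
      actV (x n) (actV (x n) p) = actY (hx n) p].
Proof.
move=> gN sp; split=> [y|i lin|].
- apply: (endo_mspan_eq (f := actV (x n) * actY y)
    (g := actY y * actV (x n) + actV (bVY (x n) y))) sp => u.
  case/orP=> [/gN[_ e _ _]|/andP[_ su]]; rewrite endoD !endoM.
    by rewrite (e (x n) y) addrC subrK.
  by rewrite (act_append act) // (actY_cons act).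
- apply: (endo_mspan_eq (f := actV (x n) * actV (x i))
    (g := actY (bVV (x n) (x i)) - actV (x i) * actV (x n))) sp => u.
  case/orP=> [/gN[_ _ e _]|/andP[_ su]]; rewrite endoD endoN !endoM.
    by rewrite (e (x n) (x i)) addrK.
  by rewrite (act_append act) // (actV_cons act).
apply: (endo_mspan_eq (f := actV (x n) * actV (x n))) sp => u.
case/orP=> [/gN[_ _ _ e]|/andP[_ su]]; rewrite endoM; first by rewrite e.
by rewrite (act_append act) // (act_square act).
Qed.

Lemma relations_at_unsorted w : ~~ sorted gt w -> relations_at << w >>.
Proof.
move=> /(act_unsorted act)[eY eV].
by split=> [y y'|v y|v v'|i]; rewrite !(eY, eV) !endor0 ?subr0 ?addr0.
Qed.

Lemma relations_at_nil : relations_at << [::] >>.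
Proof.
split=> [y y'|||i].
- by rewrite !(act_nil act) !endorZ !(act_nil act) !scalerA -scalerBl jYY.
- apply: relVY_basis => i y.
  by rewrite (act_append act) // (actY_cons act) // [X in X - _]addrC addrK.
- apply: relVV_basis => i i' /orP[/eqP <-|lii'].
    by rewrite (act_append act) // (act_square act) // hx2 mulr2n actYD endoD.
  by rewrite (act_append act (i := i) (w := [::])) // (actV_cons act) // subrK.
by rewrite (act_append act) // (act_square act).
Qed.

Lemma relVY_swap m : relVY m -> forall v y,
  actY y (actV v m) = actV v (actY y m) + actV (bVY v y) m.
Proof. by move=> e v y; rewrite e addrC subrK. Qed.

Lemma relVV_swap m : relVV m -> forall v v',
  actV v' (actV v m) = actY (bVV v v') m - actV v (actV v' m).
Proof. by move=> e v v'; rewrite e addrK. Qed.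

Lemma relYY_swap m : relYY m -> forall y y',
  actY y' (actY y m) = actY (bYY y y') m + actY y (actY y' m).
Proof. by move=> e y y'; rewrite e subrK. Qed.

Section Step.
Context (n : I) (w : seq I) (sw : sorted gt (n :: w)).
Context (IH : forall u, (size u <= size w)%N -> relations_at << u >>).
Local Notation e := (<< w >> : M).

Let gY y : relations_at (actY y e).
Proof. exact: relations_at_span IH (actY_span act y w). Qed.

Let eY : relYY e. Proof. by have [] := IH (leqnn (size w)). Qed.
Let eVY : relVY e. Proof. by have [] := IH (leqnn (size w)). Qed.
Let eVV : relVV e. Proof. by have [] := IH (leqnn (size w)). Qed.
Let esq : relsq e. Proof. by have [] := IH (leqnn (size w)). Qed.

(** The vector w * x_i may contain words as long as [n :: w], where [IH] is silent. They are topped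
    by n, so the relations that begin with x_n are still available. *)
Let tX i (lin : lt i n) :=
  topped_rel (N := (size w).+1) IH (actV_span act sw lin).

(** The overlap x_n y y', resolved by the Jacobi identity [JVYY]. *)
Lemma relYY_cons : relYY << n :: w >>.
Proof.
move=> y y'; have [_ rVYy _ _] := gY y; have [_ rVYy' _ _] := gY y'.
rewrite !(actY_cons act sw) !endorD eY JVYY actVD actVN endoD endoN endorB.
rewrite !(relVY_swap rVYy) !(relVY_swap rVYy') !(relVY_swap eVY).
cancel_in_zmod.
Qed.

(** The overlap x_n x_i y, resolved by [JVVY] if i < n and by [JhY] if i = n. For i > n the relation
    is the rule for y at the word [i :: n :: w]. *)
Lemma relVY_cons : relVY << n :: w >>.
Proof.
apply: relVY_basis => i y; have [_ _ rVVy rsqy] := gY y.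
case/or3P: (lt_total i n) => [lin|/eqP ->|lni].
- have [tY tV _] := tX lin.
  rewrite -[in LHS](act_append act sw) (actV_cons act sw lin) (actY_cons act sw).
  rewrite !(endorD, endorN) tY (relVY_swap eVY) endorD !(relVV_swap rVVy (x n)).
  rewrite (relVV_swap eVV (x i)) (relVV_swap eVV (x n)) (relYY_swap eY) JVVY.
  rewrite actYD endoD (bVVC (bVY (x n) y)).
  cancel_in_zmod.
- rewrite (act_square act sw) (actY_cons act sw) -[in LHS](act_append act sw).
  rewrite endorD (relVV_swap eVV (x n)) (relYY_swap eY) JhY bVVC rsqy.
  cancel_in_zmod.
have sinw : sorted gt (i :: n :: w) by rewrite /= lni.
by rewrite (act_append act sinw) (actY_cons act sinw) [X in X - _]addrC addrK.
Qed.

(** The overlap x_n x_i x_i, resolved by [JVh] if i < n. For i = n it is the cube of x_n, and [Jhh]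
    says that its two reductions agree. *)
Lemma relsq_cons : relsq << n :: w >>.
Proof.
move=> i; case/or3P: (lt_total i n) => [lin|/eqP ->|lni].
- have [_ tV _] := tX lin.
  rewrite (actY_cons act sw) (actV_cons act sw lin) endorB tV // JVh actVN endoN.
  rewrite (relVY_swap eVY) esq.
  cancel_in_zmod.
- by rewrite (act_square act sw) (actY_cons act sw) Jhh actV0 endo0 addr0.
have sinw : sorted gt (i :: n :: w) by rewrite /= lni.
by rewrite (act_append act sinw) (act_square act sinw).
Qed.

(** Two equal vectors reduce to [relsq_cons]. For l < i the overlap is x_n x_i x_l, resolved by
    [JVVV] if i < n and by [JVh] if i = n; for i > n a rule applies directly. *)
Lemma relVV_cons : relVV << n :: w >>.
Proof.
apply: relVV_basis => i l /orP[/eqP <-|lli].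
  by rewrite hx2 mulr2n actYD endoD relsq_cons.
case/or3P: (lt_total i n) => [lin|/eqP ein|lni].
- have lln := lt_tr lli lin.
  have [_ tVi _] := tX lin; have [_ tVl _] := tX lln.
  rewrite (actY_cons act sw) (actV_cons act sw lin) (actV_cons act sw lln) !endorB.
  rewrite (tVi l) // (tVl i) // !(relVY_swap eVY) JVVV actVD !actVN endoD !endoN.
  rewrite (eVV (x i)) endorD (bVVC _ (x i)).
  cancel_in_zmod.
- rewrite {i}ein in lli *; have [_ _ tsq] := tX lli.
  rewrite (act_square act sw) (actY_cons act sw) (actV_cons act sw lli) endorB tsq.
  rewrite (relVY_swap eVY) JVh (bVVC (x l)) actVN endoN.
  cancel_in_zmod.
have sinw : sorted gt (i :: n :: w) by rewrite /= lni.
by rewrite (act_append act sinw) (actV_cons act sinw lli) subrK.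
Qed.

Lemma relations_at_cons : relations_at << n :: w >>.
Proof.
by split; [apply: relYY_cons | apply: relVY_cons
  | apply: relVV_cons | apply: relsq_cons].
Qed.

End Step.

Lemma relations_at_word w : relations_at << w >>.
Proof.
have [N] := ubnP (size w); elim: N w => // N IH [_|n w wN].
  exact: relations_at_nil.
have [sw|] := boolP (sorted gt (n :: w)); last exact: relations_at_unsorted.
apply: relations_at_cons => // u uw; apply: IH.
by apply: (leq_ltn_trans uw); apply: wN.
Qed.

Lemma right_action_rel :
  [/\ forall y y', actY (bYY y y') = actY y * actY y' - actY y' * actY y,
      forall v y, actV (bVY v y) = actV v * actY y - actY y * actV v,
      forall v v', actY (bVV v v') = actV v * actV v' + actV v' * actV v &
      forall i, actY (hx i) = actV (x i) * actV (x i)].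
Proof.
split=> [y y'|v y|v v'|i]; apply: endo_ext => w;
  have [e1 e2 e3 e4] := relations_at_word w.
- exact: e1.
- exact: e2.
- exact: e3.
exact: e4.
Qed.

End Relations.

(** * Evaluation of words in an algebra *)

Section OrderedProducts.
Context (U : nzRingType) (I : Type) (X : I -> U).

(* The head of a word is the last factor. *)
Definition wprod (w : seq I) : U := foldr (fun i p => p * X i) 1 w.

End OrderedProducts.

Section ToAlgebra.
Context (k : comNzRingType) (A U : algType k) (I : choiceType) (lt : rel I).
Context (iota_ : A -> U) (iota_alg : algmap iota_) (X : I -> U).
Local Notation M := {malg A[seq I]}.
Local Notation desc := (sorted (fun a b => lt b a)).
Local Notation wp := (wprod X).

(** All words index the basis of [M]; those that are not strictly decreasing are sent to 0, in
    accordance with the actions, which kill them. *)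
Definition eval_words (m : M) : U :=
  msum (fun w a => iota_ a * (if desc w then wp w else 0)) m.

Let FD w : {morph (fun a => iota_ a * (if desc w then wp w else 0)) : a b / a + b}.
Proof. by move=> a b; rewrite (algmapD iota_alg) mulrDl. Qed.
Lemma eval_words0 : eval_words 0 = 0. Proof. exact: (msum0 FD). Qed.
Lemma eval_wordsD m p : eval_words (m + p) = eval_words m + eval_words p.
Proof. exact: (msumD FD). Qed.
Lemma eval_wordsB m p : eval_words (m - p) = eval_words m - eval_words p.
Proof. exact: (msumB FD). Qed.
Lemma eval_words_word w : desc w -> eval_words << w >> = wp w.
Proof.
move=> dw; rewrite -[<< w >>]scale1r /eval_words (msumE FD) dw.
by rewrite iota_alg.2.1 mul1r.
Qed.
Lemma eval_words_unsorted w : ~~ desc w -> eval_words << w >> = 0.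
Proof.
by move=> dw; rewrite -[<< w >>]scale1r /eval_words (msumE FD) (negPf dw) mulr0.
Qed.
Lemma eval_wordsZ a m : eval_words (a *: m) = iota_ a * eval_words m.
Proof.
elim/malg_ind: m => [|m p em ep|b w]; first by rewrite scaler0 eval_words0 mulr0.
  by rewrite scalerDr !eval_wordsD em ep mulrDr.
by rewrite scalerA /eval_words !(msumE FD) iota_alg.2.2 mulrA.
Qed.
Lemma eval_words_algZ (c : k) m : eval_words (c%:A *: m) = c *: eval_words m.
Proof. by rewrite eval_wordsZ (algmap_scalar iota_alg) mulr_algl. Qed.

End ToAlgebra.

Section Intertwining.
Context (k : comNzRingType) (A U : algType k) (Y V : lmodType k).
Context (I : choiceType) (lt : rel I).
Context (lt_total : forall a b, [|| lt a b, a == b | lt b a]).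
Context (j : Y -> A).
Context (x : I -> V) (co : V -> {malg k[I]}) (coK : forall v, mext x (co v) = v).
Context (bVY : V -> Y -> V) (bVV : V -> V -> Y) (hx : I -> Y).
Context (actY : {linear Y -> endo A I}) (actV : {linear V -> endo A I}).
Context (act : right_action lt j x bVY bVV hx actY actV).
Context (iota_ : A -> U) (iota_alg : algmap iota_).
Context (gY : Y -> U) (gV : {linear V -> U}).
Context (gYE : forall y, gY y = iota_ (j y)).
Context (gVY : forall v y, gV v * gY y = gY y * gV v + gV (bVY v y)).
Context (gVV : forall i l, gV (x i) * gV (x l) =
  gY (bVV (x i) (x l)) - gV (x l) * gV (x i)).
Context (gsq : forall i, gV (x i) * gV (x i) = gY (hx i)).

Local Notation desc := (sorted (fun a b => lt b a)).
Local Notation eval_words := (eval_words lt iota_ (gV \o x)).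

Lemma eval_words_span (f : endo A I) (u : U) (P : seq I -> Prop) m :
  (forall w, P w -> eval_words (f << w >>) = eval_words << w >> * u) -> mspan P m ->
  eval_words (f m) = eval_words m * u.
Proof.
move=> fP; elim=> [|a w p Pw _ IH].
  by rewrite endor0 (eval_words0 lt iota_alg) mul0r.
rewrite endorD endorZ !(eval_wordsD lt iota_alg) !(eval_wordsZ lt iota_alg).
by rewrite IH fP // mulrDl mulrA.
Qed.

Let actV_all w :
    (forall i, eval_words (actV (x i) << w >>) = eval_words << w >> * gV (x i)) ->
  forall v, eval_words (actV v << w >>) = eval_words << w >> * gV v.
Proof.
move=> e; apply: (V_ind coK) => [|u v eu ev|a i].
- by rewrite !linear0 (eval_words0 lt iota_alg) mulr0.
- by rewrite !linearD endoD (eval_wordsD lt iota_alg) eu ev mulrDr.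
rewrite (linearZ_LR actV) (linearZ_LR gV) endoZ (eval_words_algZ lt iota_alg).
by rewrite e scalerAr.
Qed.

(** The rewriting rules are true identities in U, so evaluation turns the action into right
    multiplication. The induction follows the rules, with the long topped words treated separately
    again. *)
Lemma eval_words_act_word w :
  (forall y, eval_words (actY y << w >>) = eval_words << w >> * gY y) /\
  (forall v, eval_words (actV v << w >>) = eval_words << w >> * gV v).
Proof.
have [N] := ubnP (size w); elim: N w => // N IH w wN.
have [sw|nw] := boolP (desc w); last first.
  have [eY eV] := act_unsorted act nw.
  by split=> z; rewrite ?eY ?eV (eval_words0 lt iota_alg)
    (eval_words_unsorted iota_alg _) // mul0r.
case: w sw wN => [|n w] sw wN.
  split=> [y|].
    rewrite (act_nil act) (eval_wordsZ lt iota_alg).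
    by rewrite (eval_words_word iota_alg _) // mul1r mulr1 gYE.
  apply: actV_all => i; rewrite (act_append act) //.
  by rewrite !(eval_words_word iota_alg _) //= mul1r.
have dw : desc w by move: sw => /path_sorted.
have IHw u : (size u <= size w)%N -> _ := fun uw => IH u (leq_ltn_trans uw wN).
have [wY wV] := IHw w (leqnn _).
have eV i p : mspan (fun u => size u <= size w)%N p ->
    eval_words (actV i p) = eval_words p * gV i.
  by apply: eval_words_span => u uw; have [_ ->] := IHw u uw.
split=> [y|].
  rewrite (actY_cons act sw) (eval_wordsD lt iota_alg) eV; last first.
    exact: (actY_span act).
  by rewrite wY wV -mulrA -mulrDr -gVY mulrA !(eval_words_word iota_alg _).
apply: actV_all => i; case/or3P: (lt_total i n) => [lin|/eqP ->|lni].
- rewrite (actV_cons act sw lin) (eval_wordsB lt iota_alg) wY.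
  have -> : eval_words (actV (x n) (actV (x i) << w >>)) =
      eval_words (actV (x i) << w >>) * gV (x n).
    apply: eval_words_span (actV_span act sw lin) => u.
    case/orP=> [uw|/andP[_ su]]; first by have [_ ->] := IHw u uw.
    rewrite (act_append act su) !(eval_words_word iota_alg _) //.
    by move: su => /path_sorted.
  by rewrite wV -mulrA -mulrBr -gVV mulrA !(eval_words_word iota_alg _).
- by rewrite (act_square act sw) wY -gsq mulrA !(eval_words_word iota_alg _).
have si : desc (i :: n :: w) by rewrite /= lni.
by rewrite (act_append act si) !(eval_words_word iota_alg _).
Qed.

Lemma eval_words_actY y m : eval_words (actY y m) = eval_words m * gY y.
Proof.
elim/malg_ind: m => [|m p em ep|a w].
- by rewrite endor0 (eval_words0 lt iota_alg) mul0r.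
- by rewrite endorD !(eval_wordsD lt iota_alg) em ep mulrDl.
by rewrite endorZ !(eval_wordsZ lt iota_alg) (eval_words_act_word w).1 mulrA.
Qed.

Lemma eval_words_actV v m : eval_words (actV v m) = eval_words m * gV v.
Proof.
elim/malg_ind: m => [|m p em ep|a w].
- by rewrite endor0 (eval_words0 lt iota_alg) mul0r.
- by rewrite endorD !(eval_wordsD lt iota_alg) em ep mulrDl.
by rewrite endorZ !(eval_wordsZ lt iota_alg) (eval_words_act_word w).2 mulrA.
Qed.

End Intertwining.

(** * Quotients by homogeneous relations and coproducts of ordered products *)

Section HomogeneousRelations.
Context (k : comNzRingType) (V : superModType k) (S : prim_rel V).

Lemma hquot_ind (P : hquot S -> Prop) :
    (forall a, P a%:A) -> (forall v, P (hgen S v)) ->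
    (forall u v, P u -> P v -> P (u + v)) ->
    (forall u v, P u -> P v -> P (u * v)) -> forall u, P u.
Proof.
move=> Pc Pg PD PM u; rewrite -[u]hpiK.
elim/talg_ind: (repr u) => [a|v|s t es et|s t es et].
- by rewrite linearZ rmorph1; apply: Pc.
- exact: Pg.
- by rewrite linearD; apply: PD.
by rewrite rmorphM; apply: PM.
Qed.

Section Lift.
Context (hS : forall s, S s -> exists i, homog i s).
Context (A : algType k) (f : V -> A) (fL : linear f).
Context (fS : forall s, S s -> talg_lift f s = 0).

(* Homogeneous relations generate an ideal that is already graded, so that, unlike
   in [hlift_pi], A need not be graded. *)
Lemma hlift_pi_homog t : hlift f (hpi S t) = talg_lift f t.
Proof.
have [lL [l1 lM]] := talg_liftP fL.
pose l : {linear talg V -> A} :=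
  HB.pack (talg_lift f) (GRing.isLinear.Build _ _ _ _ (talg_lift f) lL).
have lD a b : l (a + b) = talg_lift f a + talg_lift f b by apply: linearD.
have partM i (a b : talg V) : spart i (a * b) =
    spart false a * spart i b + spart true a * spart (~~ i) b.
  exact: talg_part_mul.
have lI s : superideal S s -> forall i, l (spart i s) = 0.
  elim=> {s} [s Ss i||a b _ ea _ eb i|a b _ eb i|a b _ eb i|i a _ ea l'].
  - have [i' hi] := hS Ss; rewrite (homog_spart i hi); case: eqP => _.
      exact: fS.
    exact: linear0.
  - by move=> i; rewrite !linear0.
  - by rewrite !linearD ea eb addr0.
  - by rewrite partM lD !lM ![talg_lift f (spart _ b)]eb !mulr0 addr0.
  - by rewrite partM lD !lM ![talg_lift f (spart _ b)]eb !mul0r addr0.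
  by rewrite spartK; case: eqP => // _; rewrite linear0.
apply/eqP; rewrite -subr_eq0; apply/eqP.
rewrite -[LHS](linearB l) -[X in l X]spartD linearD /=.
have I0 := repr_hpi S t.
by rewrite [X in X + _](lI _ I0) [X in _ + X](lI _ I0) addr0.
Qed.

Lemma hliftE_homog v : hlift f (hgen S v) = f v.
Proof. by rewrite hlift_pi_homog talg_liftE. Qed.

Lemma hlift_algmap_homog : algmap (hlift (S := S) f).
Proof.
have [lL [l1 lM]] := talg_liftP fL; split=> [a u v|].
  by rewrite -[u]hpiK -[v]hpiK -linearP !hlift_pi_homog lL.
split=> [|u v]; first by rewrite -[1]/(hpi S 1) hlift_pi_homog l1.
by rewrite -[u]hpiK -[v]hpiK -rmorphM !hlift_pi_homog lM.
Qed.

End Lift.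

Section Words.
Context (I : Type) (X : I -> V) (hX : forall i, homog true (X i)).
Local Notation wp := (wprod (fun i => hgen S (X i))).

Lemma wprod_homog w : homog (odd (size w)) (wp w).
Proof.
elim: w => [|n w IH] /=; first exact: homog1.
rewrite -addbT; apply: homogM IH _.
exact: (even_homog (@hgen_even k V S) (hX n)).
Qed.

Lemma counit_wprod w : counit (wp w) = (nilp w)%:R.
Proof.
case: w => [|n w] /=; first by rewrite rmorph1.
by rewrite rmorphM /= counit_hgen mulr0.
Qed.

End Words.
End HomogeneousRelations.

(* The pairs of complementary subwords (u, v) of w, with the exponent s of the sign
   (-1)^s that u (x) v has in the coproduct of an ordered product of odd primitives. *)
Fixpoint splits (I : Type) (w : seq I) : seq (bool * (seq I * seq I)) :=
  if w is n :: w' then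
    [seq (p.1 (+) odd (size p.2.2), (n :: p.2.1, p.2.2)) | p <- splits w'] ++
    [seq (p.1, (p.2.1, n :: p.2.2)) | p <- splits w']
  else [:: (false, ([::], [::]))].

Lemma splits_subseq (I : eqType) (w : seq I) p :
  p \in splits w -> subseq p.2.1 w && subseq p.2.2 w.
Proof.
elim: w p => [|n w IH] p /=; first by rewrite inE => /eqP ->.
rewrite mem_cat => /orP[] /mapP[q /IH /andP[qu qv] ->] /=;
  rewrite eqxx ?qu ?qv ?andbT /=.
  exact: subseq_trans qv (subseq_cons _ _).
exact: subseq_trans qu (subseq_cons _ _).
Qed.

(** The new last factor x_n passes the whole second tensor factor to reach the first one, which
    costs one sign per letter; hence the parity added in [splits]. *)
Lemma comul_wprod (k : comNzRingType) (V : superModType k) (S : prim_rel V)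
    (I : Type) (X : I -> V) (hX : forall i, homog true (X i)) w :
  comul (wprod (fun i => hgen S (X i)) w) = \sum_(p <- splits w)
    (-1) ^+ p.1 *: (wprod (fun i => hgen S (X i)) p.2.1
                    *t wprod (fun i => hgen S (X i)) p.2.2).
Proof.
have [cL [c1 cM]] := hcomul_algmap S.
have h1 := @homog1 k (hquot S).
elim: w => [|n w IH]; first by rewrite big_seq1 scale1r; apply: c1.
rewrite [LHS]cM -/(comul _) IH hcomul_gen big_cat !big_map mulrDr !mulr_suml.
congr (_ + _); apply: eq_bigr => p _ /=.
  rewrite -scalerAl (ptensM _ _ (wprod_homog _ hX p.2.2)
    (even_homog (@hgen_even k V S) (hX n))).
  by rewrite mulr1 andbT scalerA -signr_addb.
by rewrite -scalerAl (ptensM _ _ (wprod_homog _ hX p.2.2) h1) andbF mulr1 scale1r.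
Qed.

(** Freeness of U over A, through [iota_], on the ordered products: the second clause gives
    independence, the third is spanning in the form of an induction principle. *)
Definition word_basis (k : comNzRingType) (A U : algType k) (I : choiceType)
    (lt : rel I) (iota_ : A -> U) (X : I -> U) (tw : U -> {malg A[seq I]}) :=
  [/\ forall u v, tw (u + v) = tw u + tw v,
      forall a w, sorted (fun a b => lt b a) w ->
        tw (iota_ a * wprod X w) = a *: << w >> &
      forall P : U -> Prop, P 0 -> (forall u v, P u -> P v -> P (u + v)) ->
        (forall a w, sorted (fun a b => lt b a) w -> P (iota_ a * wprod X w)) ->
        forall u, P u].

(** * From an action to a basis of ordered products *)

Section WordBasis.
Context (k : comNzRingType) (A : algType k) (I : choiceType) (lt : rel I).
Context (W : superModType k) (S : prim_rel W).
Context (hS : forall s, S s -> exists i, homog i s).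
Context (f : W -> endo A I) (fL : linear f).
Context (fS : forall s, S s -> talg_lift f s = 0).
Context (iota_ : A -> hquot S) (iota_alg : algmap iota_) (X : I -> W).
Local Notation M := {malg A[seq I]}.
Local Notation desc := (sorted (fun a b => lt b a)).
Local Notation wp := (wprod (fun i => hgen S (X i))).
Local Notation eval_words := (eval_words lt iota_ (fun i => hgen S (X i))).
Context (eval_words_f : forall z m, eval_words (f z m) = eval_words m * hgen S z).
Context (f_append : forall i w, desc (i :: w) -> f (X i) << w >> = << i :: w >>).
Context (f_i : forall a, hlift f (iota_ a) << [::] >> = a *: << [::] >>).

Definition to_words (u : hquot S) : M := hlift f u << [::] >>.

Let rA := hlift_algmap_homog hS fL fS.
Let rM (u v : hquot S) : hlift f (u * v) = hlift f u * hlift f v.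
Proof. exact: rA.2.2. Qed.
Let rD (u v : hquot S) : hlift f (u + v) = hlift f u + hlift f v.
Proof. exact: algmapD rA u v. Qed.

Lemma to_wordsD u v : to_words (u + v) = to_words u + to_words v.
Proof. by rewrite /to_words rD. Qed.

Lemma eval_words_hlift (u : hquot S) m :
  eval_words (hlift f u m) = eval_words m * u.
Proof.
elim/hquot_ind: u m => [c|v|u v eu ev|u v eu ev] m.
- rewrite (algmap_scalar rA).
  by rewrite endoZ (eval_words_algZ lt iota_alg) mulr_algr.
- by rewrite (hliftE_homog hS fL fS) eval_words_f.
- by rewrite rD (eval_wordsD lt iota_alg) eu ev mulrDr.
by rewrite rM ev eu mulrA.
Qed.

(** The empty word evaluates to 1. Hence ordered products span, which is [wprod_ind]. *)
Lemma to_wordsK u : eval_words (to_words u) = u.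
Proof. by rewrite eval_words_hlift (eval_words_word iota_alg) ?mul1r. Qed.

(** The letters of a decreasing word act on the empty word by being put in front one after another;
    this gives independence. *)
Lemma to_words_wprod a w : desc w -> to_words (iota_ a * wp w) = a *: << w >>.
Proof.
move=> dw; rewrite /to_words rM endoM f_i endorZ; congr (_ *: _).
elim: w dw => [|n w IH] dw; first by rewrite /= rA.2.1.
rewrite /= rM endoM IH; last by move: dw => /path_sorted.
by rewrite (hliftE_homog hS fL fS) f_append.
Qed.

Lemma wprod_ind (P : hquot S -> Prop) :
    P 0 -> (forall u v, P u -> P v -> P (u + v)) ->
    (forall a w, desc w -> P (iota_ a * wp w)) -> forall u, P u.
Proof.
move=> P0 PD Pw u; rewrite -(to_wordsK u); elim/malg_ind: (to_words u).
- by rewrite (eval_words0 lt iota_alg).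
- by move=> m p Pm Pp; rewrite (eval_wordsD lt iota_alg); apply: PD.
move=> a w; have [dw|nw] := boolP (desc w); rewrite (eval_wordsZ lt iota_alg).
  by rewrite (eval_words_word iota_alg) //; apply: Pw.
by rewrite (eval_words_unsorted iota_alg) // mulr0.
Qed.

Lemma to_words_basis : word_basis lt iota_ (fun i => hgen S (X i)) to_words.
Proof.
split; [exact: to_wordsD | exact: to_words_wprod | exact: wprod_ind].
Qed.

End WordBasis.

(** Both sides are quadratic in v with the same polarization, so agreement on a basis is enough. *)
Lemma square_of_basis (k : comNzRingType) (V Y : lmodType k) (E : algType k)
    (I : choiceType) (x : I -> V) (co : V -> {malg k[I]})
    (coK : forall v, mext x (co v) = v) (b : V -> V -> Y) (q : V -> Y)
    (F : {linear V -> E}) (G : {linear Y -> E}) :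
    (forall u v, q (u + v) = q u + q v + b u v) ->
    (forall a v, q (a *: v) = (a * a) *: q v) ->
    (forall u v, G (b u v) = F u * F v + F v * F u) ->
    (forall i, G (q (x i)) = F (x i) * F (x i)) ->
  forall v, G (q v) = F v * F v.
Proof.
move=> qD qZ Gb Gx; apply: (V_ind coK) => [|u v eu ev|a i].
- by rewrite -(scale0r 0) qZ mul0r !scale0r !linear0 mul0r.
- rewrite qD !linearD /= eu ev Gb mulrDl !mulrDr -!addrA; congr (_ + _).
  by rewrite addrC -addrA.
by rewrite qZ !linearZ /= Gx -scalerAl -scalerAr scalerA.
Qed.

(** * The basis of the exterior algebra *)

Section ExteriorBasis.
Context (k : comNzRingType) (N : lmodType k).
Local Notation V := (in_degree true N).
Context (I : choiceType) (lt : rel I).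
Context (lt_irr : irreflexive lt) (lt_tr : transitive lt).
Context (lt_total : forall a b, [|| lt a b, a == b | lt b a]).
Context (x : I -> V) (co : {linear V -> {malg k[I]}}).
Context (coK : forall v, mext x (co v) = v) (cox : forall i, co (x i) = << i >>).

Let S := PrimRel (@ext_rel_primitive k N).

Lemma exterior_square (v : V) : hgen S v * hgen S v = 0.
Proof.
rewrite -rmorphM; apply/hpiP; rewrite subr0; apply: SuperidealGen.
exact: ExtRel.
Qed.

Lemma exterior_anticomm (u v : V) : hgen S u * hgen S v = - (hgen S v * hgen S u).
Proof.
apply/eqP; rewrite -addr_eq0; apply/eqP.
have := exterior_square (u + v).
by rewrite linearD mulrDl !mulrDr !exterior_square add0r addr0.
Qed.

Lemma ext_rel_homog s : S s -> exists i, homog i s.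
Proof.
case=> v; exists false; have hv := homog_tgen (in_degree_homog v).
exact: (homogM hv hv).
Qed.

Lemma exterior_basis : exists tw,
  word_basis lt (fun c : k^o => (c : k) *: (1 : exterior N))
    (fun i => hgen S (x i)) tw.
Proof.
have zb (P Q R : lmodType k) : bilin (fun (_ : P) (_ : Q) => 0 : R).
  by split=> u a v w; rewrite scaler0 addr0.
(* Some module has to stand for g_0; it is [V] itself, mapped to k by zero. With zero brackets the
   operators of odd vectors then square to 0. *)
pose j : {linear V -> k^o} := \0.
have [aY [aV act]] := right_action_exists (A := k^o)
  lt_irr lt_tr lt_total j cox (fun _ _ => 0) (fun _ => 0) (zb V V V).
have e1 (y y' : V) : j 0 = j y * j y' - j y' * j y by rewrite /= mul0r subrr.
have z0 (y y' : V) : 0 = 0 + 0 :> V by rewrite addr0.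
have zN (y y' : V) : 0 = - 0 - 0 :> V by rewrite oppr0 addr0.
have zB (y y' : V) : 0 = 0 - 0 :> V by rewrite subr0.
have zN1 : 0 = - 0 :> V by rewrite oppr0.
have zM : 0 = 0 *+ 2 :> V by rewrite mul0rn.
have [_ _ rVV rsq] := right_action_rel lt_tr lt_total coK (bYY := fun _ _ => 0)
  (zb V V V) (zb V V V) (fun _ _ => erefl) (fun _ => zM) e1
  (fun v => zB) (fun _ => z0) (fun _ _ => erefl) (fun _ => zN)
  (fun _ _ => zN1) (fun _ => erefl) act.
have sq v : aV v * aV v = 0.
  rewrite -(square_of_basis coK (b := fun _ _ => 0) (q := fun _ => 0) _ _ rVV rsq).
  - exact: linear0.
  - by move=> *; rewrite !addr0.
  by move=> *; rewrite scaler0.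
have iota_alg : algmap (fun c : k^o => (c : k) *: (1 : exterior N)).
  split=> [a b c|]; first by rewrite scalerDl scalerA.
  by split=> [|a b]; rewrite ?scale1r // -scalerAl mul1r scalerA.
pose gV : {linear V -> exterior N} := hgen S.
exists (to_words (S := S) aV).
have aVL : linear aV := linearP aV.
have aVS s : S s -> talg_lift aV s = 0.
  case=> v; have [_ [_ lM]] := talg_liftP aVL.
  by rewrite lM !(talg_liftE aVL).
apply: (to_words_basis ext_rel_homog aVL aVS iota_alg).
- move=> z m.
  apply: (eval_words_actV lt_total coK act iota_alg (gY := fun _ => 0) (gV := gV)).
  + by move=> y; rewrite /= scale0r.
  + by move=> v y; rewrite !linear0 mul0r mulr0 addr0.
  + by move=> i l; rewrite sub0r; apply: exterior_anticomm.
  by move=> i; apply: exterior_square.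
- exact: (act_append act).
move=> a; rewrite (algmap_scalar (hlift_algmap_homog ext_rel_homog aVL aVS)).
by rewrite endoZ -[_%:A]/(a * 1) mulr1.
Qed.

End ExteriorBasis.

Lemma free_module_basis (k : comNzRingType) (P : lmodType k) : free_module P ->
  exists (I : choiceType) (x : I -> P) (co : {linear P -> {malg k[I]}}),
    (forall v, mext x (co v) = v) /\ (forall i, co (x i) = << i >>).
Proof.
move=> [I [e [e_span e_free]]]; exists I, e.
have inj m : mext e m = 0 -> m = 0.
  move/(e_free _ (mcoeff^~ m) (fset_uniq (msupp m))) => m0.
  apply/malgP => i; rewrite mcoeff0.
  by have [/m0 //|/mcoeff_outdom] := boolP (i \in msupp m).
have surj v : exists m, mext e m = v.
  have [s [c ->]] := e_span v; exists (\sum_(i <- s) c i *: << i >>).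
  by rewrite linear_sum; apply: eq_bigr => i _; rewrite linearZ /= mextE.
pose co v := projT1 (cid (surj v)).
have coK v : mext e (co v) = v by rewrite /co; case: cid.
have inj2 m p : mext e m = mext e p -> m = p.
  by move=> mp; apply/subr0_eq/inj; rewrite linearB /= mp subrr.
have coL : linear co by move=> a u v; apply: inj2; rewrite linearP /= !coK.
pose co_lin : {linear P -> {malg k[I]}} :=
  HB.pack co (GRing.isLinear.Build _ _ _ _ co coL).
exists co_lin; split=> //= i.
by apply: inj2; rewrite coK mextE.
Qed.

Lemma basis_torsion_free (k : comNzRingType) (P : lmodType k) (I : choiceType)
    (x : I -> P) (co : {linear P -> {malg k[I]}}) :
    (forall a : k, a *+ 2 = 0 -> a = 0) -> (forall v, mext x (co v) = v) ->
  forall v : P, v *+ 2 = 0 -> v = 0.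
Proof.
move=> k2 coK v v2; rewrite -(coK v) (_ : co v = 0) ?linear0 //.
apply/malgP => i; rewrite mcoeff0; apply: k2.
by rewrite -mcoeffMn -linearMn v2 linear0 mcoeff0.
Qed.

(** * Half-brackets and the basis of U(g) *)

Section SuperEnvelopeBasis.
Context (k : comNzRingType) (k2 : forall a : k, a *+ 2 = 0 -> a = 0).
Context (g : lieSuperAlgType k) (adm : admissible g).
Local Notation Y := (hpart g false).
Local Notation V := (hpart g true).
Local Notation A := (lie_env Y).
Local Notation U := (super_env g).
Context (I : choiceType) (lt : rel I).
Context (lt_irr : irreflexive lt) (lt_tr : transitive lt).
Context (lt_total : forall a b, [|| lt a b, a == b | lt b a]).
Context (x : I -> V) (co : {linear V -> {malg k[I]}}).
Context (coK : forall v, mext x (co v) = v) (cox : forall i, co (x i) = << i >>).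

Let S := PrimRel (@super_env_rel_primitive k g).

Definition bVY (v : V) (y : Y) : V :=
  to_hpart (slie_homog (hpart_homog v) (hpart_homog y)).
Definition bVV (u v : V) : Y :=
  to_hpart (slie_homog (hpart_homog u) (hpart_homog v)).

Let vI (i : bool) (u v : hpart g i) : hpart_val u = hpart_val v -> u = v.
Proof. exact: hpart_val_inj. Qed.

Lemma bVY_bilin : bilin bVY.
Proof.
have E u v : hpart_val (bVY u v) = slie (hpart_val u) (hpart_val v) by [].
split=> z a u v; apply: vI; rewrite [RHS]hpart_val_linear !E hpart_val_linear.
  exact: slie_bilin.1.
exact: slie_bilin.2.
Qed.

Lemma bVV_bilin : bilin bVV.
Proof.
have E u v : hpart_val (bVV u v) = slie (hpart_val u) (hpart_val v) by [].
split=> z a u v; apply: vI; rewrite [RHS]hpart_val_linear !E hpart_val_linear.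
  exact: slie_bilin.1.
exact: slie_bilin.2.
Qed.

Let Y2 (y : Y) : y *+ 2 = 0 -> y = 0.
Proof. by case: adm => fl _ _; apply: flat_torsion_free. Qed.

Let V2 (v : V) : v *+ 2 = 0 -> v = 0.
Proof. exact: basis_torsion_free coK v. Qed.

Let Y2I (y y' : Y) : y *+ 2 = y' *+ 2 -> y = y'.
Proof. by move=> e; apply/subr0_eq/Y2; rewrite mulrnBl e subrr. Qed.
Let V2I (y y' : V) : y *+ 2 = y' *+ 2 -> y = y'.
Proof. by move=> e; apply/subr0_eq/V2; rewrite mulrnBl e subrr. Qed.

Let half_ex (v : V) : exists y : Y, bVV v v = y *+ 2.
Proof.
case: adm => _ _ /(_ _ (hpart_homog v)) [u [hu e]].
by exists (to_hpart hu); apply: vI; rewrite linearMn /= -e.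
Qed.

(** A choice only in form: 2 can be cancelled in g_0, so the value is unique, and this makes it
    quadratic in v ([halfD], [halfZ]). *)
Definition half (v : V) : Y := projT1 (cid (half_ex v)).

Let halfE v : bVV v v = half v *+ 2.
Proof. by rewrite /half; case: cid. Qed.

Let bYDl (u v : Y) y : lie (u + v) y = lie u y + lie v y.
Proof. by have := (lie_bilin (s := Y)).1 y 1 u v; rewrite !scale1r. Qed.
Let bVYD v (y y' : Y) : bVY v (y + y') = bVY v y + bVY v y'.
Proof. by have := bVY_bilin.2 v 1 y y'; rewrite !scale1r. Qed.
Let bVYDl (u v : V) y : bVY (u + v) y = bVY u y + bVY v y.
Proof. by have := bVY_bilin.1 y 1 u v; rewrite !scale1r. Qed.
Let bVVD v (u u' : V) : bVV v (u + u') = bVV v u + bVV v u'.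
Proof. by have := bVV_bilin.2 v 1 u u'; rewrite !scale1r. Qed.
Let bVVDl (u v w : V) : bVV (u + v) w = bVV u w + bVV v w.
Proof. by have := bVV_bilin.1 w 1 u v; rewrite !scale1r. Qed.
Let bVVZ v a (u : V) : bVV v (a *: u) = a *: bVV v u.
Proof.
have v0 : bVV v 0 = 0 by apply: (addrI (bVV v 0)); rewrite -bVVD !addr0.
by have := bVV_bilin.2 v a u 0; rewrite v0 !addr0.
Qed.

Let slieNl (a b : g) : slie (- a) b = - slie a b.
Proof.
have s0 : slie 0 b = 0.
  by have := slie_bilin.1 b (-1) 0 0; rewrite scaler0 addr0 scaleN1r addNr.
by have := slie_bilin.1 b (-1) a 0; rewrite s0 !addr0 !scaleN1r.
Qed.

Let antiE i j (u v : g) : homog i u -> homog j v -> ~~ (i && j) ->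
  slie u v = - slie v u.
Proof.
move=> hu hv /negPf e; apply/eqP; rewrite -addr_eq0.
by have := slie_antisym _ _ _ _ hu hv; rewrite e scale1r => ->.
Qed.

Let symE (u v : g) : homog true u -> homog true v -> slie u v = slie v u.
Proof.
move=> hu hv; apply/eqP; rewrite -subr_eq0; apply/eqP.
by have := slie_antisym _ _ _ _ hu hv; rewrite scaleN1r.
Qed.

Let bVVC u v : bVV u v = bVV v u.
Proof. by apply: vI; apply: symE; apply: hpart_homog. Qed.

Let bVY_lie v (y y' : Y) : bVY v (lie y y') = bVY (bVY v y) y' - bVY (bVY v y') y.
Proof.
apply: vI; rewrite linearB /=.
have [hv hy hy'] := And3 (hpart_homog v) (hpart_homog y) (hpart_homog y').
have := slie_jacobi hv hy hy'; rewrite !scale1r /=.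
rewrite (antiE (slie_homog hy hy') hv) // (antiE hy' hv) // slieNl.
by rewrite addrAC => /subr0_eq.
Qed.

Let lie_bVV u v (y : Y) : lie (bVV u v) y = bVV (bVY u y) v + bVV u (bVY v y).
Proof.
apply: vI; rewrite linearD /=.
have [hu hv hy] := And3 (hpart_homog u) (hpart_homog v) (hpart_homog y).
have := slie_jacobi hu hv hy; rewrite /= scale1r scaleN1r.
rewrite (symE (slie_homog hv hy) hu) (antiE hy hu) // slieNl.
rewrite -addrA -opprD => /subr0_eq; rewrite addrC => -> //.
Qed.

Let bVY_bVV u v w : bVY u (bVV v w) = - bVY w (bVV u v) - bVY v (bVV u w).
Proof.
apply: vI; rewrite linearB linearN /=.
have [hu hv hw] := And3 (hpart_homog u) (hpart_homog v) (hpart_homog w).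
have := slie_jacobi hv hw hu; rewrite /= !scale1r.
rewrite (antiE (slie_homog hv hw) hu) // (antiE (slie_homog hw hu) hv) //.
rewrite (antiE (slie_homog hu hv) hw) // (symE hw hu) => /eqP.
by rewrite -addrA addr_eq0 => /eqP e; rewrite -[LHS]opprK e; cancel_in_zmod.
Qed.

(** As in the next two identities, the doubled statement concerns [bVV v v] and follows from the
    axioms of g; then 2 is cancelled. *)
Let lie_half v (y : Y) : lie (half v) y = bVV (bVY v y) v.
Proof.
apply: Y2I; rewrite [LHS]mulr2n -bYDl -[half v + _]mulr2n -halfE lie_bVV.
by rewrite (bVVC v) mulr2n.
Qed.

Let bVY_half u v : bVY u (half v) = - bVY v (bVV u v).
Proof.
apply: V2I; rewrite [LHS]mulr2n -bVYD -[half v + _]mulr2n -halfE bVY_bVV.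
by rewrite mulr2n.
Qed.

Let bVY_half0 v : bVY v (half v) = 0.
Proof.
apply: V2; rewrite mulr2n -bVYD -[half v + _]mulr2n -halfE; apply: vI.
rewrite linear0 /=.
have hv := hpart_homog v; rewrite (antiE hv (slie_homog hv hv)) //.
by rewrite slie_odd ?oppr0.
Qed.

Let halfD u v : half (u + v) = half u + half v + bVV u v.
Proof.
apply: Y2I; rewrite -halfE bVVDl !bVVD !halfE mulrnDl mulrnDl (bVVC v).
move: (half u) (half v) (bVV u v) => a b c; rewrite !mulr2n; cancel_in_zmod.
Qed.

Let halfZ a v : half (a *: v) = (a * a) *: half v.
Proof.
apply: Y2I; rewrite -halfE bVVZ bVVC bVVZ halfE.
by rewrite scalerA scalerMnr.
Qed.

Let R0 := PrimRel (@lie_env_rel_primitive k Y).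

Let lie_env_bracket (y y' : Y) : hgen R0 (lie y y' : in_degree false Y) =
  hgen R0 (y : in_degree false Y) * hgen R0 (y' : in_degree false Y) -
  hgen R0 (y' : in_degree false Y) * hgen R0 (y : in_degree false Y).
Proof.
rewrite -!rmorphM -linearB; apply/esym/hpiP; apply: SuperidealGen.
exact: LieEnvRel.
Qed.

Let env_bracket i l (z w : g) : homog i z -> homog l w ->
  hgen S z * hgen S w =
  (-1) ^+ (i && l) *: (hgen S w * hgen S z) + hgen S (slie z w).
Proof.
move=> hz hw; have <- : hgen S z * hgen S w -
    (-1) ^+ (i && l) *: (hgen S w * hgen S z) = hgen S (slie z w).
  rewrite -!rmorphM -linearZ -linearB.
  by apply/hpiP; apply: SuperidealGen; apply: SuperEnvBracket.
by rewrite addrC subrK.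
Qed.

Let env_square (v : V) : hgen S (hpart_val v) * hgen S (hpart_val v) =
  hgen S (hpart_val (half v)).
Proof.
rewrite -rmorphM; apply/hpiP; apply: SuperidealGen.
apply: SuperEnvSquare; try exact: hpart_homog.
by rewrite -linearMn -halfE.
Qed.

Lemma super_env_rel_homog s : S s -> exists i, homog i s.
Proof.
have homogB i (u v : talg g) : homog i u -> homog i v -> homog i (u - v).
  by move=> hu hv; rewrite -scaleN1r; apply: homogD hu (homogZ _ hv).
case=> [i l z w hz hw|v u hv hu _].
  exists (i (+) l); apply: (homogB); first apply: (homogB).
  - by apply: homogM; apply: homog_tgen.
  - by apply: homogZ; rewrite addbC; apply: homogM; apply: homog_tgen.
  by apply: homog_tgen; apply: slie_homog.
exists false; apply: homogB; last exact: homog_tgen.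
by rewrite -(addbb true); apply: homogM; apply: homog_tgen.
Qed.

Let part i (z : g) : hpart g i := to_hpart (spart_homog i z).

Let part_linear i : linear (part i).
Proof.
move=> a u v; apply: vI; rewrite [RHS]hpart_val_linear.
by rewrite [LHS]/= linearP.
Qed.

Let part_homog i (z : g) (hz : homog i z) : part i z = to_hpart hz.
Proof. by apply: vI. Qed.

Let part_homog0 i (z : g) : homog i z -> part (~~ i) z = 0.
Proof.
move=> hz; apply: vI; rewrite linear0 /= (homog_spart _ hz).
by case: (i).
Qed.

Lemma super_env_basis : exists tw,
  word_basis lt (@env_incl k g) (fun i => hgen S (hpart_val (x i))) tw.
Proof.
have jL : linear (hgen R0 : Y -> A).
  by move=> a u v; apply: (linearP (hgen R0 : in_degree false Y -> A)).
pose j : {linear Y -> A} := HB.pack (hgen R0 : Y -> A)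
  (GRing.isLinear.Build k Y A *:%R (hgen R0 : Y -> A) jL).
have [aY [aV act]] := right_action_exists (A := A)
  lt_irr lt_tr lt_total j cox bVV (half \o x) bVY_bilin.
have [rYY rVY rVV rsq0] := right_action_rel lt_tr lt_total coK (bYY := @lie k Y)
  bVY_bilin bVV_bilin bVVC (fun i => halfE (x i)) lie_env_bracket bVY_lie lie_bVV
  (fun i => lie_half (x i)) bVY_bVV (fun v i => bVY_half v (x i))
  (fun i => bVY_half0 (x i)) act.
(* The envelope imposes a square relation for every odd v, not only for the [x i]. *)
have rsq := square_of_basis coK halfD halfZ rVV rsq0.
pose f (z : g) : endo A I := aY (part false z) + aV (part true z).
have fL : linear f.
  by move=> a u v; rewrite /f !part_linear !linearP scalerDr addrACA.
have f0 (y : Y) : f (hpart_val y) = aY y.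
  rewrite /f (part_homog (hpart_homog y)) (part_homog0 (hpart_homog y)) linear0.
  by rewrite addr0; congr (aY _); apply: vI.
have f1 (v : V) : f (hpart_val v) = aV v.
  rewrite /f (part_homog (hpart_homog v)) (part_homog0 (hpart_homog v)) linear0.
  by rewrite add0r; congr (aV _); apply: vI.
have fN a : f (- a) = - f a.
  pose h : {linear g -> endo A I} :=
    HB.pack f (GRing.isLinear.Build k g (endo A I) *:%R f fL).
  exact: (linearN h).
have fS s : S s -> talg_lift f s = 0.
  have [lL [_ lM]] := talg_liftP fL.
  have lB a b : talg_lift f (a - b) = talg_lift f a - talg_lift f b.
    by rewrite addrC -scaleN1r lL scaleN1r addrC.
  have lZ c a : talg_lift f (c *: a) = c *: talg_lift f a.
    by rewrite -[c *: a]subr0 lB -(subrr a) lB subrr subr0 -[c *: a]addr0 lL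
      -(subrr a) lB subrr addr0.
  case=> [i l z w hz hw|v u hv hu e].
    rewrite !(lB, lZ) !lM !(talg_liftE fL); apply/eqP; rewrite subr_eq0; apply/eqP.
    case: i hz => hz; case: l hw => hw; rewrite /= ?scale1r ?scaleN1r ?opprK.
    - rewrite (f1 (to_hpart hz)) (f1 (to_hpart hw)) -rVV.
      exact: esym (f0 (bVV (to_hpart hz) (to_hpart hw))).
    - rewrite (f1 (to_hpart hz)) (f0 (to_hpart hw)) -rVY.
      exact: esym (f1 (bVY (to_hpart hz) (to_hpart hw))).
    - rewrite (f0 (to_hpart hz)) (f1 (to_hpart hw)) (antiE hz hw) // fN.
      by rewrite -[LHS]opprB -rVY -(f1 (bVY (to_hpart hw) (to_hpart hz))).
    rewrite (f0 (to_hpart hz)) (f0 (to_hpart hw)) -rYY.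
    exact: esym (f0 (lie (to_hpart hz) (to_hpart hw))).
  rewrite lB lM !(talg_liftE fL).
  (* An even u with [v, v] = 2u must be [half v], again by cancelling 2. *)
  rewrite (f1 (to_hpart hv)) (f0 (to_hpart hu)) -rsq; apply/eqP.
  rewrite subr_eq0; apply/eqP; congr (aY _); apply: Y2I; rewrite -halfE.
  by apply: vI; rewrite linearMn.
have fA := hlift_algmap_homog super_env_rel_homog fL fS.
have fgen z := hliftE_homog super_env_rel_homog fL fS z.
exists (to_words (S := S) f).
apply: (to_words_basis super_env_rel_homog fL fS (env_incl_algmap g)).
- move=> z m; rewrite /f endoD (eval_wordsD lt (env_incl_algmap g)).
  pose gY (y : Y) : U := hgen S (hpart_val y).
  have gVL : linear (fun v : V => hgen S (hpart_val v) : U).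
    by move=> a u v; rewrite hpart_val_linear linearP.
  pose gV : {linear V -> U} := HB.pack (fun v : V => hgen S (hpart_val v) : U)
    (GRing.isLinear.Build k V U *:%R (fun v : V => hgen S (hpart_val v) : U) gVL).
  have gYE y : gY y = env_incl (j y) by rewrite [RHS]env_inclE.
  have gVY v y : gV v * gY y = gY y * gV v + gV (bVY v y).
    by rewrite (env_bracket (hpart_homog v) (hpart_homog y)) scale1r.
  have gVV i l : gV (x i) * gV (x l) = gY (bVV (x i) (x l)) - gV (x l) * gV (x i).
    rewrite (env_bracket (hpart_homog _) (hpart_homog _)).
    by rewrite scaleN1r addrC.
  have gsq i : gV (x i) * gV (x i) = gY (half (x i)) := env_square (x i).
  have iA := env_incl_algmap g.
  rewrite (eval_words_actY lt_total coK act iA gYE gVY gVV gsq).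
  rewrite (eval_words_actV lt_total coK act iA gYE gVY gVV gsq).
  by rewrite -mulrDr -[in RHS](spartD z) linearD.
- by move=> i w dw; rewrite f1 (act_append act).
(* For a product ab, the factor a produced first on the empty word is pulled out of the operator of
   b by A-linearity. *)
move=> a; elim/hquot_ind: a => [c|y|a b ea eb|a b ea eb].
- rewrite (algmap_scalar (env_incl_algmap g)) (algmap_scalar fA).
  by rewrite endoZ.
- by rewrite env_inclE fgen (f0 y) (act_nil act).
- rewrite (algmapD (env_incl_algmap g)) (algmapD fA) endoD ea eb.
  by rewrite scalerDl.
rewrite (env_incl_algmap g).2.2 fA.2.2 endoM ea endorZ eb.
by rewrite scalerA.
Qed.

End SuperEnvelopeBasis.

(* The product of a quotient of T(W) by primitives is a coalgebra map, because
   comul is multiplicative. *)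
Lemma comul_product (k : comNzRingType) (W : superModType k) (S : prim_rel W)
    (C D : superCoalgType k) (F : {linear C -> hquot S})
    (G : {linear D -> hquot S}) (P : {linear tensor C D -> hquot S}) :
    (forall a, comul (F a) = tmap F F (comul a)) ->
    (forall u, comul (G u) = tmap G G (comul u)) ->
    is_even F -> is_even G -> (forall a u, P (a *t u) = F a * G u) ->
  forall t, comul (P t) = tmap P P (comul t).
Proof.
move=> Fc Gc FE GE PE.
have e : @mulmap k (hquot S) \o tmap F G =1 P.
  apply: (tensor_ext (f := @mulmap k (hquot S) \o tmap F G)) => a u.
  by rewrite /= tmapE mulmapE PE.
have [_ [_ cM]] := hcomul_algmap S.
have key a u : comul (P (a *t u)) = tmap P P (comul (a *t u)).
  rewrite PE [LHS]cM -/(comul _) -/(comul (G u)) Fc Gc [comul (a *t u)]tens_comulE.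
  rewrite -[LHS]/(tmap (@mulmap k _) (@mulmap k _)
    (tmid (tmap F F (comul a) *t tmap G G (comul u)))).
  by rewrite tmid_natural // tmap_comp; apply: tmap_eq.
exact: (tensor_ext (f := @comul k (hquot S) \o P)
  (g := tmap P P \o @comul k (tensor C D)) key).
Qed.

(** * The isomorphism and its compatibilities *)

Section EnvelopeInclusion.
Context (k : comNzRingType) (g : lieSuperAlgType k).
Local Notation incl := (@env_incl k g).

HB.instance Definition _ := GRing.isLinear.Build k (lie_env (hpart g false))
  (super_env g) *:%R incl (env_incl_algmap g).1.

Lemma env_incl_comul a : comul (incl a) = tmap incl incl (comul a).
Proof.
have iA := env_incl_algmap g; have iE := @env_incl_even k g.
apply: (hquot_ext (f := comul \o incl) (g := tmap incl incl \o comul)) => [||v] /=.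
- exact: algmap_comp (hcomul_algmap _) iA.
- exact: algmap_comp (tmap_algmap iA iA iE iE) (hcomul_algmap _).
rewrite env_inclE [LHS]hcomul_gen [comul _]hcomul_gen linearD /= !tmapE /=.
by rewrite env_inclE iA.2.1.
Qed.

Lemma env_incl_counit a : counit (incl a) = counit a.
Proof.
have iA := env_incl_algmap g; elim/hquot_ind: a => [c|v|a b ea eb|a b ea eb].
- by rewrite (algmap_scalar iA) !linearZ /= !rmorph1.
- by rewrite env_inclE !counit_hgen.
- by rewrite !linearD /= ea eb.
by rewrite iA.2.2 !rmorphM /= ea eb.
Qed.

End EnvelopeInclusion.

Section TensorDecomposition.
Context (k : comNzRingType) (g : lieSuperAlgType k).
Local Notation A := (lie_env (hpart g false)).
Local Notation L := (exterior (hpart g true)).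
Local Notation U := (super_env g).
Local Notation incl := (@env_incl k g).
Context (I : choiceType) (lt : rel I) (lt_tr : transitive lt).
Context (x : I -> in_degree true (hpart g true)).

Let SL := PrimRel (@ext_rel_primitive k (hpart g true)).
Let SU := PrimRel (@super_env_rel_primitive k g).
Let xU (i : I) : g := hpart_val (x i).
Local Notation wL := (wprod (fun i => hgen SL (x i))).
Local Notation wU := (wprod (fun i => hgen SU (xU i))).
Local Notation desc := (sorted (fun a b => lt b a)).

Context (tL : L -> {malg k^o[seq I]}) (tU : U -> {malg A[seq I]}).
Context (tL_basis : word_basis lt (fun c : k^o => (c : k) *: (1 : L))
  (fun i => hgen SL (x i)) tL).
Context (tU_basis : word_basis lt incl (fun i => hgen SU (xU i)) tU).

Let xL_odd i : homog true (x i). Proof. exact: in_degree_homog. Qed.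
Let xU_odd i : homog true (xU i). Proof. exact: hpart_homog. Qed.

Lemma exterior_ind (P : L -> Prop) :
    P 0 -> (forall u v, P u -> P v -> P (u + v)) ->
    (forall (c : k) w, desc w -> P (c *: wL w)) -> forall u, P u.
Proof.
move=> P0 PD Pw; case: tL_basis => _ _ /(_ P); apply=> // c w dw.
by rewrite mulr_algl; apply: Pw.
Qed.

(** This map is tied to the ordered basis and is not multiplicative in general, so the coalgebra
    structure is compared on ordered products. *)
Definition quantize (u : L) : U := msum (fun w (c : k^o) => (c : k) *: wU w) (tL u).

Let FD w : {morph (fun c : k^o => (c : k) *: wU w) : a b / a + b}.
Proof. by move=> a b; apply: scalerDl. Qed.

Lemma quantizeE (c : k) w : desc w -> quantize (c *: wL w) = c *: wU w.
Proof.
case: tL_basis => _ e _ dw; rewrite -[c *: wL w]mulr_algl /quantize (e c w dw).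
exact: (msumE FD).
Qed.

Lemma quantize_linear : linear quantize.
Proof.
have tD u v : quantize (u + v) = quantize u + quantize v.
  by case: tL_basis => e _ _; rewrite /quantize e (msumD FD).
move=> c u v; rewrite tD; congr (_ + _).
elim/exterior_ind: u => [|u u' eu eu'|b w dw].
- by rewrite scaler0 (_ : quantize 0 = 0) ?scaler0 //;
    apply: (addrI (quantize 0)); rewrite -tD !addr0.
- by rewrite scalerDr !tD eu eu' scalerDr.
by rewrite scalerA !quantizeE // scalerA.
Qed.

HB.instance Definition _ :=
  GRing.isLinear.Build k L U *:%R quantize quantize_linear.

Lemma quantize_wprod w : desc w -> quantize (wL w) = wU w.
Proof. by move=> dw; rewrite -[wL w]scale1r quantizeE // scale1r. Qed.

Lemma quantize_even : is_even quantize.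
Proof.
move=> i u; elim/exterior_ind: u => [|u v eu ev|c w dw].
- by rewrite !linear0.
- by rewrite !linearD /= eu ev.
rewrite !linearZ /= quantize_wprod //.
rewrite (homog_spart i (wprod_homog SL xL_odd w)).
rewrite (homog_spart i (wprod_homog SU xU_odd w)).
by case: eqP => _; rewrite ?linear0 // quantize_wprod.
Qed.

(** Subwords of a decreasing word are decreasing, so [quantize] can be evaluated on both factors of
    every term of the coproduct. *)
Lemma quantize_comul u : comul (quantize u) = tmap quantize quantize (comul u).
Proof.
elim/exterior_ind: u => [|u v eu ev|c w dw]; first by rewrite !linear0.
  by rewrite !linearD /= eu ev.
rewrite !linearZ /= quantize_wprod //; congr (_ *: _).
rewrite (comul_wprod SU xU_odd) [comul (wL w)](comul_wprod SL xL_odd) linear_sum.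
rewrite big_seq [RHS]big_seq; apply: eq_bigr => p /splits_subseq /andP[pu pv].
have gt_tr : transitive (fun a b => lt b a) by move=> a b c' ab bc; apply: lt_tr ab.
rewrite linearZ /= tmapE /= !quantize_wprod //.
  exact: (subseq_sorted gt_tr pv).
exact: (subseq_sorted gt_tr pu).
Qed.

Lemma quantize_counit u : counit (quantize u) = counit u.
Proof.
elim/exterior_ind: u => [|u v eu ev|c w dw]; first by rewrite !linear0.
  by rewrite !linearD /= eu ev.
rewrite !linearZ /= quantize_wprod //; congr (_ * _).
by rewrite [LHS](counit_wprod SU) [RHS](counit_wprod SL).
Qed.

Let b : bilin (fun a u => incl a * quantize u).
Proof.
split=> z a u v; rewrite linearP /=; first by rewrite mulrDl scalerAl.
by rewrite mulrDr scalerAr.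
Qed.

Definition decomp : tensor A L -> U := tlift (fun a u => incl a * quantize u).

HB.instance Definition _ :=
  GRing.isLinear.Build k (tensor A L) U *:%R decomp (tlift_linear b).

Lemma decompE a u : decomp (a *t u) = incl a * quantize u.
Proof. exact: tliftE b a u. Qed.

Lemma decomp_even : is_even decomp.
Proof.
apply: tensor_even => i l a u ha hu; rewrite /= decompE.
exact: homogM (even_homog (@env_incl_even k g) ha) (even_homog quantize_even hu).
Qed.

Lemma decomp_comul t : comul (decomp t) = tmap decomp decomp (comul t).
Proof.
exact: (comul_product (S := SU) (C := A) (D := L) (F := incl) (G := quantize)
  (P := decomp) (@env_incl_comul k g) quantize_comul (@env_incl_even k g)
  quantize_even decompE).
Qed.

Lemma decomp_counit t : counit (decomp t) = counit t.
Proof.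
elim/tensor_ind: t => [|s t es et|a u]; first by rewrite !linear0.
  by rewrite !linearD /= es et.
by rewrite decompE rmorphM /= env_incl_counit quantize_counit counit_ptens.
Qed.

Lemma decomp_bij : bijective decomp.
Proof.
(* The inverse expands an element in ordered products and sends a x_w to a tensor x_w. *)
pose G w (a : A) : tensor A L := a *t wL w.
have GD w : {morph G w : a a' / a + a'} by move=> a a'; apply: ptensDl.
case: tU_basis => tD tE tind.
have t0 : tU 0 = 0 by apply: (addrI (tU 0)); rewrite -tD !addr0.
exists (fun u => msum G (tU u)).
  elim/tensor_ind => [|s t es et|a u].
  - by rewrite linear0 t0 (msum0 GD).
  - by rewrite linearD tD (msumD GD) es et.
  elim/exterior_ind: u => [|u v eu ev|c w dw].
  - by rewrite ptens0r linear0 t0 (msum0 GD).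
  - by rewrite ptensDr linearD tD (msumD GD) eu ev.
  rewrite ptensZr -ptensZl decompE quantize_wprod // tE // (msumE GD) //.
elim/tind => [|u v eu ev|a w dw].
- by rewrite t0 (msum0 GD) linear0.
- by rewrite tD (msumD GD) linearD /= eu ev.
by rewrite tE // (msumE GD) /G decompE quantize_wprod.
Qed.

Lemma decomp_left u t : decomp (tmap ( *%R u) idfun t) = incl u * decomp t.
Proof.
have bu : bilin (fun a v => (u * a : A) *t (v : L)).
  split=> z a s t'; last by rewrite ptensDr ptensZr.
  by rewrite mulrDr -scalerAr ptensDl ptensZl.
have tuL := tlift_linear bu; rewrite -/(tmap _ _) in tuL.
pose h : {linear tensor A L -> tensor A L} := HB.pack (tmap ( *%R u) idfun)
  (GRing.isLinear.Build k _ _ *:%R (tmap ( *%R u) idfun) tuL).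
have hD s r : tmap ( *%R u) idfun (s + r) = h s + h r by exact: (linearD h).
have decompD s r : decomp (s + r) = decomp s + decomp r by exact: linearD.
elim/tensor_ind: t => [|s r es er|a v].
- by rewrite [tmap _ _ 0](linear0 h) !linear0 mulr0.
- by rewrite hD !decompD mulrDr es er.
by rewrite [tmap _ _ _](tliftE bu) !decompE (env_incl_algmap g).2.2 mulrA.
Qed.

Lemma decomp1 : decomp (1 *t 1) = 1.
Proof.
rewrite decompE (env_incl_algmap g).2.1 mul1r.
exact: (quantize_wprod (w := [::])).
Qed.

Lemma tensor_decomposition : exists f : {linear tensor A L -> U},
  [/\ super_coalgebra_iso f,
      forall (u : A) (t : tensor A L), f (tmap ( *%R u) idfun t) = incl u * f t &
      f (1 *t 1) = 1].
Proof.
exists decomp; split; last exact: decomp1.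
  split; [exact: decomp_bij | exact: decomp_even | exact: decomp_comul
    | exact: decomp_counit].
exact: decomp_left.
Qed.

End TensorDecomposition.

Theorem corollary3p6 (k : comNzRingType)
    (k_2torsion_free : forall a : k, a *+ 2 = 0 -> a = 0)
    (g : lieSuperAlgType k) (g_admissible : admissible g) :
  exists phi : {linear tensor (lie_env (hpart g false)) (exterior (hpart g true))
                       -> super_env g},
    [/\ super_coalgebra_iso phi,
        forall (u : lie_env (hpart g false))
               (x : tensor (lie_env (hpart g false)) (exterior (hpart g true))),
          phi (tmap ( *%R u) idfun x) = env_incl u * phi x &
        phi (1 *t 1) = 1].
Proof.
have [_ g1_free _] := g_admissible.
have [I [x [co [coK cox]]]] := free_module_basis g1_free.
have [lt [lt_irr lt_tr lt_total]] := strict_total_order I.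
(* Both bases use the same ordered basis of g_1, because [quantize] matches products along equal
   words. *)
have [tL tL_basis] := exterior_basis (N := hpart g true)
  lt_irr lt_tr lt_total coK cox.
have [tU tU_basis] := super_env_basis k_2torsion_free g_admissible
  lt_irr lt_tr lt_total coK cox.
by have := tensor_decomposition lt_tr tL_basis tU_basis.
Qed.
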